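(* Let $W=W(\Gamma,\mathbf m)$ be a graph product of primary cyclic groups and suppose $\Gamma$ is a tree. Then the outer automorphism group $\operatorname{Aut}W/\operatorname{Inn}W$ is virtually torsion-free and $$\operatorname{vcd}(\operatorname{Aut}W/\operatorname{Inn}W)=|V_1|-2,$$ where $V_1$ is the set of vertices of $\Gamma$ of valence one (leaves).
   Context: $\Gamma$ is a finite simplicial graph with non-empty vertex set $V=\{v_1,\dots,v_N\}$. Each index $i$ is given a label $\mathbf m(i)$ which is a prime power $p^\alpha$, $\alpha\ge1$. The graph product of primary cyclic groups $W=W(\Gamma,\mathbf m)$ is the group with generators $V$ and relations $v_i^{\mathbf m(i)}=1$ and $v_jv_k=v_kv_j$ whenever $v_j,v_k$ are adjacent in $\Gamma$. $\operatorname{Inn}W$ is the group of inner automorphisms of $W$. $\operatorname{vcd}$ denotes virtual cohomological dimension.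
   Formalization: For the tree with a single vertex, which has no leaves, the printed formula would give −2 although Out W is finite; there the formal statement takes the value 0 (|V_1|−2 is truncated at 0). For all trees with at least two vertices the formula is unchanged. *)

(* Defs.v *)
From HB Require Import structures.
From mathcomp Require Import all_boot all_order all_algebra.
From mathcomp Require Import boolp.

Set Implicit Arguments.
Unset Strict Implicit.
Unset Printing Implicit Defensive.

Import GRing.Theory.
Local Open Scope group_scope.
Local Open Scope quotient_scope.

(** * Groups given by generators and relations *)

(* The letter [(v, false)] stands for [v], and [(v, true)] for [v^-1]. *)
Definition word (V : choiceType) : Type := seq (V * bool).

Definition inv_word (V : choiceType) (w : word V) : word V :=
  rev [seq (l.1, ~~ l.2) | l <- w].

(* [R u v] is the relation [u = v]. *)
Inductive word_cong (V : choiceType) (R : word V -> word V -> Prop) :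
    word V -> word V -> Prop :=
| wc_rel u v : R u v -> word_cong R u v
| wc_cancel l : word_cong R [:: l; (l.1, ~~ l.2)] [::]
| wc_cat u u' v v' :
    word_cong R u u' -> word_cong R v v' -> word_cong R (u ++ v) (u' ++ v')
| wc_refl u : word_cong R u u
| wc_sym u v : word_cong R u v -> word_cong R v u
| wc_trans u v w : word_cong R u v -> word_cong R v w -> word_cong R u w.

Section Presented.
Variables (V : choiceType) (R : word V -> word V -> Prop).

Definition wcongb : rel (seq (V * bool)) := fun u v => `[< word_cong R u v >].

Lemma wcongb_refl : reflexive wcongb.
Proof. by move=> u; apply/asboolP/wc_refl. Qed.

Lemma wcongb_sym : symmetric wcongb.
Proof. by move=> u v; apply/asboolP/asboolP; apply: wc_sym. Qed.

Lemma wcongb_trans : transitive wcongb.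
Proof.
by move=> v u w /asboolP uv /asboolP vw; apply/asboolP/(wc_trans uv vw).
Qed.

Canonical wcongb_equiv := EquivRel wcongb wcongb_refl wcongb_sym wcongb_trans.

Definition presented : Type := {eq_quot wcongb}.

HB.instance Definition _ := Choice.on presented.
HB.instance Definition _ := EqQuotient.on presented.

Lemma presented_eq (u v : word V) :
  \pi_presented u = \pi_presented v <-> word_cong R u v.
Proof. by split=> [/eqquotP/asboolP|uv] //; apply/eqquotP/asboolP. Qed.

Lemma presented_repr (u : word V) : word_cong R (repr (\pi_presented u)) u.
Proof. by apply/presented_eq; rewrite reprK. Qed.

Definition presented_mul (x y : presented) : presented :=
  \pi_presented (repr x ++ repr y).
Definition presented_one : presented := \pi_presented [::].
Definition presented_inv (x : presented) : presented :=
  \pi_presented (inv_word (repr x)).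

Lemma inv_word_cat (w : word V) : word_cong R (inv_word w ++ w) [::].
Proof.
elim: w => [|l w IHw]; first exact: wc_refl.
rewrite /inv_word map_cons rev_cons -cats1 -catA -/(inv_word w).
apply: (@wc_trans _ _ _ (inv_word w ++ w)); last exact: IHw.
apply: wc_cat; first exact: wc_refl.
apply: (@wc_cat _ _ [:: (l.1, ~~ l.2); l] [::]); last exact: wc_refl.
by have := wc_cancel R (l.1, ~~ l.2); rewrite /= negbK; case: l.
Qed.

Lemma cat_inv_word (w : word V) : word_cong R (w ++ inv_word w) [::].
Proof.
suff {1}-> : w = inv_word (inv_word w) by exact: inv_word_cat.
rewrite /inv_word map_rev revK -map_comp -[LHS]map_id.
by apply: eq_map => -[v b] /=; rewrite negbK.
Qed.

Lemma presented_mulA : associative presented_mul.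
Proof.
move=> x y z; apply/presented_eq; apply: (@wc_trans _ _ _ (repr x ++ repr y ++ repr z)).
  by apply: wc_cat; [exact: wc_refl | exact: presented_repr].
rewrite catA; apply: wc_sym.
by apply: wc_cat; [exact: presented_repr | exact: wc_refl].
Qed.

Lemma presented_mul1 : left_id presented_one presented_mul.
Proof.
move=> x; rewrite -[RHS]reprK; apply/presented_eq; rewrite -[X in word_cong _ _ X]cat0s.
by apply: wc_cat; [exact: presented_repr | exact: wc_refl].
Qed.

Lemma presented_mulr1 : right_id presented_one presented_mul.
Proof.
move=> x; rewrite -[RHS]reprK; apply/presented_eq; rewrite -[X in word_cong _ _ X]cats0.
by apply: wc_cat; [exact: wc_refl | exact: presented_repr].
Qed.

Lemma presented_mulV : left_inverse presented_one presented_inv presented_mul.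
Proof.
move=> x; apply/presented_eq; apply: (@wc_trans _ _ _ (inv_word (repr x) ++ repr x));
  last exact: inv_word_cat.
by apply: wc_cat; [exact: presented_repr | exact: wc_refl].
Qed.

Lemma presented_mulrV : right_inverse presented_one presented_inv presented_mul.
Proof.
move=> x; apply/presented_eq; apply: (@wc_trans _ _ _ (repr x ++ inv_word (repr x)));
  last exact: cat_inv_word.
by apply: wc_cat; [exact: wc_refl | exact: presented_repr].
Qed.

HB.instance Definition _ := isGroup.Build presented
  presented_mulA presented_mul1 presented_mulr1 presented_mulV presented_mulrV.

End Presented.

(** * Graph products of primary cyclic groups *)

Definition simple_graph (V : finType) (e : rel V) : Prop :=
  symmetric e /\ irreflexive e.

(* A sequence of length 2 can be a [ucycle]: it is an edge run in both
   directions. *)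
Definition acyclic_graph (V : finType) (e : rel V) : Prop :=
  forall c : seq V, ucycle e c -> (size c <= 2)%N.

Definition is_tree (V : finType) (e : rel V) : Prop :=
  (forall x y : V, connect e x y) /\ acyclic_graph e.

Definition leaves (V : finType) (e : rel V) : {set V} :=
  [set v | #|[set w | e v w]| == 1%N].

Definition prime_power (q : nat) : Prop :=
  exists p a : nat, [/\ prime p, (0 < a)%N & q = (p ^ a)%N].

Inductive graph_product_rel (V : finType) (e : rel V) (m : V -> nat) :
    word V -> word V -> Prop :=
| gp_order v : graph_product_rel e m (nseq (m v) (v, false)) [::]
| gp_comm v w : e v w ->
    graph_product_rel e m [:: (v, false); (w, false)] [:: (w, false); (v, false)].

Definition graph_product (V : finType) (e : rel V) (m : V -> nat) : groupType :=
  presented (graph_product_rel e m).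

(** * Subgroups and quotients *)

Definition subgroup (G : groupType) := groupClosed G.

Definition subgroup_group (G : groupType) (H : subgroup G) : Type :=
  {x : G | x \in H}.

Lemma subgroup_closed (G : groupType) (H : subgroup G) :
  group_closed (H : {pred G}).
Proof. by split=> [|x y xH yH]; [exact: gpred1 | exact: gpredF]. Qed.

Section SubgroupGroup.
Variables (G : groupType) (H : subgroup G).
HB.instance Definition _ := SubChoice.on (subgroup_group H).
HB.instance Definition _ :=
  SubChoice_isSubGroup.Build G (fun x => x \in H) (subgroup_group H)
    (subgroup_closed H).
End SubgroupGroup.

Definition normal_subgroup (G : groupType) (N : subgroup G) : Prop :=
  forall x g : G, x \in N -> x ^ g \in N.

Definition finite_index (G : groupType) (H : subgroup G) : Prop :=
  exists s : seq G, forall x : G, exists2 t, t \in s & t^-1 * x \in H.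

Section Quotient.
Variables (G : groupType) (N : subgroup G) (nN : normal_subgroup N).

Definition cosetb of normal_subgroup N : rel G := fun x y => x^-1 * y \in N.

Lemma cosetb_refl : reflexive (cosetb nN).
Proof. by move=> x; rewrite /cosetb mulVg gpred1. Qed.

Lemma cosetb_sym : symmetric (cosetb nN).
Proof. by move=> x y; rewrite /cosetb -gpredV invgM invgK. Qed.

Lemma cosetb_trans : transitive (cosetb nN).
Proof.
move=> y x z xy yz; rewrite /cosetb -(mulVKg y z) mulgA.
exact: gpredM.
Qed.

Canonical cosetb_equiv :=
  EquivRel (cosetb nN) cosetb_refl cosetb_sym cosetb_trans.

Definition quotient_group : Type := {eq_quot (cosetb nN)}.

HB.instance Definition _ := Choice.on quotient_group.
HB.instance Definition _ := EqQuotient.on quotient_group.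

Lemma quotient_eq (x y : G) :
  \pi_quotient_group x = \pi_quotient_group y <-> x^-1 * y \in N.
Proof. by split=> [/eqquotP|xy] //; apply/eqquotP. Qed.

Lemma quotient_repr (x : G) : (repr (\pi_quotient_group x))^-1 * x \in N.
Proof. by apply/quotient_eq; rewrite reprK. Qed.

Definition quotient_mul (x y : quotient_group) : quotient_group :=
  \pi_quotient_group (repr x * repr y).
Definition quotient_one : quotient_group := \pi_quotient_group 1.
Definition quotient_inv (x : quotient_group) : quotient_group :=
  \pi_quotient_group (repr x)^-1.

Lemma quotient_piM (x y : G) :
  \pi_quotient_group (x * y)
  = quotient_mul (\pi_quotient_group x) (\pi_quotient_group y).
Proof.
apply/esym/quotient_eq.
set x' := repr _; set y' := repr _.
have -> : (x' * y')^-1 * (x * y) = (y'^-1 * y) * (x'^-1 * x) ^ y.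
  by rewrite conjgE invgM !mulgA mulgK.
by apply: gpredM; [exact: quotient_repr | apply: nN; exact: quotient_repr].
Qed.

Lemma quotient_mulA : associative quotient_mul.
Proof.
move=> + + +; elim/quotW=> x; elim/quotW=> y; elim/quotW=> z.
by rewrite -(quotient_piM y z) -(quotient_piM x y) -!quotient_piM mulgA.
Qed.

Lemma quotient_mul1 : left_id quotient_one quotient_mul.
Proof. by elim/quotW=> x; rewrite -(quotient_piM 1 x) mul1g. Qed.

Lemma quotient_mulr1 : right_id quotient_one quotient_mul.
Proof. by elim/quotW=> x; rewrite -(quotient_piM x 1) mulg1. Qed.

Lemma quotient_mulV : left_inverse quotient_one quotient_inv quotient_mul.
Proof.
by move=> x; rewrite -{2}[x]reprK -(quotient_piM (repr x)^-1) mulVg.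
Qed.

Lemma quotient_mulrV : right_inverse quotient_one quotient_inv quotient_mul.
Proof.
by move=> x; rewrite -{1}[x]reprK -(quotient_piM (repr x)) mulgV.
Qed.

HB.instance Definition _ := isGroup.Build quotient_group
  quotient_mulA quotient_mul1 quotient_mulr1 quotient_mulV quotient_mulrV.

End Quotient.

(** * Automorphisms *)

Record aut (G : groupType) := Aut {
  aut_fun :> G -> G;
  autM : {morph aut_fun : x y / x * y};
  aut_bij : bijective aut_fun }.

Section AutGroup.
Variable G : groupType.

HB.instance Definition _ := gen_eqMixin (aut G).
HB.instance Definition _ := gen_choiceMixin (aut G).

Lemma aut_ext (f g : aut G) : f =1 g -> f = g.
Proof.
case: f => f fM fb; case: g => g gM gb /= /funext fg.
by move: gM gb; rewrite -fg => gM gb; congr Aut; exact: Prop_irrelevance.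
Qed.

Lemma aut_comp_subproof (f g : aut G) : {morph f \o g : x y / x * y}.
Proof. by move=> x y /=; rewrite !autM. Qed.

Definition aut_comp (f g : aut G) : aut G :=
  Aut (aut_comp_subproof f g) (bij_comp (aut_bij f) (aut_bij g)).

Definition aut_id : aut G :=
  @Aut G id (fun _ _ => erefl) (Bijective (fun=> erefl) (fun=> erefl)).

Lemma aut_inv_exists (f : aut G) :
  exists g : aut G, cancel f g /\ cancel g f.
Proof.
have [g fK gK] := aut_bij f.
have gM : {morph g : x y / x * y}.
  by move=> x y; apply: (can_inj fK); rewrite autM !gK.
by exists (Aut gM (Bijective gK fK)).
Qed.

Definition aut_inv (f : aut G) : aut G := projT1 (cid (aut_inv_exists f)).

Lemma aut_invK (f : aut G) : cancel f (aut_inv f).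
Proof. by rewrite /aut_inv; case: cid => g []. Qed.

Lemma aut_invVK (f : aut G) : cancel (aut_inv f) f.
Proof. by rewrite /aut_inv; case: cid => g []. Qed.

Lemma aut_compA : associative aut_comp.
Proof. by move=> f g h; apply: aut_ext. Qed.
Lemma aut_comp1 : left_id aut_id aut_comp.
Proof. by move=> f; apply: aut_ext. Qed.
Lemma aut_compr1 : right_id aut_id aut_comp.
Proof. by move=> f; apply: aut_ext. Qed.
Lemma aut_compV : left_inverse aut_id aut_inv aut_comp.
Proof. by move=> f; apply: aut_ext => x; exact: aut_invK. Qed.
Lemma aut_comprV : right_inverse aut_id aut_inv aut_comp.
Proof. by move=> f; apply: aut_ext => x; exact: aut_invVK. Qed.

HB.instance Definition _ := isGroup.Build (aut G)
  aut_compA aut_comp1 aut_compr1 aut_compV aut_comprV.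

Definition inn : {pred aut G} :=
  fun f => `[< exists g : G, forall x, f x = x ^ g >].

Lemma innP (f : aut G) : reflect (exists g : G, forall x, f x = x ^ g) (f \in inn).
Proof. exact: asboolP. Qed.

Lemma inn_mulg_closed : mulg_closed inn.
Proof.
move=> f g /innP[a fa] /innP[b gb]; apply/innP; exists (b * a) => x.
by rewrite conjgM -gb -fa.
Qed.

Lemma inn1 : 1 \in inn.
Proof. by apply/innP; exists 1 => x; rewrite conjg1. Qed.

Lemma inn_invg_closed : invg_closed inn.
Proof.
move=> f /innP[a fa]; apply/innP; exists a^-1 => x.
by rewrite -[x in LHS](conjgKV a) -fa; exact: aut_invK.
Qed.

HB.instance Definition _ := isMulClosed.Build (aut G) inn inn_mulg_closed.
HB.instance Definition _ := isMul1Closed.Build (aut G) inn inn1.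
HB.instance Definition _ := isInvClosed.Build (aut G) inn inn_invg_closed.

Lemma aut_conjg (f : aut G) x a : f (x ^ a) = f x ^ f a.
Proof.
have fV : f a^-1 = (f a)^-1.
  apply: (@mulgI _ (f a)); rewrite -autM !mulgV.
  by apply: (@mulgI _ (f 1)); rewrite -autM !mulg1.
by rewrite !conjgE !autM fV.
Qed.

Lemma inn_normal : normal_subgroup (inn : subgroup (aut G)).
Proof.
move=> f h /innP[a fa]; apply/innP; exists (h^-1 a) => x.
have -> : (f ^ h) x = h^-1 (f (h x)) by [].
by rewrite fa aut_conjg; congr (_ ^ _); exact: aut_invK.
Qed.

Definition out : groupType := quotient_group inn_normal.

End AutGroup.

(** * Cohomological dimension *)

Definition torsion_free (G : groupType) : Prop :=
  forall (x : G) (n : nat), (0 < n)%N -> x ^+ n = 1 -> x = 1.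

Definition virtually_torsion_free (G : groupType) : Prop :=
  exists H : subgroup G, finite_index H /\ torsion_free (subgroup_group H).

(* A module over the integral group ring of [G], that is, an abelian group with
   an additive action of [G]. *)
Record gmodule (G : groupType) := GModule {
  gmod_sort :> zmodType;
  gact : G -> {additive gmod_sort -> gmod_sort};
  gact1 : forall x, gact 1 x = x;
  gactM : forall g h x, gact (g * h) x = gact g (gact h x) }.

Arguments gact {G M} g : rename.

Record ghom (G : groupType) (M N : gmodule G) := GHom {
  ghom_fun :> {additive M -> N};
  ghom_equiv : forall g x, ghom_fun (gact g x) = gact g (ghom_fun x) }.

Definition trivial_Z (G : groupType) : gmodule G :=
  @GModule G int (fun=> idfun : {additive int -> int})
    (fun=> erefl) (fun _ _ _ => erefl).

Definition surjective_fun (A B : Type) (f : A -> B) : Prop :=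
  forall y, exists x, f x = y.

Definition projective_gmodule (G : groupType) (P : gmodule G) : Prop :=
  forall (M N : gmodule G) (p : ghom M N) (f : ghom P N),
    surjective_fun p -> exists h : ghom P M, forall x, p (h x) = f x.

Definition exact_at (G : groupType) (A B C : gmodule G)
    (f : ghom A B) (g : ghom B C) : Prop :=
  forall b : B, g b = 0%R <-> exists a : A, f a = b.

(* [0 -> P n -> ... -> P 1 -> P 0 -> Z -> 0] is exact, with all [P i]
   projective; the terms beyond [n] are zero. *)
Definition projective_resolution (G : groupType) (n : nat)
    (P : nat -> gmodule G) (d : forall i, ghom (P i.+1) (P i))
    (eps : ghom (P 0%N) (trivial_Z G)) : Prop :=
  [/\ forall i, projective_gmodule (P i),
      forall i, (n < i)%N -> forall x : P i, x = 0%R,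
      surjective_fun eps,
      exact_at (d 0%N) eps
    & forall i, exact_at (d i.+1) (d i)].

Definition cd_le (G : groupType) (n : nat) : Prop :=
  exists (P : nat -> gmodule G) (d : forall i, ghom (P i.+1) (P i))
    (eps : ghom (P 0%N) (trivial_Z G)), projective_resolution n d eps.

Definition cd_eq (G : groupType) (n : nat) : Prop :=
  cd_le G n /\ forall k, cd_le G k -> (n <= k)%N.

(* The virtual cohomological dimension is the common cohomological dimension
   of all torsion-free subgroups of finite index. *)
Definition vcd_eq (G : groupType) (n : nat) : Prop :=
  virtually_torsion_free G /\
  forall H : subgroup G, finite_index H -> torsion_free (subgroup_group H) ->
    cd_eq (subgroup_group H) n.

(* Main.v *)
(* W is the fundamental group of a tree of groups with finite edge groups E(u,w) =
   <u, w> glued along the vertex groups Z(u) = <u>. Its maximal finite subgroups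
   are the conjugates of the E(u,w), so automorphisms permute the set X of their
   cosets. The trees of groups with these vertex stabilizers and nontrivial
   amalgamation at each block are encoded by the W-invariant "betweenness"
   structures on X, ordered by refinement. Out W acts on this poset.

   Upper bound: the order complex of the poset is acyclic, by Morse theory for the
   number of blocks that the half-spaces of the standard structure cut (a
   structure of minimal norm is the standard one, and every other one has a
   conical set of lower neighbours, the cone point being obtained by folding).
   Counting stabilizer orbits of directions at the vertices bounds the length of
   a chain by |V_1| - 1. The automorphisms that are, on each E(u,w), conjugation by
   an element with trivial exponent sums form a finite index subgroup acting freely;
   hence every torsion-free finite index subgroup acts freely, and its cohomological
   dimension is at most |V_1| - 2.

   Lower bound: root the tree at a leaf. For a vertex w with parent u, grandparent p
   and distinguished sibling q, conjugation of the descendants of w by pq is an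
   automorphism; these |V_1| - 2 automorphisms commute and are independent in Out W,
   so finite index subgroups contain free abelian groups of that rank. *)
Require Import Defs.
From HB Require Import structures.
From mathcomp Require Import all_boot all_order all_algebra.
From mathcomp Require Import boolp zify.
From mathcomp.multinomials Require freeg.

(** A structure is a ternary relation on one fixed set, so that refinement is inclusion and the
    lower bounds needed below a folding are plain intersections; no tree or contractible space is
    built, only chains with vanishing reduced homology. The obstacle in the Morse argument is that
    [norm] is not strictly monotone: structures of equal norm are first grouped by the finest one
    among them, [rho s], and only a structure with [rho s = s] can be folded with a strict drop of
    the norm. Torsion-freeness of the finite index subgroup is not tested on elements: its free
    action bounds its cohomological dimension, and a group of finite dimension has no torsion. The
    constant arises as follows. There are $|V|-1$ orbits of points, so a structure has at most
    $2(|V|-2)$ orbits of directions. Every structure keeps, at each point, one direction for each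
    end of its edge that is not a leaf, and these number $2(|V|-1)-|V_1|$. The difference $|V_1|-2$
    bounds the number of strict coarsenings. For the lower bound, the projective dimension of the
    integers over a free abelian group is bounded below by splitting off one infinite cyclic factor
    at a time. *)

Module Homology.

Set Implicit Arguments.
Unset Strict Implicit.
Unset Printing Implicit Defensive.

Import GRing.Theory freeg.
Local Open Scope ring_scope.

(** * Free abelian groups *)

Section FreeAbelian.
Variables (K : choiceType) (M : zmodType).
Implicit Types (D : {freeg K / int}) (f : K -> M).

Definition lin f D : M := \sum_(x <- dom D) f x *~ coeff x D.

Lemma lin_widen f D (s : seq K) : uniq s -> {subset dom D <= s} ->
  lin f D = \sum_(x <- s) f x *~ coeff x D.
Proof.
move=> us sub; rewrite (bigID (fun x => x \in dom D)) /= [X in _ + X]big1 ?addr0.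
  rewrite -big_filter /lin; apply: perm_big; apply: uniq_perm.
  - exact: uniq_dom.
  - exact: filter_uniq.
  by move=> x; rewrite mem_filter; case: (boolP (x \in dom D)) => //= /sub->.
by move=> x /coeff_outdom->; rewrite mulr0z.
Qed.

Lemma lin_is_zmod_morphism f : zmod_morphism (lin f).
Proof.
move=> D E; pose s := undup (dom D ++ dom E).
have sD : {subset dom D <= s} by move=> x xD; rewrite mem_undup mem_cat xD.
have sE : {subset dom E <= s} by move=> x xE; rewrite mem_undup mem_cat xE orbT.
have sB : {subset dom (D - E) <= s} by move=> x /domB; rewrite mem_undup.
rewrite !(@lin_widen f _ s) ?undup_uniq // -sumrB.
by apply: eq_bigr => x _; rewrite coeffB mulrzBr.
Qed.

HB.instance Definition _ f :=
  GRing.isZmodMorphism.Build {freeg K / int} M (lin f) (lin_is_zmod_morphism f).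

Lemma linU f x : lin f << x >> = f x.
Proof. by rewrite /lin domU1 big_seq1 coeffU eqxx mulr1. Qed.

Lemma freeg_ind_dom (P : {freeg K / int} -> Prop) D :
  P 0 -> (forall E F, P E -> P F -> P (E - F)) ->
  (forall x, x \in dom D -> P << x >>) -> P D.
Proof.
move=> P0 PB Px.
have PN E : P E -> P (- E) by rewrite -[- E]add0r; exact: PB.
have PD E F : P E -> P F -> P (E + F).
  by move=> PE /PN PF; rewrite -[F]opprK; exact: PB.
rewrite -(freeg_sumE D) big_seq; elim/big_ind: _ => // x /Px {}Px.
have -> : << coeff x D *g x >> = << x >> *~ coeff x D :> {freeg K / int}.
  by rewrite freegU_mulz intz.
have Pn n : P (<< x >> *+ n) by elim: n => [//|n IH]; rewrite mulrS; exact: PD.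
by case: (coeff x D) => n; [exact: Pn | rewrite NegzE mulrNz; exact/PN/Pn].
Qed.

Lemma additive_ext_dom (g h : {additive {freeg K / int} -> M}) D :
  (forall x, x \in dom D -> g << x >> = h << x >>) -> g D = h D.
Proof.
apply: (freeg_ind_dom (P := fun E => g E = h E)); first by rewrite !raddf0.
by move=> E F gE gF; rewrite !raddfB gE gF.
Qed.

Lemma additive_ext (g h : {additive {freeg K / int} -> M}) :
  (forall x, g << x >> = h << x >>) -> g =1 h.
Proof. by move=> gh D; apply: additive_ext_dom. Qed.

End FreeAbelian.

Section Support.
Variable K : choiceType.
Implicit Types (D : {freeg K / int}) (Q : pred K).

Definition supp Q D : Prop := forall x, x \in dom D -> Q x.

Lemma supp0 Q : supp Q 0. Proof. by move=> x; rewrite dom0. Qed.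

Lemma suppB Q D E : supp Q D -> supp Q E -> supp Q (D - E).
Proof. by move=> QD QE x /domB; rewrite mem_cat => /orP[/QD|/QE]. Qed.

Lemma suppN Q D : supp Q D -> supp Q (- D).
Proof. by move=> QD; rewrite -sub0r; apply: suppB => //; exact: supp0. Qed.

Lemma suppD Q D E : supp Q D -> supp Q E -> supp Q (D + E).
Proof. by move=> QD QE; rewrite -[E]opprK; apply: suppB => //; exact: suppN. Qed.

Lemma suppU (Q : pred K) x : Q x -> supp Q << x >>.
Proof. by move=> Qx y; rewrite domU1 inE => /eqP->. Qed.

Lemma supp_sub (Q Q' : pred K) D : (forall x, Q x -> Q' x) -> supp Q D -> supp Q' D.
Proof. by move=> QQ' QD x /QD/QQ'. Qed.

End Support.

Lemma supp_lin (K L : choiceType) (Q : pred K) (Q' : pred L)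
    (f : K -> {freeg L / int}) (D : {freeg K / int}) :
  (forall x, Q x -> supp Q' (f x)) -> supp Q D -> supp Q' (lin f D).
Proof.
move=> Qf QD; apply: (freeg_ind_dom (P := fun E => supp Q' (lin f E))).
- by rewrite raddf0; exact: supp0.
- by move=> E F QE QF; rewrite raddfB; exact: suppB.
- by move=> x /QD/Qf; rewrite linU.
Qed.

(** * Chains of a partially ordered set *)

Section Chains.
Variables (T : choiceType) (lt : rel T).
Hypotheses (ltxx : irreflexive lt) (lt_trans : transitive lt).
Local Notation C := {freeg (seq T) / int}.
Implicit Types (z : C) (s : seq T) (x : T) (L : pred T).

Definition le x y := (x == y) || lt x y.

Lemma le_refl x : le x x. Proof. by rewrite /le eqxx. Qed.

Lemma le_lt_trans x y w : le x y -> lt y w -> lt x w.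
Proof. by case/predU1P=> [->//|]; exact: lt_trans. Qed.

Lemma le_trans : transitive le.
Proof.
move=> y x w xy /predU1P[<-//|yw]; apply/orP; right; exact: le_lt_trans yw.
Qed.

Definition prefix_chain x : C -> C := lin (fun s => << x :: s >>).
HB.instance Definition _ x := GRing.Additive.on (prefix_chain x).

Lemma prefix_chainU x s : prefix_chain x << s >> = << x :: s >>.
Proof. exact: linU. Qed.

Fixpoint boundary_seq s : C :=
  if s is x :: s' then << s' >> - prefix_chain x (boundary_seq s') else 0.

(* The boundary of the augmented complex: a one-element chain is sent to the
   empty chain, which spans degree [-1]. *)
Definition boundary : C -> C := lin boundary_seq.
HB.instance Definition _ := GRing.Additive.on boundary.

Lemma boundaryU s : boundary << s >> = boundary_seq s.
Proof. exact: linU. Qed.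

Lemma boundary_prefix x z :
  boundary (prefix_chain x z) = z - prefix_chain x (boundary z).
Proof.
move: z; apply: (additive_ext (g := boundary \o prefix_chain x)
  (h := idfun \- (prefix_chain x \o boundary))) => s.
by rewrite /= prefix_chainU !boundaryU.
Qed.

Lemma boundary_boundary z : boundary (boundary z) = 0.
Proof.
move: z; apply: (additive_ext (g := boundary \o boundary) (h := \0)) => s /=.
rewrite boundaryU; elim: s => [|x s IHs] /=; first by rewrite raddf0.
by rewrite raddfB /= boundary_prefix boundaryU IHs raddf0 subr0 subrr.
Qed.

Definition chain_in L s := sorted lt s && all L s.

Lemma chain_in_cons L x s :
  chain_in L (x :: s) = [&& L x, all (lt x) s & chain_in L s].
Proof.
rewrite /chain_in /= (path_sortedE lt_trans) -!andbA.
by case: (L x); rewrite ?andbF.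
Qed.

Lemma supp_prefix L L' x z : L x -> (forall y, L' y -> lt x y && L y) ->
  supp (chain_in L') z -> supp (chain_in L) (prefix_chain x z).
Proof.
move=> Lx L'L; apply: supp_lin => s /andP[sorts allL']; apply: suppU.
rewrite chain_in_cons Lx /chain_in sorts /=; apply/andP; split.
  by apply: sub_all allL' => y /L'L/andP[].
by apply: sub_all allL' => y /L'L/andP[].
Qed.

Lemma supp_boundary L z :
  supp (chain_in L) z -> supp (chain_in L) (boundary z).
Proof.
apply: supp_lin => s; elim: s L => [|x s IHs] L; first by move=> _; exact: supp0.
rewrite chain_in_cons => /and3P[Lx ltx chs] /=; apply: suppB; first exact: suppU.
apply: (@supp_prefix _ (fun y => lt x y && L y)) => //; apply: IHs.
by case/andP: chs => sorts allL; rewrite /chain_in sorts all_predI ltx.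
Qed.

Definition acyclic_on L := forall z, supp (chain_in L) z -> boundary z = 0 ->
  exists2 y, supp (chain_in L) y & boundary y = z.

(** Putting [x0] in front of the chains that do not contain it is a contracting homotopy: [boundary]
    after [h] plus [h] after [boundary] is the identity, in the augmented degree too. *)
Lemma acyclic_cone L x0 : L x0 -> (forall y, L y -> le x0 y) -> acyclic_on L.
Proof.
move=> Lx0 minx0.
pose h s : C := if x0 \in s then 0 else << x0 :: s >>.
have lth s : chain_in L s -> x0 \notin s -> chain_in L (x0 :: s).
  move=> chs x0s; rewrite chain_in_cons Lx0 chs andbT /=.
  case/andP: chs => _ /allP allL; apply/allP => y ys.
  by case/predU1P: (minx0 _ (allL _ ys)) => // eqy; rewrite eqy ys in x0s.
have hprefix x (z : C) : x != x0 -> (forall s, s \in dom z -> x0 \notin s) ->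
    lin h (prefix_chain x z) = prefix_chain x0 (prefix_chain x z).
  move=> xx0 zx0; apply: (additive_ext_dom (g := lin h \o prefix_chain x)
    (h := prefix_chain x0 \o prefix_chain x)) => s /zx0 x0s /=.
  by rewrite !prefix_chainU linU /h inE eq_sym (negPf xx0) (negPf x0s).
have hprefix0 (z : C) : lin h (prefix_chain x0 z) = 0.
  apply: (additive_ext (g := lin h \o prefix_chain x0) (h := \0)) => s /=.
  by rewrite prefix_chainU linU /h mem_head.
have hbd s : chain_in L s ->
    boundary (lin h << s >>) + lin h (boundary << s >>) = << s >>.
  move=> chs; case: (boolP (x0 \in s)) => x0s.
    have [t st] : exists t, s = x0 :: t.
      case: s chs x0s => [//|y t]; rewrite chain_in_cons => /and3P[Ly lty _].
      rewrite inE => /predU1P[->|x0t]; first by exists t.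
      have /minx0 := Ly; rewrite /le => /predU1P[->|ltx0]; first by exists t.
      by have := lt_trans ltx0 (allP lty _ x0t); rewrite ltxx.
    rewrite {}st in chs x0s *.
    rewrite linU /h mem_head raddf0 add0r boundaryU /= raddfB /= hprefix0 subr0.
    rewrite linU /h; move: chs; rewrite chain_in_cons => /and3P[_ lt0 _].
    by case: ifP => // /(allP lt0); rewrite ltxx.
  have -> : lin h << s >> = << x0 :: s >> by rewrite linU /h (negPf x0s).
  rewrite !boundaryU /=.
  suff -> : lin h (boundary_seq s) = prefix_chain x0 (boundary_seq s).
    by rewrite subrK.
  have bds : supp (chain_in (fun y => y != x0)) (boundary_seq s).
    rewrite -boundaryU; apply/supp_boundary/suppU; case/andP: chs => sorts _.
    rewrite /chain_in sorts; apply/allP => y ys; apply: contraNneq x0s => <-.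
    exact: ys.
  apply: (additive_ext_dom (g := lin h) (h := prefix_chain x0)) => t /bds.
  case/andP=> _ /allP tx0; rewrite /= linU /h prefix_chainU.
  by case: ifP => // /tx0; rewrite eqxx.
move=> z chz dz; exists (lin h z).
  apply: supp_lin chz => s chs; rewrite /h; case: ifPn => x0s.
    exact: supp0.
  exact/suppU/lth.
suff: boundary (lin h z) + lin h (boundary z) = z by rewrite dz raddf0 addr0.
apply: (additive_ext_dom
  (g := (boundary \o lin h) \+ (lin h \o boundary)) (h := idfun)) => s /chz.
exact: hbd.
Qed.

(** Monotone maps may identify neighbours, so images of chains are only weakly increasing. Sequences
    with a repetition are degenerate simplices and are set to zero. *)
Definition normalize : C -> C :=
  lin (fun s => if sorted lt s then << s >> else 0).
HB.instance Definition _ := GRing.Additive.on normalize.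

Lemma normalize_chain L z : supp (chain_in L) z -> normalize z = z.
Proof.
move=> chz; apply: (additive_ext_dom (g := normalize) (h := idfun)) => s /chz.
by case/andP=> sorts _; rewrite /= /normalize linU sorts.
Qed.

Lemma normalize_prefix x z :
  normalize (prefix_chain x z) = normalize (prefix_chain x (normalize z)).
Proof.
move: z; apply: (additive_ext (g := normalize \o prefix_chain x)
  (h := normalize \o prefix_chain x \o normalize)) => s /=.
rewrite prefix_chainU /normalize !linU; case: ifP => [sorts|].
  by case: ifP => nsorts; rewrite ?prefix_chainU ?linU ?sorts //; move: nsorts;
    rewrite /= (path_sorted sorts).
case: ifP => [sorts|]; last by rewrite !raddf0.
by rewrite prefix_chainU linU => ->.
Qed.

(** At a repetition, the two faces that omit either copy cancel, and all other faces are still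
    degenerate. *)
Lemma normalize_boundary s : sorted le s ->
  normalize (boundary << s >>) = boundary (normalize << s >>).
Proof.
rewrite {2}/normalize linU; case: ifPn => [sorts _|].
  apply: (@normalize_chain predT); apply: supp_boundary; apply: suppU.
  by rewrite /chain_in sorts all_predT.
rewrite raddf0; elim: s => [//|x s IHs] nsorts ws.
have ws' : sorted le s by exact: path_sorted ws.
case: (boolP (sorted lt s)) => sorts; last first.
  rewrite boundaryU /= raddfB /= normalize_prefix.
  rewrite -boundaryU IHs // raddf0 raddf0 subr0 /normalize linU.
  by rewrite (negPf sorts).
case: s ws nsorts sorts {IHs ws'} => [//|y s] ws nsorts sorts.
have eqxy : x = y.
  move: ws => /= /andP[/predU1P[//|ltxy] _].
  by move: nsorts; rewrite /= ltxy; move: sorts => /= ->.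
rewrite -eqxy boundaryU /= (raddfB (prefix_chain x)) /= prefix_chainU.
rewrite opprB addrC subrK.
move: (boundary_seq s); apply: (additive_ext
  (g := normalize \o prefix_chain x \o prefix_chain x) (h := \0)) => t /=.
by rewrite !prefix_chainU /normalize linU /= ltxx.
Qed.

Definition map_chain (g : T -> T) : C -> C := lin (fun s => << map g s >>).
HB.instance Definition _ g := GRing.Additive.on (map_chain g).

Lemma map_chain_prefix g x z :
  map_chain g (prefix_chain x z) = prefix_chain (g x) (map_chain g z).
Proof.
move: z; apply: (additive_ext (g := map_chain g \o prefix_chain x)
  (h := prefix_chain (g x) \o map_chain g)) => s /=.
by rewrite prefix_chainU /map_chain !linU prefix_chainU.
Qed.

Lemma boundary_map g z : boundary (map_chain g z) = map_chain g (boundary z).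
Proof.
move: z; apply: (additive_ext (g := boundary \o map_chain g)
  (h := map_chain g \o boundary)) => s /=.
elim: s => [|x s IHs]; first by rewrite /map_chain linU !boundaryU /= raddf0.
rewrite -prefix_chainU map_chain_prefix !boundary_prefix IHs raddfB /=.
by rewrite map_chain_prefix.
Qed.

(* The prism operator, a chain homotopy between the maps induced by [f] and
   [g]; it produces weakly decreasing sequences when [g <= f] pointwise. *)
Fixpoint prism_seq (f g : T -> T) s : C :=
  if s is x :: s' then << f x :: map g s >> - prefix_chain (f x) (prism_seq f g s')
  else 0.

Definition prism f g : C -> C := lin (prism_seq f g).
HB.instance Definition _ f g := GRing.Additive.on (prism f g).

Lemma prism_prefix f g x z : prism f g (prefix_chain x z) =
  prefix_chain (f x) (map_chain g (prefix_chain x z) - prism f g z).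
Proof.
move: z; apply: (additive_ext (g := prism f g \o prefix_chain x)
  (h := prefix_chain (f x) \o ((map_chain g \o prefix_chain x) \- prism f g))) => s.
by rewrite /= prefix_chainU /prism /map_chain !linU /= raddfB /= prefix_chainU.
Qed.

Lemma boundary_prism f g z :
  boundary (prism f g z) = map_chain g z - map_chain f z - prism f g (boundary z).
Proof.
move: z; apply: (additive_ext (g := boundary \o prism f g) (h :=
  (map_chain g \- map_chain f) \- (prism f g \o boundary))) => s /=.
elim: s => [|x s IHs].
  by rewrite boundaryU /= raddf0 subr0 /prism linU /= raddf0 /map_chain !linU subrr.
rewrite -prefix_chainU prism_prefix boundary_prefix (raddfB boundary) /= IHs.
rewrite boundary_map boundary_prefix (raddfB (map_chain g)) /=.
rewrite (raddfB (prism f g)) /= prism_prefix (map_chain_prefix f).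
set a := map_chain g << s >>; set b := map_chain f << s >>.
set c := map_chain g (prefix_chain x (boundary _)); set q := prism f g (boundary _).
have -> : a - c - (a - b - q) = b - (c - q).
  by rewrite !opprB !addrA (ACl (1*5*4*3*2)) /= subrr add0r.
by rewrite (raddfB (prefix_chain (f x))) /= !opprB !addrA (ACl (1*4*3*2)).
Qed.

Lemma normalize_mono Q L (F : seq T -> C) z : 
  supp Q z -> (forall s, Q s -> supp (fun t => sorted le t && all L t) (F s)) ->
  supp (chain_in L) (normalize (lin F z)).
Proof.
move=> Qz QF; apply: (@supp_lin _ _ (fun t => sorted le t && all L t)); last first.
  exact: supp_lin Qz.
move=> t /andP[_ allL]; case: ifP => sorts; last exact: supp0.
by apply: suppU; rewrite /chain_in sorts.
Qed.

Lemma supp_prism L L' f g s :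
  (forall x y, L x -> L y -> lt x y -> le (f x) (f y)) ->
  (forall x y, L x -> L y -> lt x y -> le (g x) (g y)) ->
  (forall x, L x -> [&& L' (f x), L' (g x) & le (f x) (g x)]) -> chain_in L s ->
  supp (fun t => sorted le t && all L' t) (prism_seq f g s).
Proof.
move=> fmono gmono Lfg chs.
have sg t : chain_in L t -> sorted le (map g t).
  elim: t => [//|x [//|y t] IHt]; rewrite chain_in_cons => /and3P[Lx /= ltx cht].
  have /= -> := IHt cht; rewrite andbT; case/andP: ltx => ltxy _; apply: gmono => //.
  by move: cht; rewrite chain_in_cons => /and3P[].
have {Lfg}: {in s, forall x, [&& L' (f x), L' (g x) & le (f x) (g x)]}.
  by case/andP: chs => _ /allP allL x /allL/Lfg.
elim: s L' chs => [|x s IHs] L'; first by move=> _ _; exact: supp0.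
move=> chxs Lfg; have := chxs; rewrite chain_in_cons => /and3P[Lx ltx chs] /=.
have /and3P[Lf Lg lefg] := Lfg _ (mem_head _ _).
have Ls y : y \in s -> L y by case/andP: chs => _ /allP; apply.
apply: suppB.
  apply: suppU => /=; rewrite lefg Lf Lg /=.
  have /= -> /= := sg _ chxs.
  by rewrite all_map; apply/allP => y ys /=; case/and3P: (Lfg y (@mem_behead _ (x :: s) y ys)).
apply: supp_lin (IHs (fun y => L' y && le (f x) y) chs _) => [t|y ys].
  case/andP=> sortt allt; apply: suppU; rewrite /= (path_sortedE le_trans) sortt Lf.
  by rewrite andbT; apply/andP; split; apply: sub_all allt => y /andP[].
have /and3P[-> -> lefgy] := Lfg y (@mem_behead _ (x :: s) y ys).
have lefxy : le (f x) (f y) by apply: fmono => //; [exact: Ls | exact: (allP ltx)].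
by rewrite lefgy lefxy (le_trans lefxy).
Qed.

(** The boundary formula of the prism holds before normalization; [normalize] commutes with
    [boundary] on the weakly increasing sequences that make up the prism. *)
Lemma map_chain_homotopic L L' f g z :
  (forall x y, L x -> L y -> lt x y -> le (f x) (f y)) ->
  (forall x y, L x -> L y -> lt x y -> le (g x) (g y)) ->
  (forall x, L x -> [&& L' (f x), L' (g x) & le (f x) (g x)]) ->
  supp (chain_in L) z -> boundary z = 0 ->
  exists2 y, supp (chain_in L') y &
    boundary y = normalize (map_chain g z) - normalize (map_chain f z).
Proof.
move=> fmono gmono Lfg chz dz; exists (normalize (prism f g z)).
  by apply: (normalize_mono chz) => s; exact: supp_prism.
have : supp (fun t => sorted le t && all L' t) (prism f g z).
  by apply: supp_lin chz => s; exact: supp_prism.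
move=> wp; rewrite -(raddfB normalize) /=.
have <- : boundary (prism f g z) = map_chain g z - map_chain f z.
  by rewrite boundary_prism dz raddf0 subr0.
symmetry; apply: (additive_ext_dom (g := normalize \o boundary)
  (h := boundary \o normalize)) => s /wp /andP[ws _].
exact: normalize_boundary.
Qed.

(* A closure operator deforms [L] onto its image, which is a cone over [c]. *)
Lemma acyclic_closure L f c : L c ->
  (forall x y, L x -> L y -> lt x y -> le (f x) (f y)) ->
  (forall x, L x -> [&& L (f x), le (f x) x & le (f x) c]) -> acyclic_on L.
Proof.
move=> Lc fmono Lf z chz dz.
have map_id y : map_chain id y = y.
  apply: (additive_ext (g := map_chain id) (h := idfun)) => s /=.
  by rewrite /map_chain linU map_id.
(* [f] lies below the identity and below the constant map [c], so [z] is homologous to a cycle on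
   the single point [c]. *)
have [||y1 Ly1 dy1] := @map_chain_homotopic L L f id z fmono _ _ chz dz.
- by move=> x y _ _ xy; rewrite /le xy orbT.
- by move=> x Lx; case/and3P: (Lf x Lx) => -> -> _; rewrite Lx.
have [||y2 Ly2 dy2] := @map_chain_homotopic L L f (fun=> c) z fmono _ _ chz dz.
- by move=> *; exact: le_refl.
- by move=> x Lx; case/and3P: (Lf x Lx) => -> _ ->; rewrite Lc.
rewrite map_id (normalize_chain chz) in dy1.
set w := normalize (map_chain (fun=> c) z) in dy2.
have chw : supp (chain_in (pred1 c)) w.
  apply: (normalize_mono chz) => s _; apply: suppU.
  rewrite sorted_map all_map; apply/andP; split; last by apply/allP => y _ /=.
  case: s => [//|x s] /=; elim: s x => [//|y s IHs] x; apply/andP; split.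
    exact: le_refl.
  exact: IHs.
have dw : boundary w = 0.
  have : boundary (boundary y2) = 0 := boundary_boundary _.
  have : boundary (boundary y1) = 0 := boundary_boundary _.
  rewrite dy1 dy2 !(raddfB boundary) /= dz sub0r => /eqP; rewrite oppr_eq0 => /eqP ->.
  by rewrite subr0.
have [|y3 Ly3 dy3] := @acyclic_cone (pred1 c) c (eqxx c) _ w chw dw.
  by move=> y /eqP->; exact: le_refl.
exists (y1 - y2 + y3).
  apply: suppD; first exact: suppB.
  by apply: supp_sub Ly3 => s /andP[sorts alls]; rewrite /chain_in sorts;
    apply: sub_all alls => y /eqP->.
rewrite (raddfD boundary) (raddfB boundary) /= dy1 dy2 dy3.
by rewrite opprB addrA subrK subrK.
Qed.

(* Discrete Morse theory: the level set [N = n] splits into pieces with finest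
   element [tau], each attached to the lower levels along an acyclic set. *)
Lemma acyclic_morse L (N : T -> nat) (rho : T -> T) b :
  L b ->
  (forall s : T, L s -> [&& L (rho s), le (rho s) s & N (rho s) == N s]) ->
  (forall s t : T, L s -> L t -> lt s t -> N t <= N s)%N ->
  (forall s t : T, L s -> L t -> lt s t -> N s = N t -> rho s = rho t) ->
  (forall t : T, L t -> rho t = t -> t != b ->
     exists s : T, [&& L s, le t s & (N s < N t)%N]) ->
  (forall t : T, L t -> rho t = t -> t != b ->
     acyclic_on (fun s : T => [&& L s, le t s & (N s < N t)%N])) ->
  acyclic_on L.
Proof.
move=> Lb Lrho Nmono rho_eq desc acyc_desc.
have rhoK (s : T) : L s -> rho (rho s) = rho s.
  move=> Ls; case/and3P: (Lrho s Ls) => Lr /predU1P[rs|ltr] /eqP Nr.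
    by rewrite !rs.
  by apply: rho_eq.
(* Passing to [rho] and then to a strictly lower element ends only at [b], which therefore has the
   least value of [N]. *)
have minN (s : T) : L s -> (N b <= N s)%N.
  have [n] := ubnP (N s); elim: n s => // n IHn s ltn Ls.
  case/and3P: (Lrho s Ls) => Lr _ /eqP Nr; rewrite -Nr.
  case: (eqVneq (rho s) b) => [->//|neq].
  have [t /and3P[Lt _ Nt]] := desc _ Lr (rhoK _ Ls) neq.
  by apply: leq_trans (ltnW Nt); apply: IHn => //; lia.
have rho_min (s : T) : L s -> N s = N b -> rho s = b.
  move=> Ls Nsb; case/and3P: (Lrho s Ls) => Lr _ /eqP Nr.
  apply/eqP; apply: contraT => neq.
  have [t /and3P[Lt _]] := desc _ Lr (rhoK _ Ls) neq.
  by rewrite Nr Nsb ltnNge minN.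
pose Ln n (s : T) := L s && (N s <= n)%N.
suff main k : acyclic_on (Ln (N b + k)%N).
  move=> z chz dz; pose n := (\max_(s <- flatten (dom z)) N s)%N.
  have chnz : supp (chain_in (Ln (N b + n)%N)) z.
    move=> s sz; have /andP[sorts /allP allL] := chz s sz.
    rewrite /chain_in sorts; apply/allP => x xs; rewrite /Ln allL //=.
    have : (N x <= n)%N by apply: leq_bigmax_seq => //; apply/flattenP; exists s.
    by lia.
  have [y chy dy] := main n z chnz dz; exists y => //.
  apply: supp_sub chy => s /andP[sorts alls]; rewrite /chain_in sorts.
  by apply: sub_all alls => x /andP[].
(* On the lowest level every [y] lies above [rho y = b], so this level is a cone. *)
elim: k => [|k]; first rewrite addn0.
  apply: (@acyclic_cone _ b) => [|y /andP[Ly Nyb]]; first by rewrite /Ln Lb leqnn.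
  have <- : rho y = b by apply: rho_min => //; apply/eqP; rewrite eqn_leq Nyb minN.
  by case/and3P: (Lrho y Ly).
rewrite addnS; move: (N b + k)%N (leq_addr k (N b)) => n leNn IHn.
(* [N] does not increase along a chain, so the head decides whether a chain meets level [n.+1]. [R]
   lists the pieces of that level containing a head; they are removed one by one. *)
suff main (R : seq T) z : supp (chain_in (Ln n.+1)) z -> boundary z = 0 ->
    (forall x s, x :: s \in dom z -> N x = n.+1 -> rho x \in R) ->
    exists2 y, supp (chain_in (Ln n.+1)) y & boundary y = z.
  move=> z chz dz; apply: (main (map rho (flatten (dom z)))) => // x s xsz _.
  by apply: map_f; apply/flattenP; exists (x :: s) => //; exact: mem_head.
elim: R z => [|tau R IHR] z chz dz headz.
  have [|y chy dy] := IHn z _ dz.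
    move=> [//|x s] xsz; have := chz _ xsz; rewrite /chain_in /=.
    case/andP=> pths /andP[/andP[Lx leNx] /allP allL].
    have ltNx : (N x <= n)%N.
      rewrite leqNgt; apply/negP => ltnN.
      by have := headz x s xsz; rewrite in_nil => nilF; apply/notF/nilF; lia.
    rewrite pths /Ln Lx ltNx /=; apply/allP => y ys.
    have /andP[-> _] := allL _ ys; apply: leq_trans ltNx; apply: Nmono => //.
      by case/andP: (allL _ ys).
    by move: pths; rewrite (path_sortedE lt_trans) => /andP[/allP/(_ _ ys)].
  exists y => //; apply: supp_sub chy => s /andP[sorts alls].
  rewrite /chain_in sorts; apply: sub_all alls => x /andP[Lx ltNx].
  by rewrite /Ln Lx ltnW.
pose Q x := (N x == n.+1) && (rho x == tau).
pose P s := if s is x :: _ then Q x else false.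
case: (boolP (has P (dom z))) => [/hasP[[//|x0 s0] xs0z Px0]|/hasPn noP]; last first.
  apply: IHR => // x s xsz Nx; have := headz x s xsz Nx; rewrite inE.
  by have /= := noP _ xsz; rewrite /Q Nx eqxx /= => /negPf->.
pose part (p : pred (seq T)) : C -> C := lin (fun s => if p s then << s >> else 0).
have suppP p : supp (fun s => [&& p s, chain_in (Ln n.+1) s & s \in dom z]) (part p z).
  rewrite /part; apply: (@supp_lin _ _ (fun s => chain_in (Ln n.+1) s && (s \in dom z))).
    move=> s chs; case: ifP => ps; last exact: supp0.
    by apply: suppU; rewrite ps.
  by move=> s sz; rewrite sz chz.
have zE : z = part P z + part (predC P) z.
  symmetry; apply: (additive_ext_dom (g := lin _ \+ lin _) (h := idfun)) => s _ /=.
  by rewrite !linU /=; case: (P s); rewrite ?addr0 ?add0r.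
move: (part P z) (part (predC P) z) zE (suppP P) (suppP (predC P)) => z1 z2 zE.
move=> {suppP} chz1 chz2.
have /andP[/eqP Nx0 /eqP rx0] : Q x0 := Px0.
have Lx0 : L x0 by have := chz _ xs0z; rewrite chain_in_cons => /and3P[/andP[]].
have /and3P[] := Lrho x0 Lx0; rewrite rx0 Nx0 => Ltau _ /eqP Ntau.
have rtau : rho tau = tau by rewrite -rx0 rhoK.
have neqb : tau != b by apply: contraTneq leNn => eqb; rewrite -eqb Ntau; lia.
have acyc := acyc_desc tau Ltau rtau neqb.
have up s : chain_in (Ln n.+1) s && P s ->
    chain_in (fun x => Ln n.+1 x && le tau x) s.
  case: s => [|x s]; rewrite ?andbF // !chain_in_cons.
  case/andP=> /and3P[Lnx ltx /andP[sorts allL]] /andP[/eqP Nx /eqP rx].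
  have /andP[Lx _] := Lnx; have lex : le tau x.
    by rewrite -rx; case/and3P: (Lrho x Lx).
  rewrite Lnx lex ltx /chain_in sorts /= all_predI allL /=.
  by apply: sub_all ltx => y ltxy; apply: le_trans lex _; rewrite /le ltxy orbT.
have down s : chain_in (Ln n.+1) s && ~~ P s ->
    chain_in (fun x => Ln n.+1 x && ~~ Q x) s.
  case: s => [//|x s]; rewrite !chain_in_cons /=.
  case/andP=> /and3P[Lnx ltx /andP[sorts allL]] nQx.
  rewrite Lnx nQx ltx /chain_in sorts /=; apply/allP => y ys.
  have /andP[Ly Ny] := allP allL y ys; rewrite /Ln Ly Ny /=.
  apply: contraNN nQx => /andP[/eqP Nyn /eqP ry].
  have /andP[Lx Nx] := Lnx; have ltxy := allP ltx y ys.
  have Nxn : N x = n.+1.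
    by apply/eqP; rewrite eqn_leq Nx -Nyn Nmono.
  by rewrite /Q Nxn eqxx (rho_eq x y) ?ry //= Nxn Nyn.
have dz1 : boundary z1 = - boundary z2.
  by apply/eqP; rewrite -subr_eq0 opprK -(raddfD boundary) /= -zE dz.
(* The boundary of [z1] lies above [tau]. Being also the boundary of [- z2], it avoids the piece of
   [tau], and whatever lies above [tau] on the same level belongs to that piece; only lower levels
   remain. *)
have chd1 : supp (chain_in (fun x => [&& L x, le tau x & (N x < N tau)%N]))
    (boundary z1).
  have s1 : supp (chain_in (fun x => Ln n.+1 x && le tau x)) (boundary z1).
    by apply: supp_boundary; apply: supp_sub chz1 => s /and3P[Ps chs _];
      apply: up; rewrite chs.
  have s2 : supp (chain_in (fun x => Ln n.+1 x && ~~ Q x)) (boundary z1).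
    rewrite dz1; apply/suppN/supp_boundary; apply: supp_sub chz2 => s.
    by case/and3P=> nPs chs _; apply: down; rewrite chs.
  move=> s sd; have /andP[sorts /allP all1] := s1 s sd.
  have /andP[_ /allP all2] := s2 s sd.
  rewrite /chain_in sorts; apply/allP => x xs.
  have /andP[/andP[Lx Nx] lex] := all1 _ xs; rewrite Lx lex Ntau ltn_neqAle Nx /=.
  have /andP[_] := all2 _ xs; rewrite /Q; case: eqP => // Nxn /=.
  case/predU1P: lex => [<-|ltx]; first by rewrite rtau eqxx.
  by rewrite -(rho_eq _ _ Ltau Lx ltx) ?rtau ?eqxx // Ntau Nxn.
have [y0 chy0 dy0] := acyc _ chd1 (boundary_boundary _).
have chy0' : supp (chain_in (fun x => [&& L x, le tau x & (N x <= n)%N])) y0.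
  by apply: supp_sub chy0 => s; rewrite Ntau.
(* With [y0] filling [boundary z1] below the level, [z1 - y0] is a cycle in a cone over [tau], and
   [z2 + y0] has no head left in this piece. *)
have [||||y1 chy1 dy1] :=
  @acyclic_cone (fun x => Ln n.+1 x && le tau x) tau _ _ (z1 - y0).
- by rewrite /Ln Ltau Ntau leqnn le_refl.
- by move=> y /andP[].
- apply: suppB.
    by apply: supp_sub chz1 => s /and3P[Ps chs _]; apply: up; rewrite chs.
  apply: supp_sub chy0' => s /andP[sorts alls]; rewrite /chain_in sorts.
  by apply: sub_all alls => x /and3P[Lx -> Nx]; rewrite /Ln Lx ltnW.
- by rewrite (raddfB boundary) /= dy0 subrr.
have [|||y2 chy2 dy2] := IHR (z2 + y0).
- apply: suppD; first by apply: supp_sub chz2 => s /and3P[].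
  apply: supp_sub chy0' => s /andP[sorts alls]; rewrite /chain_in sorts.
  by apply: sub_all alls => x /and3P[Lx _ Nx]; rewrite /Ln Lx ltnW.
- by rewrite (raddfD boundary) /= dy0 dz1 addrN.
- move=> x s xs Nx.
  have : supp (fun t => if t is y :: _ then (N y == n.+1) ==> (rho y \in R) else true)
      (z2 + y0).
    apply: suppD.
      apply: supp_sub chz2 => -[//|y t] /and3P[/= nQy _ ytz]; apply/implyP => /eqP Ny.
      have := headz y t ytz Ny; rewrite inE; case: eqP => // ry.
      by move: nQy; rewrite /Q Ny ry !eqxx.
    apply: supp_sub chy0' => -[//|y t]; rewrite chain_in_cons => /and3P[/and3P[_ _ Ny] _ _].
    by apply/implyP => /eqP NyS; rewrite NyS ltnn in Ny.
  by move=> /(_ _ xs); rewrite Nx eqxx.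
exists (y1 + y2).
  apply: suppD => //; apply: supp_sub chy1 => s /andP[sorts alls].
  by rewrite /chain_in sorts; apply: sub_all alls => x /andP[].
rewrite (raddfD boundary) /= dy1 dy2 zE.
by rewrite addrA [z1 - y0 + z2]addrAC subrK.
Qed.

End Chains.

(** * Modules over group rings *)

Definition additive_of (M N : zmodType) (f : M -> N) (fB : zmod_morphism f) :
    {additive M -> N} := HB.pack f (GRing.isZmodMorphism.Build M N f fB).

Section GHoms.
Variable G : groupType.
Implicit Types M N P : gmodule G.

Definition ghom_of M N (f : M -> N) (fB : zmod_morphism f)
    (fG : forall g x, f (gact g x) = gact g (f x)) : ghom M N :=
  @GHom G M N (additive_of fB) fG.

Definition ghom_id M : ghom M M :=
  @GHom G M M idfun (fun _ _ => erefl).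

Lemma ghom_comp_zmod M N P (g : ghom N P) (f : ghom M N) : zmod_morphism (g \o f).
Proof. by move=> x y; rewrite /= !raddfB. Qed.

Lemma ghom_comp_equiv M N P (g : ghom N P) (f : ghom M N) a x :
  (g \o f) (gact a x) = gact a ((g \o f) x).
Proof. by rewrite /= !ghom_equiv. Qed.

Definition ghom_comp M N P (g : ghom N P) (f : ghom M N) : ghom M P :=
  ghom_of (ghom_comp_zmod g f) (ghom_comp_equiv g f).

Lemma projective_retract M P (i : ghom M P) (r : ghom P M) :
  cancel i r -> projective_gmodule P -> projective_gmodule M.
Proof.
move=> ik projP A B p f ps; have [h hP] := projP A B p (ghom_comp f r) ps.
by exists (ghom_comp h i) => x; rewrite /= hP /= ik.
Qed.

(** ** Submodules *)

Section Submodule.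
Variables (M : gmodule G) (S : M -> Prop).
Hypotheses (S0 : S 0) (SB : forall x y, S x -> S y -> S (x - y))
  (SG : forall g x, S x -> S (gact g x)).

Let Sb : pred M := fun x => `[< S x >].

Lemma submodule_closed : zmod_closed Sb.
Proof.
split=> [|x y /asboolP Sx /asboolP Sy]; apply/asboolP => //; exact: SB.
Qed.

Definition submod_type : Type := {x : M | Sb x}.
HB.instance Definition _ := SubChoice.on submod_type.
HB.instance Definition _ :=
  GRing.SubChoice_isSubZmodule.Build M Sb submod_type submodule_closed.

Definition submod_act (g : G) (x : submod_type) : submod_type :=
  Sub (gact g (val x)) (asboolT (SG g (asboolW (valP x)))).

Lemma submod_act_zmod g : zmod_morphism (submod_act g).
Proof. by move=> x y; apply: val_inj; rewrite /= !raddfB. Qed.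

Lemma submod_act1 x : submod_act 1%g x = x.
Proof. by apply: val_inj; rewrite /= gact1. Qed.

Lemma submod_actM g h x : submod_act (g * h)%g x = submod_act g (submod_act h x).
Proof. by apply: val_inj; rewrite /= gactM. Qed.

Definition submodule : gmodule G :=
  @GModule G submod_type (fun g => additive_of (submod_act_zmod g))
    submod_act1 submod_actM.

Lemma submodule_val_zmod : zmod_morphism (val : submodule -> M).
Proof. by move=> x y; rewrite raddfB. Qed.

Definition submodule_incl : ghom submodule M :=
  ghom_of submodule_val_zmod (fun _ _ => erefl).

Definition submodule_factor (N : gmodule G) (f : ghom N M) (fS : forall x, S (f x)) :
    N -> submodule := fun x => Sub (f x) (asboolT (fS x)).

Lemma submodule_factor_zmod N (f : ghom N M) fS :
  zmod_morphism (@submodule_factor N f fS).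
Proof. by move=> x y; apply: val_inj; rewrite /= !raddfB. Qed.

Lemma submodule_factor_equiv N (f : ghom N M) fS g x :
  @submodule_factor N f fS (gact g x) = gact g (@submodule_factor N f fS x).
Proof. by apply: val_inj; rewrite /= ghom_equiv. Qed.

Definition submodule_corestr N (f : ghom N M) fS : ghom N submodule :=
  ghom_of (@submodule_factor_zmod N f fS) (@submodule_factor_equiv N f fS).

End Submodule.

(** Projectivity lifts along surjections, so [g] is corestricted to its image, a submodule that
    contains the values of [f]. *)
Lemma projective_lift P A B (g : ghom A B) (f : ghom P B) :
  projective_gmodule P -> (forall x, exists a, g a = f x) ->
  exists h : ghom P A, forall x, g (h x) = f x.
Proof.
move=> projP fg; pose S (b : B) := exists a, g a = b.
have S0 : S 0 by exists 0; rewrite raddf0.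
have SB x y : S x -> S y -> S (x - y).
  by move=> [a <-] [b <-]; exists (a - b); rewrite raddfB.
have SG a x : S x -> S (gact a x).
  by move=> [b <-]; exists (gact a b); rewrite ghom_equiv.
pose g' := @submodule_corestr B S S0 SB SG A g (fun a => ex_intro _ a erefl).
pose f' := @submodule_corestr B S S0 SB SG P f fg.
have [|h hP] := projP _ _ g' f'.
  move=> [b bS]; have [a ga] := asboolW bS.
  by exists a; apply: val_inj; rewrite /= ga.
by exists h => x; have /(congr1 val) := hP x.
Qed.

(** ** Permutation modules *)

Section Permutation.
Variables (T : choiceType) (act : G -> T -> T).
Hypotheses (act1 : forall t, act 1%g t = t)
  (actM : forall g h t, act (g * h)%g t = act g (act h t)).

Definition perm_act (g : G) : {freeg T / int} -> {freeg T / int} :=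
  lin (fun t => << act g t >>).
HB.instance Definition _ g := GRing.Additive.on (perm_act g).

Lemma perm_act1 x : perm_act 1%g x = x.
Proof.
move: x; apply: (additive_ext (g := perm_act 1%g) (h := idfun)) => t /=.
by rewrite /perm_act linU act1.
Qed.

Lemma perm_actM g h x : perm_act (g * h)%g x = perm_act g (perm_act h x).
Proof.
move: x; apply: (additive_ext (g := perm_act (g * h)%g)
  (h := perm_act g \o perm_act h)) => t /=.
by rewrite /perm_act !linU actM.
Qed.

Definition perm_module : gmodule G :=
  @GModule G {freeg T / int} (fun g => perm_act g : {additive _ -> _})
    perm_act1 perm_actM.

Lemma perm_moduleU g t : gact g (<< t >> : perm_module) = << act g t >>.
Proof. exact: linU. Qed.

Section Lift.
Variables (M : gmodule G) (f : T -> M).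
Hypothesis fG : forall g t, f (act g t) = gact g (f t).

Lemma perm_lift_equiv g x :
  lin f (gact g (x : perm_module)) = gact g (lin f x).
Proof.
move: x; apply: (additive_ext (g := lin f \o perm_act g)
  (h := gact g \o lin f)) => t /=.
by rewrite /perm_act !linU fG.
Qed.

Definition perm_lift : ghom perm_module M :=
  @GHom G perm_module M (lin f : {additive _ -> _}) perm_lift_equiv.

Lemma perm_liftU t : perm_lift << t >> = f t.
Proof. exact: linU. Qed.

End Lift.

Lemma perm_module_ext (M : gmodule G) (f h : ghom perm_module M) :
  (forall t, f << t >> = h << t >>) -> forall x, f x = h x.
Proof. exact: additive_ext. Qed.

(** Freeness makes each point [t] a unique translate, by [c t], of the representative [r t] of its
    orbit; lifts chosen on representatives extend equivariantly. *)
Lemma perm_module_projective :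
  (forall g t, act g t = t -> g = 1%g) -> projective_gmodule perm_module.
Proof.
move=> free M N p f ps.
pose orb t : pred T := fun t' => `[< exists g, act g t' = t >].
have orbxx t : orb t t by apply/asboolP; exists 1%g.
pose r t := choose (orb t) t.
have rP t : exists g, act g (r t) = t by apply/asboolP/(chooseP (orbxx t)).
have rG g t : r (act g t) = r t.
  have eq_orb : orb (act g t) = orb t.
    apply/funext => t'; apply/asboolP/asboolP => -[h ht].
      by exists (g^-1 * h)%g; rewrite actM ht -actM mulVg act1.
    by exists (g * h)%g; rewrite actM ht.
  by rewrite /r eq_orb; apply: choose_id; rewrite // -eq_orb.
pose c t := projT1 (cid (rP t)).
have cP t : act (c t) (r t) = t by rewrite /c; case: cid.
have cG g t : c (act g t) = (g * c t)%g.
  have e : act (c (act g t)) (r t) = act (g * c t)%g (r t).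
    by rewrite actM cP -(rG g) cP.
  apply/(mulgI (g * c t)^-1%g); rewrite mulVg; apply: (free _ (r t)).
  by rewrite actM e -actM mulVg act1.
pose m t := projT1 (cid (ps (f << t >>))).
have mP t : p (m t) = f << t >> by rewrite /m; case: cid.
have hG g t : gact (c (act g t)) (m (r (act g t))) = gact g (gact (c t) (m (r t))).
  by rewrite cG rG gactM.
exists (perm_lift hG); apply: (@perm_module_ext N (ghom_comp p (perm_lift hG)) f) => t.
rewrite /= (perm_liftU hG) ghom_equiv mP -ghom_equiv.
by rewrite perm_moduleU cP.
Qed.

End Permutation.

End GHoms.

(** * Projective dimension *)

Section ProjectiveDimension.
Variable G : groupType.
Implicit Types M N P K : gmodule G.

(** Projective dimension through successive syzygies: one short exact sequence at a time is the form
    that induction on the module needs. *)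
Fixpoint pd_le (n : nat) M : Prop :=
  if n is k.+1 then
    exists P K (p : ghom P M) (i : ghom K P),
      [/\ projective_gmodule P, surjective_fun p, injective i, exact_at i p
        & pd_le k K]
  else projective_gmodule M.

Lemma ghom_section M P (p : ghom P M) (s : M -> P) : cancel s p ->
  (forall x y, s (x - y) = s x - s y) ->
  (forall g x, s (gact g x) = gact g (s x)) -> projective_gmodule P ->
  projective_gmodule M.
Proof. by move=> sK sB sG; apply: (@projective_retract _ _ _ (ghom_of sB sG) p). Qed.

Lemma projective_bij M P (p : ghom P M) :
  surjective_fun p -> (forall x, p x = 0 -> x = 0) ->
  projective_gmodule P -> projective_gmodule M.
Proof.
move=> ps pker; pose s y := projT1 (cid (ps y)).
have sK : cancel s p by move=> y; rewrite /s; case: cid.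
have pI x y : p x = p y -> x = y.
  by move=> exy; apply/subr0_eq/pker; rewrite raddfB exy subrr.
apply: (ghom_section sK) => *; apply: pI.
  by rewrite raddfB !sK.
by rewrite ghom_equiv !sK.
Qed.

(** The syzygies are the images of the differentials; the last one is isomorphic to [P n] because
    the next term vanishes. *)
Lemma cd_le_pd n : cd_le G n -> pd_le n (trivial_Z G).
Proof.
case=> P [d [eps [projP P0 epsS ex0 exS]]].
pose im i (x : P i) := exists y, d i y = x.
have im0 i : @im i 0 by exists 0; rewrite raddf0.
have imB i x y : @im i x -> @im i y -> @im i (x - y).
  by move=> [a <-] [b <-]; exists (a - b); rewrite raddfB.
have imG i g x : @im i x -> @im i (gact g x).
  by move=> [a <-]; exists (gact g a); rewrite ghom_equiv.
pose Im i := submodule (im0 i) (@imB i) (@imG i).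
pose di i : ghom (P i.+1) (Im i) :=
  @submodule_corestr G _ _ (im0 i) (@imB i) (@imG i) _ (d i) (fun y => ex_intro _ y erefl).
have diS i : surjective_fun (di i).
  by move=> [x Sx]; have [y dy] := asboolW Sx; exists y; apply: val_inj.
have diE i x : di i x = 0 <-> d i x = 0.
  by split=> [dx|dx]; [move/(congr1 val): dx | apply: val_inj].
have pdIm k : forall i, (i + k.+1)%N = n -> pd_le k (Im i).
  elim: k => [|k IHk] i ikn.
    apply: (projective_bij (diS i)) => // x /diE /exS[y <-].
    by rewrite (P0 i.+2 _ y) ?raddf0 //; lia.
  exists (P i.+1), (Im i.+1), (di i).
  exists (submodule_incl (im0 i.+1) (@imB i.+1) (@imG i.+1)); split=> //.
  - exact: val_inj.
  - move=> x; split=> [/diE/exS xim|[y <-]].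
      by exists (Sub x (asboolT xim)).
    by apply/diE/exS; exact: (asboolW (valP y)).
  - by apply: IHk; lia.
case: n P0 pdIm => [|n] P0 pdIm.
  by apply: (projective_bij epsS) => // x /ex0[y <-]; rewrite (P0 1%N _ y) ?raddf0.
exists (P 0%N), (Im 0%N), eps, (submodule_incl (im0 _) (@imB _) (@imG _)).
split=> //; first exact: val_inj; last by apply: pdIm; lia.
move=> x; split=> [/ex0 xim|[y <-]]; first by exists (Sub x (asboolT xim)).
by apply/ex0; exact: (asboolW (valP y)).
Qed.

(** ** Free covers *)

Section Cover.
Variable M : gmodule G.

(** The basis [G * M], translated in its first factor, spans the free module on the underlying set
    of [M]. Projectives are retracts of their covers, which reduces claims about them to formulas on
    a basis. *)
Definition cover_act (g : G) (t : G * M) : G * M := ((g * t.1)%g, t.2).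

Lemma cover_act1 t : cover_act 1%g t = t.
Proof. by case: t => a x; rewrite /cover_act mul1g. Qed.

Lemma cover_actM g h t : cover_act (g * h)%g t = cover_act g (cover_act h t).
Proof. by rewrite /cover_act mulgA. Qed.

Definition cover : gmodule G := perm_module cover_act1 cover_actM.

Lemma cover_actU g (a : G) (x : M) :
  gact g (<< (a, x) >> : cover) = << ((g * a)%g, x) >>.
Proof. exact: perm_moduleU. Qed.

Lemma cover_map_equiv g t :
  gact (cover_act g t).1 (cover_act g t).2 = gact g (gact t.1 t.2).
Proof. exact: gactM. Qed.

Definition cover_map : ghom cover M := perm_lift cover_act1 cover_actM cover_map_equiv.

Lemma cover_mapU t : cover_map << t >> = gact t.1 t.2.
Proof. exact: perm_liftU. Qed.

Lemma cover_act_free g t : cover_act g t = t -> g = 1%g.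
Proof. by case: t => h x [] /eqP; rewrite -{2}[h]mul1g => /eqP/mulIg. Qed.

Lemma cover_map_surj : surjective_fun cover_map.
Proof. by move=> x; exists << (1%g, x) >>; rewrite cover_mapU gact1. Qed.

Lemma projective_cover : projective_gmodule M ->
  exists i : ghom M cover, cancel i cover_map.
Proof. by move=> /(_ _ _ cover_map (ghom_id M) cover_map_surj)[i iP]; exists i. Qed.

End Cover.

End ProjectiveDimension.

(** ** Restriction along a group homomorphism *)

Section Restriction.
Variables (A G : groupType) (phi : A -> G).
Hypothesis phiM : {morph phi : x y / (x * y)%g}.

Lemma morph1 : phi 1%g = 1%g.
Proof. by apply: (mulgI (phi 1%g)); rewrite -phiM !mulg1. Qed.

Lemma restrict_act1 (M : gmodule G) (x : M) : gact (phi 1%g) x = x.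
Proof. by rewrite morph1 gact1. Qed.

Lemma restrict_actM (M : gmodule G) a b (x : M) :
  gact (phi (a * b)%g) x = gact (phi a) (gact (phi b) x).
Proof. by rewrite phiM gactM. Qed.

Definition restrict (M : gmodule G) : gmodule A :=
  @GModule A M (fun a => gact (phi a)) (@restrict_act1 M) (@restrict_actM M).

Definition restrict_hom (M N : gmodule G) (f : ghom M N) :
    ghom (restrict M) (restrict N) :=
  @GHom A (restrict M) (restrict N) f (fun a x => ghom_equiv f (phi a) x).

(** An injective [phi] keeps the action on the basis of the cover free, and retracts survive
    restriction. *)
Lemma restrict_projective (P : gmodule G) :
  injective phi -> projective_gmodule P -> projective_gmodule (restrict P).
Proof.
move=> phiI projP; have [i ik] := projective_cover projP.
apply: (@projective_retract _ _ (restrict (cover P)) (restrict_hom i)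
  (restrict_hom (cover_map P)) ik).
pose act a (t : G * P) := cover_act (phi a) t.
have act1 t : act 1%g t = t by rewrite /act morph1 cover_act1.
have actM a b t : act (a * b)%g t = act a (act b t).
  by rewrite /act phiM cover_actM.
have free : projective_gmodule (perm_module act1 actM).
  apply: perm_module_projective => a t /cover_act_free.
  by rewrite -morph1 => /phiI.
apply: (@projective_retract _ (restrict (cover P)) (perm_module act1 actM)
  (@GHom A (restrict (cover P)) (perm_module act1 actM) idfun (fun _ _ => erefl))
  (@GHom A (perm_module act1 actM) (restrict (cover P)) idfun (fun _ _ => erefl))) => //.
Qed.

Lemma restrict_pd n (M : gmodule G) :
  injective phi -> pd_le n M -> pd_le n (restrict M).
Proof.
move=> phiI; elim: n M => [|n IHn] M /=; first exact: restrict_projective.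
case=> P [K [p [i [projP ps iI ex pdK]]]].
exists (restrict P), (restrict K), (restrict_hom p), (restrict_hom i).
by split=> //; [exact: restrict_projective | exact: IHn].
Qed.

Lemma restrict_pd_Z n : injective phi ->
  pd_le n (trivial_Z G) -> pd_le n (trivial_Z A).
Proof.
move=> phiI /(restrict_pd phiI).
case: n => [|n].
  apply: (@projective_retract _ (trivial_Z A) (restrict (trivial_Z G))
   (@GHom A (trivial_Z A) (restrict (trivial_Z G)) idfun (fun _ _ => erefl))
   (@GHom A (restrict (trivial_Z G)) (trivial_Z A) idfun (fun _ _ => erefl))) => //.
case=> P [K [p [i [projP ps iI ex pdK]]]]; exists P, K.
by exists (@GHom A P (trivial_Z A) p (fun g x => ghom_equiv p g x)), i.
Qed.

End Restriction.

(** ** Groups of finite cohomological dimension are torsion-free *)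

Section FiniteGroup.
Variables (C : groupType) (s : seq C).
Hypotheses (us : uniq s) (sT : forall c, c \in s).

Lemma sum_translate (M : zmodType) (F : C -> M) a :
  \sum_(c <- s) F (a * c)%g = \sum_(c <- s) F c.
Proof.
rewrite -(big_map (fun c => (a * c)%g) xpredT F); apply: perm_big.
apply: uniq_perm => //; first by rewrite map_inj_uniq //; exact: mulgI.
by move=> c; rewrite sT; apply/mapP; exists (a^-1 * c)%g; rewrite ?mulVKg.
Qed.

(** On the cover, [q] keeps the basis elements with group coordinate 1, and its conjugates by the
    group sum to the identity; the formula passes to retracts. *)
Lemma trace_projective (P : gmodule C) : projective_gmodule P ->
  exists pi : {additive P -> P},
    forall x, x = \sum_(c <- s) gact c (pi (gact c^-1%g x)).
Proof.
move=> /projective_cover[i iK].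
pose q : cover P -> {freeg (C * P) / int} :=
  lin (fun t : C * P => if t.1 == 1%g then << t >> else 0).
have qB : zmod_morphism q by exact: raddfB.
have qU (a : C) (y : P) : q << (a, y) >> = if a == 1%g then << (a, y) >> else 0.
  exact: linU.
have qP x : x = \sum_(c <- s) gact c (q (gact c^-1%g x) : cover P).
  pose tr (x : cover P) := \sum_(c <- s) gact c (q (gact c^-1%g x) : cover P).
  have trB : zmod_morphism tr.
    by move=> a b; rewrite /tr -sumrB; apply: eq_bigr => c _; rewrite raddfB qB raddfB.
  apply: (additive_ext (g := idfun) (h := additive_of trB)) => -[a y].
  rewrite /= /tr (bigD1_seq a) //= big1 ?addr0 => [|c ca].
    by rewrite cover_actU qU mulVg eqxx cover_actU mulg1.
  rewrite cover_actU qU.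
  case: eqP => [/mulg1_eq|_]; last by rewrite raddf0.
  by rewrite invgK => eca; rewrite eca eqxx in ca.
have piB : zmod_morphism (cover_map P \o q \o i).
  by move=> a b; rewrite /= raddfB qB raddfB.
exists (additive_of piB) => x.
rewrite -[LHS]iK [in LHS](qP (i x)) raddf_sum; apply: eq_bigr => c _.
by rewrite ghom_equiv /= (ghom_equiv i).
Qed.

Lemma equivariant_retraction (K P : gmodule C) (i : ghom K P) (r : {additive P -> K}) :
  projective_gmodule K -> cancel i r -> exists r' : ghom P K, cancel i r'.
Proof.
move=> /trace_projective[pi piP] ik.
pose f x := \sum_(c <- s) gact c (pi (r (gact c^-1%g x))).
have fB : zmod_morphism f.
  by move=> a b; rewrite /f -sumrB; apply: eq_bigr => c _; rewrite !raddfB.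
have fG g x : f (gact g x) = gact g (f x).
  rewrite /f raddf_sum -(sum_translate _ g); apply: eq_bigr => c _.
  by rewrite -gactM invgM -gactM mulgVK gactM.
exists (ghom_of fB fG) => x; rewrite /= /f [RHS]piP; apply: eq_bigr => c _.
by rewrite -ghom_equiv ik.
Qed.

Definition additively_projective (M : zmodType) : Prop :=
  forall (A B : zmodType) (p : {additive A -> B}) (f : {additive M -> B}),
  surjective_fun p -> exists h : {additive M -> A}, forall x, p (h x) = f x.

Lemma additively_projective_retract (M N : zmodType) (i : {additive M -> N})
    (r : {additive N -> M}) :
  cancel i r -> additively_projective N -> additively_projective M.
Proof.
move=> iK projN A B p f ps; have [h hP] := projN A B p (f \o r) ps.
by exists (h \o i) => x; rewrite /= hP /= iK.
Qed.

Lemma projective_additively (P : gmodule C) :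
  projective_gmodule P -> additively_projective P.
Proof.
move=> /projective_cover[i iK].
apply: (additively_projective_retract (N := cover P) iK) => A B p f ps.
exists (lin (fun t => projT1 (cid (ps (f << t >>))))) => x.
apply: (additive_ext (g := p \o lin _) (h := f)) => t /=.
by rewrite linU; case: cid.
Qed.

(** The first syzygy sequence splits additively. Once the syzygy is known to be projective, the
    trace formula averages that splitting into an equivariant one. *)
Lemma finite_pd_projective n (M : gmodule C) :
  additively_projective M -> pd_le n M -> projective_gmodule M.
Proof.
elim: n M => [//|n IHn] M projM [P [K [p [i [projP ps iI ex pdK]]]]].
have [h hP] := projM _ _ p idfun ps.
have hK x : exists y, i y = x - h (p x).
  by apply/ex; rewrite raddfB hP subrr.
pose r x := projT1 (cid (hK x)).
have rP x : i (r x) = x - h (p x) by rewrite /r; case: cid.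
have rB : zmod_morphism r.
  move=> x y; apply: iI; rewrite raddfB !rP (raddfB p) (raddfB h) /= !opprB !addrA.
  by rewrite (ACl (1*4*3*2)).
have iK : cancel i (additive_of rB).
  move=> y; apply: iI; rewrite /= rP.
  have -> : p (i y) = 0 by apply/ex; exists y.
  by rewrite raddf0 subr0.
have projK : projective_gmodule K.
  apply: IHn pdK; apply: (additively_projective_retract iK).
  exact: projective_additively.
have [r' r'K] := equivariant_retraction projK iK.
pose q x := x - i (r' x).
have qi y : q (i y) = 0 by rewrite /q r'K subrr.
have qP x : p (q x) = p x.
  by rewrite raddfB; have -> : p (i (r' x)) = 0; [apply/ex; exists (r' x) | rewrite subr0].
have qI x y : p x = p y -> q x = q y.
  move=> exy; have /ex[z iz] : p (x - y) = 0 by rewrite raddfB exy subrr.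
  apply/subr0_eq; rewrite -(qi z) iz /q (raddfB r') (raddfB i) !opprB !addrA.
  by rewrite (ACl (1*4*3*2)).
pose s0 y := q (projT1 (cid (ps y))).
have s0P x : s0 (p x) = q x by apply: qI; case: cid.
apply: (@ghom_section _ M P p s0) => // [y|x y|g y].
- by have [x <-] := ps y; rewrite s0P qP.
- have [a <-] := ps x; have [b <-] := ps y; rewrite -raddfB !s0P /q.
  by rewrite (raddfB r') (raddfB i) !opprB !addrA (ACl (1*4*3*2)).
- have [a <-] := ps y; rewrite -ghom_equiv !s0P /q raddfB.
  by rewrite !ghom_equiv.
Qed.

(** If the integers were projective, the trace formula at 1 would make 1 a multiple of [size s]. *)
Lemma finite_group_pd n : (1 < size s)%N -> ~ pd_le n (trivial_Z C).
Proof.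
move=> s1 /finite_pd_projective projZ.
have /trace_projective[pi /(_ 1)] : projective_gmodule (trivial_Z C).
  apply: projZ => A B p f ps; have [a pa] := ps (f 1).
  have hB : zmod_morphism (fun k : int => a *~ k) by move=> x y; rewrite mulrzBr.
  by exists (additive_of hB) => x /=; rewrite raddfMz pa -raddfMz intz.
rewrite /= big_const_seq count_predT iter_addr_0 => e1.
have := congr1 absz e1; rewrite -mulr_natr natz abszM absz_nat.
by move/esym/eqP; rewrite muln_eq1 => /andP[_ /eqP s_eq1]; rewrite s_eq1 in s1.
Qed.

End FiniteGroup.

Section TorsionFree.
Variable G : groupType.

Section Powers.
Variables (x : G) (n : nat).
Hypotheses (n0 : (0 < n)%N) (xn : (x ^+ n = 1)%g).

Definition powers : {pred G} := fun y => y \in [seq (x ^+ i)%g | i <- iota 0 n].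

Lemma powersP y : reflect (exists i, y = (x ^+ i)%g) (y \in powers).
Proof.
apply: (iffP mapP) => [[i _ ->]|[i ->]]; first by exists i.
exists (i %% n)%N; first by rewrite mem_iota /= add0n ltn_mod.
rewrite {1}(divn_eq i n) expgnDr mulnC expgnA xn.
by rewrite expg1n mul1g.
Qed.

Lemma powers_mul : mulg_closed powers.
Proof.
by move=> _ _ /powersP[i ->] /powersP[j ->]; apply/powersP; exists (i + j)%N; rewrite expgnDr.
Qed.

Lemma powers1 : (1 \in powers)%g. Proof. by apply/powersP; exists 0%N. Qed.

Lemma powers_inv : invg_closed powers.
Proof.
move=> _ /powersP[i ->]; apply/powersP; exists (i * n.-1)%N; apply: mulg1_eq.
by rewrite -expgnDr -mulnS prednK // mulnC expgnA xn expg1n.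
Qed.

HB.instance Definition _ := isMulClosed.Build G powers powers_mul.
HB.instance Definition _ := isMul1Closed.Build G powers powers1.
HB.instance Definition _ := isInvClosed.Build G powers powers_inv.

Definition power_group : groupType := subgroup_group (powers : subgroup G).

End Powers.

(** Finite projective dimension of the integers restricts to the finite cyclic subgroup generated by
    a torsion element. *)
Lemma cd_le_torsion_free n : cd_le G n -> torsion_free G.
Proof.
move=> /cd_le_pd pdG x k k0 xk; apply/eqP/contraT => x1.
pose C := power_group k0 xk.
pose s : seq C := undup (pmap insub [seq (x ^+ i)%g | i <- iota 0 k]).
have sT c : c \in s.
  rewrite mem_undup mem_pmap_sub; exact: (valP c).
have us : uniq s := undup_uniq _.
have pdC : pd_le n (trivial_Z C).
  by apply: (@restrict_pd_Z C G val _ n val_inj) => // a b; rewrite gmulfM.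
case: (@finite_group_pd C s us sT n _ pdC).
have x1s : (x \in powers x k) by apply/(powersP k0 xk); exists 1%N; rewrite expg1.
case: s us sT {pdC} => [|a [|b r]] // _ sT; first by have := sT 1%g.
have := sT 1%g; have := sT (Sub x x1s); rewrite !inE => /eqP <- /eqP /(congr1 val) /=.
by move=> e; rewrite -e eqxx in x1.
Qed.

End TorsionFree.

(** ** Free abelian groups of finite rank *)

Definition zext (A : groupType) : Type := (int * A)%type.

Section ZExt.
Variable A : groupType.

HB.instance Definition _ := Choice.on (zext A).

Definition zext_mul (x y : zext A) : zext A := (x.1 + y.1, (x.2 * y.2)%g).
Definition zext_one : zext A := (0, 1%g).
Definition zext_inv (x : zext A) : zext A := (- x.1, (x.2^-1)%g).

Lemma zext_mulA : associative zext_mul.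
Proof. by move=> x y z; rewrite /zext_mul addrA mulgA. Qed.
Lemma zext_mul1 : left_id zext_one zext_mul.
Proof. by case=> n a; rewrite /zext_mul add0r mul1g. Qed.
Lemma zext_mulr1 : right_id zext_one zext_mul.
Proof. by case=> n a; rewrite /zext_mul addr0 mulg1. Qed.
Lemma zext_mulV : left_inverse zext_one zext_inv zext_mul.
Proof. by case=> n a; rewrite /zext_mul /= addNr mulVg. Qed.
Lemma zext_mulrV : right_inverse zext_one zext_inv zext_mul.
Proof. by case=> n a; rewrite /zext_mul /= addrN mulgV. Qed.

HB.instance Definition _ := isGroup.Build (zext A)
  zext_mulA zext_mul1 zext_mulr1 zext_mulV zext_mulrV.

Definition zext_in (a : A) : zext A := (0, a).
Definition zext_gen : zext A := (1, 1%g).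

Lemma zext_inM : {morph zext_in : x y / (x * y)%g}.
Proof. by move=> x y; congr pair; rewrite addr0. Qed.

Lemma zext_genC (x : zext A) : (zext_gen * x = x * zext_gen)%g.
Proof.
by case: x => n a; congr pair; [exact: addrC | rewrite /= mulg1 mul1g].
Qed.

Local Notation t := zext_gen.

(* The sum of [f i] for [0 <= i < n], understood with the opposite sign for
   negative [n]. *)
Definition int_sum (N : zmodType) (f : int -> N) (n : int) : N :=
  match n with
  | Posz k => \sum_(i < k) f i
  | Negz k => - \sum_(i < k.+1) f (- i.+1%:Z)
  end.

Lemma int_sumS (N : zmodType) (f : int -> N) n :
  int_sum f (1 + n) - int_sum f n = f n.
Proof.
case: n => [k|[|k]].
- by rewrite -PoszD add1n /= big_ord_recr /= addrAC subrr add0r.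
- by rewrite /= big_ord0 big_ord_recr big_ord0 /= !add0r opprK.
- have -> : 1 + Negz k.+1 = Negz k by rewrite !NegzE; lia.
  rewrite /= [in X in _ - X]big_ord_recr /= opprK addrA addNr add0r.
  by rewrite NegzE.
Qed.

Lemma int_sum_additive (N N' : zmodType) (h : {additive N -> N'}) f n :
  h (int_sum f n) = int_sum (h \o f) n.
Proof. by case: n => k; rewrite /= ?raddfN raddf_sum. Qed.

(* A projective module is free over the infinite cyclic factor, so the
   equation [psi (t x - x) = phi x] can be solved by recursion on powers of [t]. *)
Lemma projective_integrate (P : gmodule (zext A)) (N : gmodule A)
    (phi : ghom (restrict zext_inM P) N) : projective_gmodule P ->
  exists psi : ghom (restrict zext_inM P) N,
    forall x : P, phi x = psi (gact t x - x).
Proof.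
move=> /projective_cover[i iK].
pose e (a : A) (x : P) (n : int) : N := phi (cover_map P << ((n, a) : zext A, x) >>).
pose psi0 (y : zext A * P) : N := int_sum (e y.1.2 y.2) y.1.1.
have psi0S y : psi0 ((t * y.1)%g, y.2) - psi0 y = phi (cover_map P << y >>).
  by case: y => [[n a] x]; rewrite /psi0 /= mul1g int_sumS.
pose psiF : cover P -> N := lin psi0.
have psiFB : zmod_morphism psiF by exact: raddfB.
have psiFU y : psiF << y >> = psi0 y by exact: linU.
have psiFt (x : cover P) : psiF (gact t x - x) = phi (cover_map P x).
  pose l : cover P -> N := fun x => psiF (gact t x - x).
  have lB : zmod_morphism l.
    move=> a b; rewrite /l -psiFB raddfB; congr psiF.
    by rewrite !opprB !addrA (ACl (1*4*3*2)).
  have rB : zmod_morphism (fun x : cover P => phi (cover_map P x)).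
    by move=> a b; rewrite !raddfB.
  move: x; apply: (additive_ext (g := additive_of lB) (h := additive_of rB)) => -[b x].
  by rewrite /= /l psiFB cover_actU !psiFU -psi0S.
have phiA (a : A) (y : P) : phi (gact (zext_in a) y) = gact a (phi y).
  exact: (ghom_equiv phi).
have psiFa (a : A) (x : cover P) : psiF (gact (zext_in a) x) = gact a (psiF x).
  have lB : zmod_morphism (fun x : cover P => psiF (gact (zext_in a) x)).
    by move=> u v; rewrite raddfB psiFB.
  have rB : zmod_morphism (fun x : cover P => gact a (psiF x)).
    by move=> u v; rewrite psiFB raddfB.
  move: x; apply: (additive_ext (g := additive_of lB) (h := additive_of rB)).
  move=> -[[n b] x]; rewrite /= cover_actU !psiFU /psi0 /= add0r int_sum_additive.
  congr int_sum; apply/funext => k; rewrite /= /e -phiA -ghom_equiv.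
  by rewrite cover_actU; congr (phi (cover_map P << (_, x) >>)); congr pair; rewrite add0r.
have psiB : zmod_morphism (psiF \o i) by move=> a b; rewrite /= raddfB psiFB.
have psiA a (x : restrict zext_inM P) : (psiF \o i) (gact a x) = gact a ((psiF \o i) x).
  by rewrite /= ghom_equiv psiFa.
exists (@ghom_of A (restrict zext_inM P) N (psiF \o i) psiB psiA) => x.
by rewrite /= raddfB ghom_equiv psiFt iK.
Qed.

(* [t - 1] acts on [M] as a composite through a projective module, that is,
   as zero in the stable category; this property passes to syzygies. *)
Definition stably_trivial (M : gmodule (zext A)) : Prop :=
  exists (Q : gmodule (zext A)) (j : ghom M Q) (h : ghom Q M),
    projective_gmodule Q /\ forall x, h (j x) = gact t x - x.

(** Subtracting from [t - 1] on [P] a lift of its factorization through [Q] leaves a map into the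
    kernel of [p], which lifts to [K]; on [K] the subtracted term vanishes. *)
Lemma stably_trivial_syzygy (M P K : gmodule (zext A)) (p : ghom P M) (i : ghom K P) :
  projective_gmodule P -> surjective_fun p -> injective i -> exact_at i p ->
  stably_trivial M -> exists h : ghom P K, forall x, h (i x) = gact t x - x.
Proof.
move=> projP ps iI ex [Q [j [h [projQ hj]]]].
have [k kP] := projective_lift (g := p) (f := h) projQ (fun x => ps (h x)).
pose q (x : P) : P := gact t x - x - k (j (p x)).
have qB : zmod_morphism q.
  move=> x y; rewrite /q (raddfB p) (raddfB j) (raddfB k) (raddfB (gact t)).
  by rewrite !opprB !addrA (ACl (1*4*6*5*3*2)).
have qG g x : q (gact g x) = gact g (q x).
  rewrite /q -gactM zext_genC gactM (ghom_equiv p) (ghom_equiv j) (ghom_equiv k).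
  by rewrite !raddfB.
have qp x : p (q x) = 0.
  by rewrite /q !raddfB kP hj ghom_equiv subrr.
have qi x : exists y, i y = ghom_of qB qG x by apply/ex; exact: qp.
have [r rP] := projective_lift projP qi.
exists r => x; apply: iI; rewrite rP /= /q.
have -> : p (i x) = 0 by apply/ex; exists x.
by rewrite (raddf0 j) (raddf0 k) subr0 (raddfB i) (ghom_equiv i).
Qed.

Lemma zext_pd n (M : gmodule (zext A)) : stably_trivial M -> pd_le n.+1 M ->
  pd_le n (restrict zext_inM M).
Proof.
have inI : injective zext_in by move=> a b [].
elim: n M => [|n IHn] M triv [P [K [p [i [projP ps iI ex pdK]]]]]; last first.
  have [h hi] := stably_trivial_syzygy projP ps iI ex triv.
  exists (restrict zext_inM P), (restrict zext_inM K).
  exists (restrict_hom zext_inM p), (restrict_hom zext_inM i); split=> //.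
    exact: restrict_projective.
  by apply: IHn pdK; exists P, i, h.
(* In the base case [K] is projective, so [psi] undoes [t - 1] on [K] over [A], and [psi] after [h]
   retracts [i]: over [A], the module [M] is a summand of [P]. *)
have [h hi] := stably_trivial_syzygy projP ps iI ex triv.
have [psi psiP] := projective_integrate
  (ghom_id (restrict zext_inM K)) pdK.
pose q (x : P) : P := x - i (psi (h x)).
have qi y : q (i y) = 0 by rewrite /q hi -psiP subrr.
have qP x : p (q x) = p x.
  rewrite raddfB; have -> : p (i (psi (h x))) = 0; last by rewrite subr0.
  by apply/ex; exists (psi (h x)).
have qB : zmod_morphism q.
  move=> x y; rewrite /q (raddfB h) (raddfB psi) (raddfB i) !opprB !addrA.
  by rewrite (ACl (1*4*3*2)).
have qI x y : p x = p y -> q x = q y.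
  move=> exy; have /ex[z iz] : p (x - y) = 0 by rewrite raddfB exy subrr.
  by apply/subr0_eq; rewrite -(qi z) iz qB.
pose s y := q (projT1 (cid (ps y))).
have sP x : s (p x) = q x by apply: qI; case: cid.
apply: (@ghom_section _ (restrict zext_inM M) (restrict zext_inM P)
  (restrict_hom zext_inM p) s) => [y|x y|g y|].
- by have [x <-] := ps y; rewrite sP /= qP.
- have [a <-] := ps x; have [b <-] := ps y; rewrite -[p a - p b]raddfB !sP.
  exact: qB.
- have [a <-] := ps y; 
  have -> : gact g (p a : restrict zext_inM M) = p (gact (zext_in g) a).
    by rewrite ghom_equiv.
  rewrite !sP /q.
  rewrite (ghom_equiv h).
  have -> : psi (gact (zext_in g) (h a)) = gact (zext_in g) (psi (h a)).
    exact: (ghom_equiv psi g (h a)).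
  by rewrite (ghom_equiv i) /= raddfB.
- exact: restrict_projective.
Qed.

Lemma zext_pd_Z n : pd_le n.+1 (trivial_Z (zext A)) -> pd_le n (trivial_Z A).
Proof.
move=> pdZ; have triv : stably_trivial (trivial_Z (zext A)).
  case: (pdZ) => P [K [p [i [projP _ _ _ _]]]].
  have zB : zmod_morphism (fun _ : int => 0 : P) by move=> x y; rewrite subr0.
  have zG g (x : trivial_Z (zext A)) : 0 = gact g (0 : P) by rewrite raddf0.
  have zB' : zmod_morphism (fun _ : P => 0 : int) by move=> x y; rewrite subr0.
  exists P, (@ghom_of _ (trivial_Z (zext A)) P (fun=> 0) zB zG).
  exists (@ghom_of _ P (trivial_Z (zext A)) (fun=> 0) zB' (fun _ _ => erefl)).
  by split=> // x; rewrite /= subrr.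
have := zext_pd triv pdZ; case: n {pdZ triv} => [|n].
  apply: (@projective_retract _ (trivial_Z A) (restrict zext_inM (trivial_Z (zext A)))
   (@GHom A (trivial_Z A) (restrict zext_inM (trivial_Z (zext A))) idfun (fun _ _ => erefl))
   (@GHom A (restrict zext_inM (trivial_Z (zext A))) (trivial_Z A) idfun
      (fun _ _ => erefl))) => //.
case=> P [K [p [i [projP ps iI ex pdK]]]]; exists P, K.
by exists (@GHom A P (trivial_Z A) p (fun g x => ghom_equiv p g x)), i.
Qed.

(** [t] acts trivially on the integers, so integrating the identity would give [1 = psi 0]. *)
Lemma zext_pd0 : ~ pd_le 0 (trivial_Z (zext A)).
Proof.
move=> /(projective_integrate (ghom_id (restrict zext_inM (trivial_Z (zext A))))).
by case=> psi /(_ 1); rewrite /= subrr raddf0.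
Qed.

End ZExt.

Fixpoint zpow (r : nat) : groupType :=
  if r is k.+1 then zext (zpow k) else 'I_1.

Lemma zpow_pd r n : pd_le n (trivial_Z (zpow r)) -> (r <= n)%N.
Proof.
by elim: r n => // r IHr [|n] pdZ; [case: (zext_pd0 pdZ) | exact/IHr/zext_pd_Z].
Qed.

(** ** The cellular resolution of a free action on an acyclic poset *)

Section CellularResolution.
Variables (G : groupType) (T : choiceType) (lt : rel T) (L : pred T).
Variables (act : G -> T -> T) (n : nat) (x0 : T).
Hypotheses (ltxx : irreflexive lt) (lt_trans : transitive lt).
Hypotheses (act1 : forall t, act 1%g t = t)
  (actM : forall g h t, act (g * h)%g t = act g (act h t)).
Hypotheses (act_lt : forall g x y, lt (act g x) (act g y) = lt x y)
  (act_L : forall g x, L (act g x) = L x).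
Hypotheses (act_free : forall g x, L x -> act g x = x -> g = 1%g).
Hypotheses (Lx0 : L x0) (acycL : acyclic_on lt L).
Hypothesis chain_bound : forall s, chain_in lt L s -> (size s <= n.+1)%N.

Local Notation C := {freeg (seq T) / int}.
Local Notation bd := (@boundary T).

Definition simplex (i : nat) : Type := {s : seq T | chain_in lt L s && (size s == i.+1)}.
HB.instance Definition _ i := SubChoice.on (simplex i).

Lemma simplex_act_subproof i g (s : simplex i) :
  chain_in lt L (map (act g) (val s)) && (size (map (act g) (val s)) == i.+1).
Proof.
case: s => s /= /andP[/andP[sorts allL] sz]; rewrite size_map sz andbT /chain_in.
rewrite sorted_map (eq_sorted (e' := lt)) ?sorts /=; last by move=> x y; exact: act_lt.
by rewrite all_map (eq_all (a2 := L)) // => x; exact: act_L.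
Qed.

Definition simplex_act i (g : G) (s : simplex i) : simplex i :=
  Sub (map (act g) (val s)) (simplex_act_subproof g s).

Lemma simplex_act1 i (s : simplex i) : simplex_act 1%g s = s.
Proof. by apply: val_inj; rewrite /= (eq_map act1) map_id. Qed.

Lemma simplex_actM i g h (s : simplex i) :
  simplex_act (g * h)%g s = simplex_act g (simplex_act h s).
Proof. by apply: val_inj; rewrite /= -map_comp; apply: eq_map => x /=; exact: actM. Qed.

Definition cells i : gmodule G := perm_module (@simplex_act1 i) (@simplex_actM i).

(** Simplices are sequences, so an element that preserves one fixes its head; freeness on points is
    enough. *)
Lemma cells_projective i : projective_gmodule (cells i).
Proof.
apply: perm_module_projective => g [[|x s] chs] /(congr1 val) /=.
  by move: chs; rewrite andbF.
move=> [gx _]; apply: act_free gx.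
by case/andP: chs; rewrite chain_in_cons // => /and3P[].
Qed.

Definition cell_incl i : cells i -> C := lin (fun s : simplex i => << val s >>).
HB.instance Definition _ i := GRing.Additive.on (@cell_incl i).

Definition cell_proj i : C -> cells i :=
  lin (fun s => if insub s is Some u then << u : simplex i >> else 0).
HB.instance Definition _ i := GRing.Additive.on (@cell_proj i).

Lemma cell_inclK i : cancel (@cell_incl i) (@cell_proj i).
Proof.
apply: (additive_ext (g := @cell_proj i \o @cell_incl i) (h := idfun)) => s /=.
by rewrite /cell_incl /cell_proj !linU valK.
Qed.

Definition chain_size i s := chain_in lt L s && (size s == i).

Lemma supp_cell_incl i x : supp (chain_size i.+1) (@cell_incl i x).
Proof.
apply: (@supp_lin _ _ predT) => // s _; exact/suppU/(valP s).
Qed.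

Lemma cell_projK i z : supp (chain_size i.+1) z -> cell_incl (cell_proj i z) = z.
Proof.
move=> chz; apply: (additive_ext_dom (g := @cell_incl i \o @cell_proj i)
  (h := idfun)) => s /chz chs.
by rewrite /= /cell_proj linU (insubT (chain_size i.+1) chs) /cell_incl linU.
Qed.

Lemma supp_boundary_size i z :
  supp (chain_size i.+1) z -> supp (chain_size i) (bd z).
Proof.
move=> chz.
have ch : supp (chain_in lt L) (bd z).
  by apply: supp_boundary => // s /chz/andP[].
have sz : supp (fun s => size s == i) (bd z).
  apply: (@supp_lin _ _ (fun s => size s == i.+1)); last by move=> s /chz/andP[].
  move=> s; elim: s i {z chz ch} => [|x s IHs] i; first by move=> _; exact: supp0.
  rewrite /= eqSS => szs; apply: suppB; first exact: suppU.
  case: i szs => [|i] szs.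
    by rewrite (size0nil (eqP szs)) /= raddf0; exact: supp0.
  by apply: supp_lin (IHs _ szs) => t szt; exact: suppU.
by move=> s sd; rewrite /chain_size ch //= sz.
Qed.

Definition cell_bd_map i : cells i.+1 -> cells i :=
  @cell_proj i \o bd \o @cell_incl i.+1.

Lemma cell_bd_zmod i : zmod_morphism (@cell_bd_map i).
Proof. by move=> x y; rewrite /cell_bd_map /= (raddfB (@cell_incl i.+1)) !raddfB. Qed.

Lemma cell_incl_act i g (x : cells i) :
  cell_incl (gact g x) = map_chain (act g) (cell_incl x).
Proof.
move: x; apply: (additive_ext (g := @cell_incl i \o gact g)
  (h := map_chain (act g) \o @cell_incl i)) => s.
by rewrite /= /perm_act /cell_incl !linU /map_chain linU.
Qed.

Lemma cell_incl_inj i : injective (@cell_incl i).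
Proof. exact: can_inj (@cell_inclK i). Qed.

Lemma cell_bdE i (x : cells i.+1) : cell_incl (cell_bd_map x) = bd (cell_incl x).
Proof. by rewrite cell_projK //; apply/supp_boundary_size/supp_cell_incl. Qed.

Lemma cell_bd_equiv i g (x : cells i.+1) :
  cell_bd_map (gact g x) = gact g (cell_bd_map x).
Proof.
apply: cell_incl_inj.
by rewrite cell_incl_act !cell_bdE cell_incl_act boundary_map.
Qed.

Definition cell_bd i : ghom (cells i.+1) (cells i) :=
  ghom_of (@cell_bd_zmod i) (@cell_bd_equiv i).

Definition cell_aug_map : cells 0 -> int := lin (fun _ : simplex 0 => 1).
HB.instance Definition _ := GRing.Additive.on cell_aug_map.

Lemma cell_aug_equiv g (x : cells 0) : cell_aug_map (gact g x) = cell_aug_map x.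
Proof.
move: x; apply: (additive_ext (g := cell_aug_map \o gact g) (h := cell_aug_map)) => s.
by rewrite /= /perm_act /cell_aug_map !linU.
Qed.

Lemma cell_aug_zmod : zmod_morphism cell_aug_map.
Proof. exact: raddfB. Qed.

Definition cell_aug : ghom (cells 0) (trivial_Z G) :=
  @ghom_of G (cells 0) (trivial_Z G) cell_aug_map cell_aug_zmod cell_aug_equiv.

Lemma cell_augE (x : cells 0) : bd (cell_incl x) = << [::] >> *~ cell_aug_map x.
Proof.
have rB : zmod_morphism (fun x : cells 0 => << [::] >> *~ cell_aug_map x : C).
  by move=> a b; rewrite cell_aug_zmod mulrzBr.
move: x; apply: (additive_ext (g := bd \o @cell_incl 0) (h := additive_of rB)) => s /=.
rewrite /cell_incl /cell_aug_map !linU boundaryU mulr1z.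
case: s => s chs /=; have /andP[_ szs] := chs.
case: s szs {chs} => [//|x [|//]] _ /=.
by rewrite raddf0 subr0.
Qed.

(** Acyclicity provides a filling whose degree is not controlled; its part of the right length is
    still a filling. *)
Definition size_part k : C -> C := lin (fun s => if size s == k then << s >> else 0).
HB.instance Definition _ k := GRing.Additive.on (size_part k).

Lemma size_part_prefix x k z :
  size_part k.+1 (prefix_chain x z) = prefix_chain x (size_part k z).
Proof.
move: z; apply: (additive_ext (g := size_part k.+1 \o prefix_chain x)
  (h := prefix_chain x \o size_part k)) => s /=.
rewrite prefix_chainU /size_part !linU /= eqSS.
by case: ifP; rewrite ?prefix_chainU // raddf0.
Qed.

Lemma size_part_prefix0 x z : size_part 0 (prefix_chain x z) = 0.
Proof.
move: z; apply: (additive_ext (g := size_part 0 \o prefix_chain x) (h := \0)) => s /=.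
by rewrite prefix_chainU /size_part !linU.
Qed.

Lemma boundary_size_part k z : bd (size_part k.+1 z) = size_part k (bd z).
Proof.
move: z; apply: (additive_ext (g := bd \o size_part k.+1) (h := size_part k \o bd)) => s.
rewrite /= boundaryU; elim: s k => [|x s IHs] k /=.
  by rewrite /size_part linU /= !raddf0.
rewrite -prefix_chainU size_part_prefix boundary_prefix raddfB /=; congr (_ - _).
case: k => [|k]; last by rewrite IHs size_part_prefix.
rewrite size_part_prefix0 /size_part linU; case: ifP => sz0; last by rewrite !raddf0.
by rewrite boundaryU (size0nil (eqP sz0)) /= raddf0.
Qed.

Lemma supp_size_part k z : supp (chain_in lt L) z -> supp (chain_size k) (size_part k z).
Proof.
apply: supp_lin => s chs; case: ifP => szs; last exact: supp0.
by apply: suppU; rewrite /chain_size chs szs.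
Qed.

Lemma cell_exact i (x : cells i) : bd (cell_incl x) = 0 ->
  exists y : cells i.+1, cell_bd_map y = x.
Proof.
move=> dx; have chx := @supp_cell_incl i x.
have [|y chy dy] := acycL _ dx; first by move=> s /chx/andP[].
exists (cell_proj i.+1 (size_part i.+2 y)); apply: cell_incl_inj.
rewrite cell_bdE cell_projK; last exact: supp_size_part.
rewrite boundary_size_part dy.
apply: (additive_ext_dom (g := size_part i.+1) (h := idfun)) => s /chx /andP[_ szs].
by rewrite /= /size_part linU szs.
Qed.

Lemma acyclic_cd_le : cd_le G n.
Proof.
exists cells, cell_bd, cell_aug; split.
- exact: cells_projective.
- move=> i ni x; apply: (additive_ext (g := idfun) (h := \0)) => -[s chs] /=.
  by have /andP[] := chs => /chain_bound + /eqP szs; rewrite szs; lia.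
- move=> k; have ch0 : chain_in lt L [:: x0] && (size [:: x0] == 1)%N.
    by rewrite /chain_in /= Lx0.
  exists (<< Sub [:: x0] ch0 : simplex 0 >> *~ k).
  by rewrite raddfMz /= /cell_aug_map linU intz.
- move=> x; split=> [/= augx|[y <-]].
    by apply: cell_exact; rewrite cell_augE augx mulr0z.
  have /eqP := cell_augE (cell_bd_map y).
  rewrite cell_bdE boundary_boundary eq_sym freegU_mulz intz freegU_eq0.
  by move/eqP.
- move=> i x; split=> [/= dx|[y <-] /=].
    by apply: cell_exact; rewrite -cell_bdE dx raddf0.
  by apply: cell_incl_inj; rewrite !cell_bdE boundary_boundary raddf0.
Qed.

End CellularResolution.

End Homology.

(** * Invariant tree structures on cosets and the action of the outer automorphism group *)

Module TreeStructures.

Set Implicit Arguments.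
Unset Strict Implicit.
Unset Printing Implicit Defensive.

Import Homology.
Local Open Scope group_scope.

(** * Tree structures on a set *)

Lemma size_filter_neq (T : eqType) (y : T) (l : seq T) :
  y \in l -> (size [seq x <- l | x != y] < size l)%N.
Proof.
move=> yl; rewrite size_filter -[X in (_ < X)%N](count_predC (pred1 y)).
by rewrite -[X in (X < _)%N]add0n ltn_add2r -has_count has_pred1.
Qed.

Section TreeLike.
Variable X : choiceType.

(* [s x y z] means that [y] and [z] lie on the same side of [x]; by convention
   [x] is alone on its own side. *)
Definition side := X -> X -> X -> Prop.
Implicit Types (s : side) (x y z t a b c w : X).

Record tree_like s : Prop := TreeLike {
  side_refl : forall x y, s x y y;
  side_sym : forall x y z, s x y z -> s x z y;
  side_trans : forall x y z w, s x y z -> s x z w -> s x y w;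
  side_self : forall x y, s x x y -> y = x;
  side_tree : forall x y z, x <> y -> s x y z \/ s y x z;
  side_fin : forall y z, exists l : seq X, forall x, ~ s x y z -> x \in l }.

(* The vertices [x] and [y] belong to a common block. *)
Definition adj s x y := x <> y /\ forall t, t <> x -> t <> y -> s t x y.

Section Geodesics.
Variable s : side.
Hypothesis sT : tree_like s.
Let srefl := side_refl sT.
Let ssym := side_sym sT.
Let strans := side_trans sT.
Let sself := side_self sT.
Let stree := side_tree sT.

Lemma side_endl x y : x <> y -> ~ s x x y.
Proof. by move=> xy /sself /esym. Qed.

Lemma side_endr x y : x <> y -> ~ s y x y.
Proof. by move=> xy /ssym/sself. Qed.

(** In the [btw_] lemmas, [~ s t x y] is read: [t] lies on the geodesic from [x] to [y], end points
    included. *)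
Lemma btw_sym t x y : ~ s t x y -> ~ s t y x.
Proof. by move=> nt /ssym. Qed.

Lemma btw_neq t x y : ~ s t x y -> x <> y.
Proof. by move=> nt xy; apply: nt; rewrite xy. Qed.

Lemma btw_side t x y : ~ s t x y -> t <> y -> s y t x.
Proof. by move=> nt ty; case: (stree x ty) => // /ssym. Qed.

Lemma btw_sidel t x y : ~ s t x y -> t <> x -> s x t y.
Proof. by move=> /btw_sym; exact: btw_side. Qed.

Lemma btw_trans w t x y : ~ s w x t -> ~ s t x y -> ~ s w x y.
Proof.
move=> nw nt sw; case: (pselect (w = t)) => [wt|wt]; first by apply: nt; rewrite -wt.
case: (stree y wt) => [wty|twy].
  by apply: nw; apply: strans sw _; exact: ssym.
by apply: nt; apply: strans twy; apply/ssym/btw_side.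
Qed.

Lemma btw_transr w t x y : ~ s w t y -> ~ s t x y -> ~ s w x y.
Proof.
move=> /btw_sym nw /btw_sym nt; exact/btw_sym/(btw_trans nw nt).
Qed.

Lemma btw_split w t x y : ~ s w x t -> ~ s t x y -> w <> t -> ~ s t w y.
Proof.
move=> nw nt wt stwy; apply: nt; apply: strans stwy.
exact/ssym/btw_side.
Qed.

Lemma adj_sym x y : adj s x y -> adj s y x.
Proof.
case=> xy h; split; first by move/esym.
by move=> t ty tx; apply/ssym/h.
Qed.

Lemma adj_btw x y t : adj s x y -> ~ s t x y -> t = x \/ t = y.
Proof.
case=> xy h nt; case: (pselect (t = x)) => [|tx]; first by left.
by case: (pselect (t = y)) => [|ty]; [right | case: nt; apply: h].
Qed.

Lemma adj_block x a c : adj s x a -> adj s x c -> s x a c -> a <> c -> adj s a c.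
Proof.
case=> xa ha [xc hc] sac ac; split=> // t ta tc.
case: (pselect (t = x)) => [-> //|tx].
by apply: strans (hc t tx tc); apply/ssym/ha.
Qed.

Lemma adj_side x a c : adj s x a -> adj s x c -> adj s a c -> s x a c.
Proof. by move=> [xa _] [xc _] [ac h]; apply: h. Qed.

(** If [x] and [y] are not adjacent, some [t] lies strictly between them, and fewer points separate
    [x] from [t]. *)
Lemma next_exists x y : x <> y -> exists a, adj s x a /\ ~ s a x y.
Proof.
have [l lP] := side_fin sT x y.
have [n] := ubnP (size l); elim: n l y lP => // n IHn l y lP ltn xy.
case: (pselect (adj s x y)) => [xya|nadj].
  by exists y; split=> //; exact: side_endr.
have [t [tx ty nt]] : exists t, [/\ t <> x, t <> y & ~ s t x y].
  apply: contrapT => nex; apply: nadj; split=> // t tx ty.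
  by apply: contrapT => nt; apply: nex; exists t.
have [||a [xa na]] := IHn [seq w <- l | w != y] t _ _ (fun e => tx (esym e)).
- move=> w nw; have wl : w \in l by apply: lP; exact: btw_trans nw nt.
  rewrite mem_filter wl andbT; apply/eqP => wy; move: nw; rewrite wy => nw.
  by apply: nw; apply/ssym/btw_side.
- have yl : y \in l by apply: lP; exact: side_endr.
  exact: leq_trans (size_filter_neq yl) ltn.
by exists a; split=> //; exact: btw_trans na nt.
Qed.

(** First step of the geodesic from [x] to [y], with the default value [x] when [y = x]. *)
Definition next x y : X :=
  if pselect (exists a, adj s x a /\ ~ s a x y) is left h then projT1 (cid h) else x.

Lemma nextP x y : x <> y -> adj s x (next x y) /\ ~ s (next x y) x y.
Proof.
by move=> /next_exists h; rewrite /next; case: pselect => // h'; case: cid.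
Qed.

Lemma next_adj x y : x <> y -> adj s x (next x y).
Proof. by case/nextP. Qed.

Lemma next_btw x y : x <> y -> ~ s (next x y) x y.
Proof. by case/nextP. Qed.

Lemma next_self x : next x x = x.
Proof. by rewrite /next; case: pselect => // -[a [_ []]]; exact: srefl. Qed.

Lemma next_neq x y : x <> y -> next x y <> x.
Proof. by move=> /next_adj[xa _] /esym. Qed.

Lemma next_side x y : s x (next x y) y.
Proof.
case: (pselect (x = y)) => [->|xy]; first by rewrite next_self.
exact: btw_sidel (next_btw xy) (next_neq xy).
Qed.

Lemma next_uniq x y a : adj s x a -> ~ s a x y -> a = next x y.
Proof.
move=> xa na; have xy := btw_neq na; apply: contrapT => ab.
have [xb nb] := nextP xy; move: (next x y) ab xb nb => b ab [xb hb] nb.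
have [_ ha] := xa.
case: (stree y ab) => [aby|bay].
  by apply: na; apply: strans aby; apply: hb => //; case: xa => + _ => /[swap] ->.
by apply: nb; apply: strans bay; apply: ha; [move/esym | move/esym].
Qed.

Lemma next_of_adj x a : adj s x a -> next x a = a.
Proof. by move=> xa; apply/esym/next_uniq => //; apply: side_endr; case: xa. Qed.

Lemma next_btw_eq x t y : ~ s t x y -> t <> x -> next x t = next x y.
Proof.
move=> nt tx; have [xa na] := nextP (fun e => tx (esym e)).
by apply: next_uniq => //; exact: btw_trans na nt.
Qed.

Lemma next_side_block x y z : x <> y -> x <> z -> s x y z ->
  next x y <> next x z -> adj s (next x y) (next x z).
Proof.
move=> xy xz sxyz; apply: adj_block (next_adj xy) (next_adj xz) _.
apply: strans (next_side x y) _; apply: strans sxyz _; exact/ssym/next_side.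
Qed.

Lemma next_closer x y t : x <> y -> ~ s t (next x y) y -> ~ s t x y /\ t <> x.
Proof.
move=> xy nt; split; first exact: btw_transr nt (next_btw xy).
by move=> tx; apply: nt; rewrite tx; exact: next_side.
Qed.

(** A step from [x] towards [y] shrinks the finite set of separating points: [x] itself leaves
    it. *)
Lemma geodesic_ind (P : X -> X -> Prop) :
  (forall x y, (x <> y -> P (next x y) y) -> P x y) -> forall x y, P x y.
Proof.
move=> IH x y; have [l lP] := side_fin sT x y.
have [n] := ubnP (size l); elim: n x l lP => // n IHn x l lP ltn.
apply: IH => xy; apply: (IHn _ [seq w <- l | w != x]) => [t /(next_closer xy)[nt tx]|].
  by rewrite mem_filter lP // andbT; apply/eqP.
have xl : x \in l by apply: lP; exact: side_endl.
exact: leq_trans (size_filter_neq xl) ltn.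
Qed.

Lemma geodesic_propagate (P : X -> Prop) x y :
  (forall t u, ~ s t x y -> ~ s u x y -> adj s t u -> P t -> P u) -> P x -> P y.
Proof.
move: x y; apply: geodesic_ind => x y IH PP Px.
case: (pselect (x = y)) => [<- //|xy].
apply: (IH xy) => [t u /(next_closer xy)[nt _] /(next_closer xy)[nu _]|].
  exact: PP.
by apply: PP Px; [exact: side_endl | exact: next_btw | exact: next_adj].
Qed.

(* [s0] separates the ends of a geodesic of [s] as soon as it separates the
   neighbours of each interior vertex. *)
Lemma local_to_global (s0 : side) x y : tree_like s0 ->
  (forall t u v, ~ s t x y -> ~ s u x y -> ~ s v x y -> adj s t u -> adj s t v ->
     ~ s t u v -> ~ s0 t u v) ->
  forall t, ~ s t x y -> ~ s0 t x y.
Proof.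
move=> s0T; move: x y; apply: geodesic_ind => x y IH H t nt.
have xy := btw_neq nt.
case: (pselect (next x y = y)) => [ay|ay].
  have xya : adj s x y by rewrite -ay; exact: next_adj.
  by case: (adj_btw xya nt) => ->; [move/(side_self s0T)/esym | move/(side_sym s0T)/(side_self s0T)].
set a := next x y in ay IH.
have Hsub t' : ~ s t' a y -> ~ s t' x y by move/(next_closer xy) => [].
have {}IH : forall t, ~ s t a y -> ~ s0 t a y.
  by apply: IH => // t' u v /Hsub ? /Hsub ? /Hsub ?; exact: H.
(* The step [b] after [a] lies with [y] on one side of [a] for [s0], so the local separation of [x]
   and [b] at [a] separates [x] and [y]. *)
have nax : ~ s0 a x y.
  have [ab nb] := nextP ay; set b := next a y in ab nb.
  have sab0 : s0 a b y.
    have ba : b <> a by exact: next_neq.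
    by case: (side_tree s0T y ba) => // sba; case: (IH b nb); apply: (side_sym s0T);
      apply: (side_sym s0T).
  have nxb : ~ s0 a x b.
    apply: H => //; first exact: next_btw.
    - exact: side_endl.
    - exact: Hsub nb.
    - exact/adj_sym/next_adj.
    move=> sxb; have := next_btw xy; apply; rewrite -/a.
    by apply: strans sxb _; exact: next_side.
  by move=> sxy; apply: nxb; apply: (side_trans s0T) sxy _; exact: (side_sym s0T).
case: (pselect (t = x)) => [->|tx]; first by move/(side_self s0T)/esym.
case: (pselect (t = a)) => [->//|ta].
have nta : ~ s t a y.
  move=> sta; apply: nt; apply: strans sta.
  by have [_ h] := next_adj xy; apply: h => // /esym.
have sat : s0 a t y.
  case: (side_tree s0T y (fun e => ta (esym e))) => //.
  by move=> stay; case: (IH _ nta).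
have stx : s0 t x a.
  have naxt : ~ s0 a t x.
    move=> satx; apply: nax; apply: (side_trans s0T) sat.
    exact: (side_sym s0T).
  by case: (side_tree s0T x ta) => [/(side_sym s0T)|].
by move=> stxy; apply: (IH _ nta); apply: (side_trans s0T) stxy; exact: (side_sym s0T).
Qed.

(** ** Blocks *)

(** For adjacent [p] and [q] this is a maximal set of pairwise adjacent points. Any two of its
    points determine it, so an adjacent pair serves as its name. *)
Definition block p q t := t = p \/ t = q \/ (adj s t p /\ adj s t q).

Lemma block_adj p q t u : adj s p q -> block p q t -> block p q u -> t <> u -> adj s t u.
Proof.
move=> pq [->|[->|[tp tq]]] [->|[->|[up uq]]] tu //; try exact: adj_sym.
apply: (@adj_block p) => //; try exact: adj_sym.
apply: (strans (z := q)); last exact: adj_side (adj_sym up) (adj_sym uq).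
exact/ssym/(adj_side pq (adj_sym tp) (adj_sym tq)).
Qed.

Lemma block_eq p q t u : adj s p q -> block p q t -> block p q u -> t <> u ->
  forall v, block t u v <-> block p q v.
Proof.
move=> pq bt bu tu; have tu_adj := block_adj pq bt bu tu.
suff sub p' q' t' u' v : adj s p' q' -> block p' q' t' -> block p' q' u' ->
    t' <> u' -> block p' q' v -> block t' u' v.
  move=> v; split=> [bv|]; last exact: sub.
  have bp : block t u p by apply: (sub p q) => //; left.
  have bq : block t u q by apply: (sub p q) => //; right; left.
  by apply: (sub t u) => //; case: pq.
move=> {}pq {}bt {}bu {tu_adj} tu' bv.
case: (pselect (v = t')) => [|vt]; first by left.
case: (pselect (v = u')) => [|vu]; first by right; left.
by right; right; split; apply: (block_adj pq).
Qed.

End Geodesics.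

End TreeLike.

Lemma count_ltn (T : eqType) (a b : pred T) (l : seq T) (x : T) :
  {in l, forall y, a y -> b y} -> x \in l -> b x -> ~~ a x ->
  (count a l < count b l)%N.
Proof.
move=> ab xl bx nax.
have -> : count b l = (count a l + count (predD b a) l)%N.
  elim: l {xl} ab => //= y l IHl ab; rewrite IHl => [|z zl]; last first.
    by apply: ab; rewrite inE zl orbT.
  rewrite addnACA; congr (_ + _)%N; have := ab y (mem_head _ _).
  by case: (a y) => /= [->//|_]; rewrite add0n.
by rewrite -[X in (X < _)%N]addn0 ltn_add2l -has_count; apply/hasP; exists x => //=; rewrite nax.
Qed.

(** * Equivariant tree structures *)

Section Equivariant.
Variables (G : groupType) (X : choiceType) (act : G -> X -> X).
Hypotheses (act1 : forall x, act 1 x = x)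
  (actM : forall g h x, act (g * h) x = act g (act h x)).
Implicit Types (s : side X) (x y z t : X) (g h : G) (S : seq X).

Lemma actK g : cancel (act g) (act g^-1).
Proof. by move=> x; rewrite -actM mulVg act1. Qed.

Lemma actVK g : cancel (act g^-1) (act g).
Proof. by move=> x; rewrite -actM mulgV act1. Qed.

Lemma act_inj g : injective (act g).
Proof. exact: can_inj (actK g). Qed.

Definition equivariant s := forall g x y z, s x y z -> s (act g x) (act g y) (act g z).

Section EquivariantTheory.
Variable s : side X.
Hypotheses (sT : tree_like s) (sE : equivariant s).

Lemma side_act g x y z : s (act g x) (act g y) (act g z) <-> s x y z.
Proof. by split=> [/(sE g^-1)|]; [rewrite !actK | exact: sE]. Qed.

Lemma adj_act g x y : adj s x y -> adj s (act g x) (act g y).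
Proof.
case=> xy h; split; first by move/act_inj.
move=> t tx ty; rewrite -(actVK g t); apply: sE; apply: h => e.
  by apply: tx; rewrite -e actVK.
by apply: ty; rewrite -e actVK.
Qed.

Lemma next_act g x y : next s (act g x) (act g y) = act g (next s x y).
Proof.
case: (pselect (x = y)) => [->|xy]; first by rewrite !next_self.
apply/esym/(next_uniq sT); first exact/adj_act/next_adj.
by move/side_act; exact: next_btw.
Qed.

End EquivariantTheory.

(** The point vertices of a fundamental domain in the sense of Bass-Serre theory: a finite connected
    transversal whose stabilizers generate [G]. *)
Record spanning s S : Prop := Spanning {
  spanning_uniq : uniq S;
  spanning_cover : forall x, exists g y, y \in S /\ x = act g y;
  spanning_orbit : forall g x y, x \in S -> y \in S -> y = act g x -> y = x;
  spanning_conn : forall P : X -> Prop,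
    (forall x y, x \in S -> y \in S -> adj s x y -> P x -> P y) ->
    forall x y, x \in S -> y \in S -> P x -> P y;
  spanning_gen : forall P : G -> Prop, P 1 ->
    (forall g h, P g -> P h -> P (g * h)) -> (forall g, P g -> P g^-1) ->
    (forall x g, x \in S -> act g x = x -> P g) -> forall g, P g }.

(** In the bipartite tree of points and blocks, [good_stab] says that the stabilizer of an edge
    fixes its block pointwise, and [good_fix] that the group of a block is nontrivial. *)
Record good s : Prop := Good {
  good_tree : tree_like s;
  good_equiv : equivariant s;
  good_stab : forall x y g, adj s x y -> act g x = x -> s x y (act g y) -> act g y = y;
  good_fix : forall x y, adj s x y -> exists g, [/\ g <> 1, act g x = x & act g y = y];
  good_span : exists S, spanning s S }.

(** The end state of folding: the stabilizer of [x] can no longer bring two neighbours of [x] in [S]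
    newly onto one side. *)
Definition folded s S := forall x y z g, x \in S -> y \in S -> z \in S ->
  adj s x y -> adj s x z -> act g x = x -> s x y (act g z) -> s x y z.

Definition full s S := forall x y, adj s x y ->
  exists g x' y', [/\ x' \in S, y' \in S, x = act g x' & y = act g y'].

(** * Folding a fundamental domain until it meets every orbit of adjacent pairs *)

Section Folding.
Variable s : side X.
Hypothesis sG : good s.
Let sT := good_tree sG.
Let sE := good_equiv sG.

Section Twist.
Variables (S : seq X) (x z : X) (g : G).
Hypotheses (spS : spanning s S) (xS : x \in S) (zS : z \in S) (xz : adj s x z)
  (gx : act g x = x).

(** The part of the domain in the direction of [z] at [x] is moved by [g]. Adjacency survives
    because [x] is fixed by [g] and separates the two parts. *)
Let mu t := if `[< s x z t >] then act g t else t.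

Lemma twist_orbit t : exists h, mu t = act h t.
Proof.
by rewrite /mu; case: asboolP => _; [exists g | exists 1; rewrite act1].
Qed.

Lemma twist_center : mu x = x.
Proof.
by rewrite /mu; case: asboolP.
Qed.

Lemma twist_adj t t' : adj s t t' -> adj s (mu t) (mu t').
Proof.
have half u u' : adj s u u' -> s x z u -> ~ s x z u' -> adj s (mu u) (mu u').
  move=> uu' zu zu'; case: (pselect (u' = x)) => [u'x|u'x].
    rewrite u'x twist_center -[X in adj s _ X]gx /mu asboolT //.
    by apply: adj_act => //; rewrite -u'x.
  case: zu'; apply: (side_trans sT) (zu) _; case: uu' => _; apply.
    by move=> xu; move: zu; rewrite -xu => /(side_sym sT)/(side_self sT) ezx;
      case: xz; rewrite ezx.
  by move/esym.
move=> tt'; case: (pselect (s x z t)) => zt; case: (pselect (s x z t')) => zt'.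
- by rewrite /mu !asboolT //; exact: adj_act.
- exact: half.
- exact/adj_sym/half/zt/zt'/adj_sym.
- by rewrite /mu !asboolF.
Qed.

Lemma twist_spanning : spanning s (map mu S).
Proof.
have mu_inj h t t' : t \in S -> t' \in S -> mu t' = act h (mu t) -> t' = t.
  move=> tS t'S; have [k ->] := twist_orbit t; have [k' ->] := twist_orbit t'.
  move=> e; apply: (spanning_orbit spS (g := k'^-1 * (h * k)) tS t'S).
  by rewrite !actM -e actK.
split.
- rewrite map_inj_in_uniq ?(spanning_uniq spS) // => t t' tS t'S e.
  by apply: (mu_inj 1) => //; rewrite act1.
- move=> y; have [h [t [tS ->]]] := spanning_cover spS y.
  have [k e] := twist_orbit t; exists (h * k^-1), (mu t); split; first exact: map_f.
  by rewrite actM e actK.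
- by move=> h _ _ /mapP[t tS ->] /mapP[t' t'S ->] /mu_inj -> .
- move=> P adjP _ _ /mapP[t tS ->] /mapP[t' t'S ->].
  apply: (spanning_conn spS (P := P \o mu)) => // u u' uS u'S /twist_adj uu' /=.
  by apply: adjP => //; exact: map_f.
- move=> P P1 PM PV Pstab.
  have Pg : P g by apply: (Pstab (mu x)); [exact: map_f | rewrite twist_center].
  apply: (spanning_gen spS) => // t h tS ht.
  case: (pselect (s x z t)) => zt; last first.
    by apply: (Pstab (mu t)); [exact: map_f | rewrite /mu asboolF].
  have -> : h = g^-1 * (g * h * g^-1) * g.
    by rewrite !mulgA mulVg mul1g mulgVK.
  apply/PM/Pg/PM; first exact: PV.
  apply: (Pstab (mu t)); first exact: map_f.
  by rewrite /mu asboolT // !actM actK ht.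
Qed.

End Twist.

Definition adj_count S := count (fun p => `[< adj s p.1 p.2 >]) [seq (x, y) | x <- S, y <- S].

Lemma adj_count_map (f : X -> X) S : adj_count (map f S) =
  count (fun p => `[< adj s (f p.1) (f p.2) >]) [seq (x, y) | x <- S, y <- S].
Proof.
rewrite /adj_count; pose ff (p : X * X) := (f p.1, f p.2).
have -> : [seq (x, y) | x <- map f S, y <- map f S]
    = map ff [seq (x, y) | x <- S, y <- S].
  by rewrite map_allpairs allpairs_mapl (allpairs_mapr _ (fun=> f)).
by rewrite count_map.
Qed.

(** Where [S] is not folded, a twist keeps all adjacent pairs and creates a new one; the number of
    pairs is at most [size S ^ 2]. *)
Lemma spanning_folded : exists S, spanning s S /\ folded s S.
Proof.
have [S spS] := good_span sG.
have [k] := ubnP ((size S) ^ 2 - adj_count S); elim: k S spS => // k IHk S spS ltk.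
case: (pselect (folded s S)) => [foldS|nfold]; first by exists S.
have [x [y [z [g [[xS yS zS] xy xz gx [sgz nyz]]]]]] : exists x y z g,
    [/\ [/\ x \in S, y \in S & z \in S], adj s x y, adj s x z, act g x = x &
     s x y (act g z) /\ ~ s x y z].
  apply: contrapT => nex; apply: nfold => x y z g xS yS zS xy xz gx sgz.
  by apply: contrapT => nyz; apply: nex; exists x, y, z, g.
pose mu t := if `[< s x z t >] then act g t else t.
apply: (IHk (map mu S)); first exact: twist_spanning.
have ltc : (adj_count S < adj_count (map mu S))%N.
  rewrite adj_count_map; apply: (@count_ltn _ _ _ _ (y, z)) => [[t t'] _ /asboolP tt'||/=|/=].
  - by apply/asboolP; exact: twist_adj.
  - by apply/allpairsP; exists (y, z).
  - apply/asboolP; rewrite /mu asboolF => [|/(side_sym sT)//].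
    rewrite asboolT; last exact: (side_refl sT).
    have yz : y <> z by move=> yz; apply: nyz; rewrite yz; exact: (side_refl sT).
    apply: (@adj_block _ _ sT x) => //; first by rewrite -gx; exact: adj_act.
    by move=> e; apply: yz; apply: (spanning_orbit spS (g := g) zS yS).
  - apply/asboolPn => yz; apply: nyz; exact: adj_side.
have bound : (adj_count (map mu S) <= size S ^ 2)%N.
  rewrite -(size_map mu S) /adj_count (leq_trans (count_size _ _)) //.
  by rewrite size_allpairs expnS expn1.
rewrite size_map; lia.
Qed.

Let sedge S y z := exists g y' z',
  [/\ y' \in S, z' \in S, y = act g y', z = act g z' & adj s y' z'].

(** The graph of translated pairs is connected: [S] is connected through such pairs, and [G] is
    generated by elements fixing points of [S]. *)
Let sedge_reach S (P : X -> Prop) y z : spanning s S ->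
  (forall p q, sedge S p q -> P p -> P q) -> P y -> P z.
Proof.
move=> spS PP; move: y z.
have sedge_sym p q : sedge S p q -> sedge S q p.
  by move=> [g [p' [q' [p'S q'S ep eq pq]]]]; exists g, q', p'; split=> //; exact: adj_sym.
have sedge_act g p q : sedge S p q -> sedge S (act g p) (act g q).
  move=> [h [p' [q' [p'S q'S -> -> pq]]]]; exists (g * h), p', q'.
  by split; rewrite ?actM.
pose R y z := forall Q : X -> Prop, (forall p q, sedge S p q -> Q p -> Q q) -> Q y -> Q z.
have Rtrans y z w : R y z -> R z w -> R y w by move=> yz zw Q QQ /(yz Q QQ); exact: zw.
have Rsym y z : R y z -> R z y.
  move=> yz Q QQ Qz; apply: contrapT => nQy; apply: (yz (fun p => ~ Q p)) nQy Qz => p q pq nQp Qq.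
  by apply: nQp; apply: QQ Qq; exact: sedge_sym.
have Ract g y z : R y z -> R (act g y) (act g z).
  move=> yz Q QQ; apply: (yz (fun p => Q (act g p))) => p q pq; apply: QQ.
  exact: sedge_act.
have RS y z : y \in S -> z \in S -> R y z.
  move=> yS zS Q QQ; apply: (spanning_conn spS) => // p q pS qS pq; apply: QQ.
  by exists 1, p, q; rewrite !act1.
move=> y z Py; have [_ [x0 [x0S _]]] := spanning_cover spS y.
have Rg g : R x0 (act g x0).
  move: g; apply: (spanning_gen spS); first by rewrite act1.
  - by move=> g h Rg Rh; rewrite actM; apply: Rtrans Rg _; exact: Ract.
  - by move=> g /(Ract g^-1)/Rsym; rewrite actK.
  - move=> t g tS gt; apply: (Rtrans _ t); first exact: RS.
    by have := Ract g _ _ (RS t x0 tS x0S); rewrite gt.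
have Rx0 w : R x0 w.
  have [g [t [tS ->]]] := spanning_cover spS w.
  by apply: (Rtrans _ (act g x0)); [exact: Rg | exact: Ract (RS _ _ x0S tS)].
by apply: (Rtrans y x0 z) Py => //; exact: Rsym.
Qed.

(** The two pairs share [p] up to some [k] in the stabilizer of [p0]. Folding puts [q1] on the side
    of [y0], so [good_stab] makes [k] fix [q1], and the third pair is a translate too. *)
Let sedge_comp S y p q : spanning s S -> folded s S ->
  sedge S y p -> sedge S p q -> s p y q -> q = y \/ sedge S y q.
Proof.
move=> spS foldS [g [y0 [p0 [y0S p0S -> -> yp]]]] [h [p1 [q1 [p1S q1S ep -> pq]]]] spyq.
have e1 : p1 = act (h^-1 * g) p0 by rewrite actM ep actK.
have {e1} e1 : p1 = p0 := spanning_orbit spS p0S p1S e1.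
rewrite {p1}e1 in p1S ep pq; pose k := g^-1 * h.
have kp : act k p0 = p0 by rewrite actM -ep actK.
have eh : h = g * k by rewrite /k mulgA mulgV mul1g.
have sk : s p0 y0 (act k q1) by apply/(side_act sE g); rewrite -actM -eh.
have sp0 : s p0 y0 q1.
  by apply: (foldS _ _ _ k) => //; exact: adj_sym.
have kq : act k q1 = q1.
  apply: (good_stab sG pq) => //; apply: (side_trans sT) sk; exact: (side_sym sT).
rewrite eh actM kq; case: (pselect (y0 = q1)) => [->|yq]; first by left.
right; exists g, y0, q1; split=> //.
by apply: (adj_block sT) sp0 yq => //; exact: adj_sym.
Qed.

(** Translated pairs form a path from [y] to [z]. Its projection to their block, recorded by [gate],
    starts at [y], ends at [z], and moves only when the path runs inside the block, where
    [sedge_comp] applies. *)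
Lemma folded_full S : spanning s S -> folded s S -> full s S.
Proof.
move=> spS foldS y z yz.
suff [g [y' [z' [y'S z'S -> -> _]]]] : sedge S y z by exists g, y', z'.
pose b := block s y z.
pose gate q p := forall t, b t -> t <> q -> ~ s q p t.
pose C p := exists q, [/\ b q, q = y \/ sedge S y q & gate q p].
have by_ : b y by left.
have bz : b z by right; left.
have [yz_neq _] := yz.
suff [q [bq yq gq]] : C z.
  have eqz : q = z.
    by apply: contrapT => qz; apply: (gq z bz); [move/esym | exact: (side_refl sT)].
  by case: yq; rewrite eqz // => /esym.
apply: (@sedge_reach S C y z spS); last first.
  exists y; split=> //; first by left.
  by move=> t bt ty; apply: (side_endl sT) => /esym.
move=> p p' pp' [q [bq yq gq]].
have adjpp' : adj s p p'.
  by case: pp' => g [u [v [_ _ -> -> uv]]]; exact: adj_act.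
case: (pselect (p = q)) => [epq|pq]; last first.
  exists q; split=> // t bt tq; case: (pselect (p' = q)) => [->|p'q].
    by apply: (side_endl sT) => /esym.
  move=> sq; apply: (gq t bt tq); apply: (side_trans sT) sq.
  by case: adjpp' => _; apply; move/esym.
rewrite -{q}epq in bq yq gq.
case: (pselect (exists t, [/\ b t, t <> p & s p p' t])) => [[t [bt tp spt]]|nex]; last first.
  exists p; split=> // t bt tp spt; apply: nex; by exists t.
have pt : adj s p t by apply: (block_adj sT yz) => // /esym.
have bp' : b p'.
  apply/(block_eq sT yz bq bt _ p'); first by move/esym.
  case: (pselect (p' = t)) => [->|p't]; first by right; left.
  right; right; split; first exact: adj_sym.
  exact: (adj_block sT adjpp' pt).
exists p'; split=> //; last by move=> u bu up; apply: (side_endl sT) => /esym.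
case: yq => [epy|yp]; first by right; rewrite -epy.
apply: sedge_comp (yp) (pp') _ => //.
have py : p <> y.
  move=> epy; case: yp => g [u [v [uS vS eu ev [uv _]]]]; apply: uv.
  by apply: (@act_inj g); rewrite -eu -ev.
case: (pselect (y = p')) => [<-|yp']; first exact: (side_refl sT).
apply: adj_side => //; last exact: (block_adj sT yz).
by apply: (block_adj sT yz) => //.
Qed.

Lemma good_full : exists S, [/\ spanning s S, folded s S & full s S].
Proof.
have [S [spS foldS]] := spanning_folded; exists S; split=> //.
exact: folded_full.
Qed.

(** Both pairs are translates of pairs of [S]; since [S] meets each orbit once, these are the same
    pair. *)
Lemma adj_orbit x y h : adj s x y -> adj s x (act h y) ->
  exists g, act g x = x /\ act h y = act g y.
Proof.
have [S [spS _ fS]] := good_full.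
move=> /fS[g [x0 [y0 [x0S y0S ex ey]]]] /fS[k [x1 [y1 [x1S y1S ex1 ehy]]]].
have e1 : x1 = x0.
  apply: (spanning_orbit spS (g := k^-1 * g)) => //.
  by rewrite actM -ex ex1 actK.
have e2 : y1 = y0.
  apply: (spanning_orbit spS (g := k^-1 * h * g)) => //.
  by rewrite !actM -ey ehy actK.
rewrite {}e1 in ex1; rewrite {}e2 in ehy.
exists (k * g^-1); split; first by rewrite actM ex actK -ex1 -ex.
by rewrite actM ey actK -ehy -ey.
Qed.

Lemma adj_same_orbit x h : ~ adj s x (act h x).
Proof.
have [S [spS _ fS]] := good_full.
move=> xh; have [xhn _] := xh; have [g [x0 [x1 [x0S x1S ex ehx]]]] := fS _ _ xh.
apply: xhn; suff -> : act h x = act g x0 by [].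
rewrite ehx; congr act.
by apply: (spanning_orbit spS (g := g^-1 * h * g)) => //; rewrite !actM -ex ehx actK.
Qed.

End Folding.

(** ** Coarsening *)

(** Coarsening adds adjacent pairs and removes separations, so the tree axiom, finiteness and the
    spanning set are inherited. *)
Lemma good_coarsen s s' : good s -> (forall x y z, s x y z -> s' x y z) ->
  (forall x y z, s' x y z -> s' x z y) ->
  (forall x y z w, s' x y z -> s' x z w -> s' x y w) ->
  (forall x y, s' x x y -> y = x) -> equivariant s' ->
  (forall x y g, adj s' x y -> act g x = x -> s' x y (act g y) -> act g y = y) ->
  (forall x y, adj s' x y -> exists g, [/\ g <> 1, act g x = x & act g y = y]) ->
  good s'.
Proof.
move=> sG ss' ssym strans sself sE' sstab sfix; have sT := good_tree sG.
have adjss' x y : adj s x y -> adj s' x y.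
  by case=> xy h; split=> // t tx ty; apply/ss'/h.
split=> //.
  split=> //.
  - by move=> x y; apply/ss'/(side_refl sT).
  - by move=> x y z xy; case: (side_tree sT z xy) => /ss'; [left | right].
  - move=> y z; have [l lP] := side_fin sT y z; exists l => x nx.
    by apply: lP => /ss'.
have [S spS] := good_span sG; exists S; case: spS => uS cS oS connS genS; split=> //.
move=> P PP; apply: connS => x y xS yS /adjss'; exact: PP.
Qed.

End Equivariant.

(** * Counting with finite predicates *)

Section FinitePredicates.

Definition fin_pred (T : choiceType) (P : T -> Prop) : Prop :=
  exists l : seq T, forall x, P x -> x \in l.

Lemma fin_pred_seq (T : choiceType) (P : T -> Prop) : fin_pred P ->
  exists l : seq T, uniq l /\ forall x, x \in l <-> P x.
Proof.
case=> l lP; exists (undup [seq x <- l | `[< P x >]]); split; first exact: undup_uniq.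
move=> x; rewrite mem_undup mem_filter; split=> [/andP[/asboolP]//|Px].
by rewrite lP // andbT; apply/asboolP.
Qed.

Lemma fin_pred_union (T T' : choiceType) (P : T -> T' -> Prop) (s : seq T) :
  (forall x, fin_pred (P x)) -> fin_pred (fun y => exists2 x, x \in s & P x y).
Proof.
move=> fP; elim: s => [|x s [l lP]]; first by exists [::] => y [].
have [l' l'P] := fP x; exists (l' ++ l) => y [x']; rewrite inE mem_cat.
case/predU1P=> [->|x's] Py; apply/orP; [left | right]; first exact: l'P.
by apply: lP; exists x'.
Qed.

(** The default value 0 is taken on infinite predicates. *)
Definition card_pred (T : choiceType) (P : T -> Prop) : nat :=
  if pselect (exists l : seq T, uniq l /\ forall x, x \in l <-> P x) is left h
  then size (projT1 (cid h)) else 0.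

Lemma card_predE (T : choiceType) (P : T -> Prop) (l : seq T) :
  uniq l -> (forall x, x \in l <-> P x) -> card_pred P = size l.
Proof.
move=> ul lP; rewrite /card_pred; case: pselect => [h|[]]; last by exists l.
case: cid => l' /= [ul' l'P]; apply: perm_size; apply: uniq_perm => // x.
by apply/idP/idP => [/l'P/lP|/lP/l'P].
Qed.

Section Surjection.
Variables (T T' : choiceType) (P : T -> Prop) (Q : T' -> Prop) (f : T -> T').
Hypotheses (finP : fin_pred P) (fPQ : forall x, P x -> Q (f x))
  (fsurj : forall y, Q y -> exists x, P x /\ f x = y).

Let l := projT1 (cid (fin_pred_seq finP)).

Let lP x : x \in l <-> P x.
Proof. by rewrite /l; case: cid => ? []. Qed.

Let ul : uniq l.
Proof. by rewrite /l; case: cid => ? []. Qed.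

Let image_list y : y \in undup (map f l) <-> Q y.
Proof.
rewrite mem_undup; split=> [/mapP[x /lP Px ->]|/fsurj[x [/lP xl <-]]].
  exact: fPQ.
exact: map_f.
Qed.

Lemma card_surj_leq : (card_pred Q <= card_pred P)%N.
Proof.
rewrite (card_predE (undup_uniq _) image_list) (card_predE ul lP).
by rewrite -(size_map f l) size_undup.
Qed.

Lemma card_surj_inj : card_pred Q = card_pred P ->
  forall x y, P x -> P y -> f x = f y -> x = y.
Proof.
rewrite (card_predE (undup_uniq _) image_list) (card_predE ul lP) => e.
have umap : uniq (map f l).
  by rewrite -[uniq _]negbK -ltn_size_undup size_map e ltnn.
move=> x y /lP xl /lP yl fxy.
have nthf z : z \in l -> nth (f x) (map f l) (index z l) = f z.
  by move=> zl; rewrite (nth_map x) ?index_mem ?nth_index.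
have /eqP := nthf y yl; rewrite -fxy -{2}(nthf x xl) nth_uniq ?size_map ?index_mem //.
by move=> /eqP eqi; rewrite -(nth_index x xl) -eqi nth_index.
Qed.

Lemma card_inj_eq : (forall x y, P x -> P y -> f x = f y -> x = y) ->
  card_pred Q = card_pred P.
Proof.
move=> finj; rewrite (card_predE (undup_uniq _) image_list) (card_predE ul lP).
rewrite undup_id ?size_map // map_inj_in_uniq // => x y /lP Px /lP Py; exact: finj.
Qed.

End Surjection.

Lemma sum_leq_eq (T : eqType) (s : seq T) (a b : T -> nat) :
  (forall x, x \in s -> a x <= b x)%N ->
  (\sum_(x <- s) a x = \sum_(x <- s) b x)%N -> forall x, x \in s -> a x = b x.
Proof.
elim: s => [//|y s IHs] ab; rewrite !big_cons => e.
have leS : (\sum_(x <- s) a x <= \sum_(x <- s) b x)%N.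
  by rewrite !big_seq; apply: leq_sum => x xs; apply: ab; rewrite inE xs orbT.
have ley := ab y (mem_head _ _).
have [ey eS] : a y = b y /\ (\sum_(x <- s) a x = \sum_(x <- s) b x)%N by lia.
move=> x; rewrite inE => /predU1P[->//|]; apply: IHs => // z zs.
by apply: ab; rewrite inE zs orbT.
Qed.

End FinitePredicates.

(** * The refinement and the fold_side relative to a base structure *)

Section Refinement.
Variables (G : groupType) (X : choiceType) (act : G -> X -> X).
Hypotheses (act1 : forall x, act 1 x = x)
  (actM : forall g h x, act (g * h) x = act g (act h x)).
Implicit Types (s : side X) (x y z t : X) (g h : G) (S : seq X).

Section Divergence.
Variable s : side X.
Hypothesis sT : tree_like s.

(** Different first steps on one side of [x] lie with [x] in a common block, so the geodesic from
    [y] to [z] passes through both of them and bypasses [x]. *)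
Lemma next_diverge x y z : x <> y -> s x y z -> next s x y <> next s x z ->
  ~ s (next s x y) y z.
Proof.
move=> xy sxyz ac.
have xz : x <> z by move=> xz; apply: ac; move: sxyz; rewrite -xz => /(side_sym sT)/(side_self sT) ->.
have [xa na] := nextP sT xy; have [xc nc] := nextP sT xz.
set a := next s x y in ac xa na *; set c := next s x z in ac xc nc.
case: (pselect (y = a)) => [ya|ya].
  rewrite -ya; apply: (side_endl sT) => yz; apply: ac.
  by rewrite /a /c yz.
have saxz : s a x z.
  by apply: contrapT => naz; apply: ac; apply: (next_uniq sT).
move=> sayz; apply: na; apply: (side_trans sT) saxz _.
exact: (side_sym sT).
Qed.

Lemma btw_block s' x y t : (forall u v w, s u v w -> s' u v w) -> tree_like s' ->
  adj s' x y -> ~ s t x y -> block s' x y t.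
Proof.
move=> ss' s'T xy nt; have [_ hxy] := xy.
have half x' y' : adj s' x' y' -> ~ s t x' y' -> t <> x' -> t <> y' -> adj s' t x'.
  move=> [xy' hxy'] nt' tx ty; apply: adj_sym => //; split; first by move/esym.
  move=> w wx wt; apply: contrapT => nw.
  have nws : ~ s w x' t by move=> sw; apply: nw; exact: ss'.
  have swty : s w t y'.
    have ntw : ~ s t w y' by exact: (btw_split sT nws nt').
    by apply: (btw_sidel sT ntw) => /esym.
  case: (pselect (w = y')) => [wy|wy].
    by move: swty; rewrite wy => /(side_sym sT)/(side_self sT).
  by apply: nw; apply: (side_trans s'T) (hxy' w wx wy) _; apply/(side_sym s'T)/ss'.
case: (pselect (t = x)) => [|tx]; first by left.
case: (pselect (t = y)) => [|ty]; first by right; left.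
right; right; split; first by apply: (half x y).
apply: (half y x) => //; first exact: adj_sym.
exact: btw_sym.
Qed.

End Divergence.

Variable s0 : side X.
Hypothesis s0G : good act s0.
Let s0T := good_tree s0G.
Let s0E := good_equiv s0G.

(* [rho s] cuts every block [b] of [s] at those vertices of [b] that separate
   other vertices of [b] in the base structure [s0]; [fold_side s] glues the blocks
   at each vertex along the directions they take in [s0]. *)
Definition fold_side s : side X := fun x y z => s0 x (next s x y) (next s x z).
Definition rho s : side X := fun x y z => s x y z /\ fold_side s x y z.

Section Rho.
Variable s : side X.
Hypothesis sG : good act s.
Let sT := good_tree sG.
Let sE := good_equiv sG.

Lemma rho_sub x y z : rho s x y z -> s x y z.
Proof. by case. Qed.

(** Here [rho] cuts a block of [s] at [x]. If [y] lies beyond the point [a] of that block, then [x]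
    and [z] are reached from [y] by the same first step; if [y = a], the tree axiom of [s0]
    decides. *)
Lemma rho_tree_half x y z : x <> y -> s x y z -> ~ fold_side s x y z -> rho s y x z.
Proof.
move=> xy sxyz nf.
have xz : x <> z by move=> xz; apply: xy; move: sxyz; rewrite -xz => /(side_sym sT)/(side_self sT).
have ac : next s x y <> next s x z.
  by move=> ac; apply: nf; rewrite /fold_side ac; exact: (side_refl s0T).
have nayz := next_diverge sT xy sxyz ac.
have nczy : ~ s (next s x z) z y.
  by apply: next_diverge => //; [exact: (side_sym sT) | move/esym].
have [xa na] := nextP sT xy; have [xc nc] := nextP sT xz.
have adj_ac := next_side_block sT xy xz sxyz ac.
rewrite /fold_side in nf; set a := next s x y in ac nayz xa na adj_ac nf.
set c := next s x z in ac nczy xc nc adj_ac nf.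
case: (pselect (y = a)) => [ya|ya].
  have nxy : next s y x = x by apply: (next_of_adj sT); apply: adj_sym; rewrite ?ya.
  have yc : adj s y c by rewrite ya.
  have ncyz : ~ s c y z by move/(side_sym sT).
  have nyz : next s y z = c by apply/esym/(next_uniq sT).
  have yx' : adj s y x by apply: adj_sym => //; rewrite ya.
  have syxc : s y x c by apply: adj_side.
  split; last first.
    rewrite /fold_side nxy nyz; case: (side_tree s0T c xy) => // s0xyc.
    by case: nf; rewrite -ya.
  apply: (side_trans sT) syxc _; apply: (btw_sidel sT ncyz) => cy.
  by apply: ac; rewrite -/a -ya cy.
have nayx : ~ s a y x by exact: btw_sym.
have ay : a <> y by move/esym.
split.
  apply: (side_trans sT (z := a)); last exact: btw_sidel nayz ay.
  exact/(side_sym sT)/(btw_sidel sT nayx ay).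
rewrite /fold_side -(next_btw_eq sT nayx ay) -(next_btw_eq sT nayz ay).
exact: (side_refl s0T).
Qed.

(** A new separator [x] lies, for [s0], between two points [a] and [c] that themselves lie between
    [y] and [z] for [s]. *)
Lemma rho_fin y z : fin_pred (fun x => ~ rho s x y z).
Proof.
have [l1 l1P] := side_fin sT y z.
have [l2 l2P] := @fin_pred_union _ _ (fun p x => ~ s0 x p.1 p.2)
  [seq (a, c) | a <- l1, c <- l1] (fun p => side_fin s0T p.1 p.2).
exists (l1 ++ l2) => x nr; rewrite mem_cat.
case: (pselect (s x y z)) => [sxyz|/l1P -> //]; apply/orP; right.
have nf : ~ fold_side s x y z by move=> f; apply: nr.
have ac : next s x y <> next s x z.
  by move=> ac; apply: nf; rewrite /fold_side ac; exact: (side_refl s0T).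
have xy : x <> y.
  move=> xy; apply: ac; move: sxyz; rewrite -xy => /(side_self sT) ->.
  by [].
have xz : x <> z.
  move=> xz; apply: ac; move: sxyz; rewrite -xz => /(side_sym sT)/(side_self sT) ->.
  by [].
have nayz := next_diverge sT xy sxyz ac.
have nczy : ~ s (next s x z) z y.
  by apply: next_diverge => //; [exact: (side_sym sT) | move/esym].
apply: l2P; exists (next s x y, next s x z) => //.
apply/allpairsP; exists (next s x y, next s x z); split=> //=; first exact: l1P.
by apply: l1P => /(side_sym sT).
Qed.

Lemma rho_tree : tree_like (rho s).
Proof.
split.
- by move=> x y; split; [exact: (side_refl sT) | exact: (side_refl s0T)].
- by move=> x y z [sxyz f]; split; [exact: (side_sym sT) | exact: (side_sym s0T)].
- move=> x y z w [sxyz f] [sxzw f']; split; first exact: (side_trans sT) sxzw.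
  exact: (side_trans s0T) f'.
- by move=> x y [/(side_self sT)].
- move=> x y z xy; case: (side_tree sT z xy) => sz.
    case: (pselect (fold_side s x y z)) => [f|nf]; first by left.
    by right; apply: rho_tree_half nf.
  case: (pselect (fold_side s y x z)) => [f|nf]; first by right.
  by left; apply: rho_tree_half nf => //; move/esym.
- exact: rho_fin.
Qed.

Lemma fold_equivariant : equivariant act (fold_side s).
Proof.
move=> g x y z f; rewrite /fold_side !(next_act act1 actM sT sE); exact: s0E.
Qed.

Lemma rho_equivariant : equivariant act (rho s).
Proof.
by move=> g x y z [sxyz f]; split; [exact: sE | exact: fold_equivariant].
Qed.

Lemma adj_rho x y : adj (rho s) x y -> adj s x y.
Proof. by case=> xy h; split=> // t tx ty; case: (h t tx ty). Qed.

Lemma rho_btw_block x y t : adj s x y -> ~ rho s t x y -> block s x y t.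
Proof.
move=> xy nr; case: (pselect (t = x)) => [|tx]; first by left.
case: (pselect (t = y)) => [|ty]; first by right; left.
have stxy : s t x y by case: xy => _; apply.
have ac : next s t x <> next s t y.
  by move=> ac; apply: nr; split=> //; rewrite /fold_side ac; exact: (side_refl s0T).
have naxy := next_diverge sT tx stxy ac.
have ncyx : ~ s (next s t y) y x.
  by apply: next_diverge => //; [exact: (side_sym sT) | move/esym].
have [ta _] := nextP sT tx; have [tc _] := nextP sT ty.
have eqa : next s t x = x.
  case: (adj_btw xy naxy) => // ay; rewrite ay in ta ac *.
  by case: ac; rewrite (next_of_adj sT ta).
have eqc : next s t y = y.
  case: (adj_btw (adj_sym sT xy) ncyx) => // cx; rewrite cx in tc ac *.
  by case: ac; rewrite (next_of_adj sT tc).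
by rewrite eqa in ta; rewrite eqc in tc; right; right.
Qed.

(** [fullS] writes [t] as [act g t0] with [t0] in [S] and [g] fixing [x]; folding and [good_stab]
    then give [act g t0 = t0]. *)
Lemma block_spanning S x y t : spanning act s S -> folded act s S -> full act s S ->
  x \in S -> y \in S -> adj s x y -> block s x y t -> t \in S.
Proof.
move=> spS foldS fullS xS yS xy [->|[->|[tx ty]]] //.
have xt := adj_sym sT tx.
have [g [x0 [t0 [x0S t0S ex et]]]] := fullS _ _ xt.
have ex0 : x = x0 := spanning_orbit spS x0S xS ex.
rewrite -{}ex0 in ex.
have xt0 : adj s x t0.
  have := adj_act act1 actM sE g^-1 xt.
  by rewrite et {1}ex !(actK act1 actM).
have sxyt : s x y t by apply: adj_side => //; exact: adj_sym.
have sxyt0 : s x y t0.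
  by apply: (foldS _ _ _ g) => //; rewrite -?et //; exact: esym.
have gt0 : act g t0 = t0.
  apply: (good_stab sG xt0); first exact: esym.
  by rewrite -et; apply: (side_trans sT) sxyt; exact: (side_sym sT).
by rewrite et gt0.
Qed.

Lemma rho_good : good act (rho s).
Proof.
split.
- exact: rho_tree.
- exact: rho_equivariant.
- by move=> x y g /adj_rho xy gx [sxy _]; exact: (good_stab sG xy).
- by move=> x y /adj_rho; exact: (good_fix sG).
(* The same [S] spans: the geodesic of [rho s] between two points of [S] adjacent for [s] stays in
   their block of [s], which lies in [S]. *)
have [S [spS foldS fullS]] := good_full act1 actM sG.
exists S; case: (spS) => uS cS oS connS genS; split=> //.
move=> P PP; apply: connS => x y xS yS xy Px.
suff: y \in S /\ P y by case.
apply: (@geodesic_propagate _ _ rho_tree (fun t => t \in S /\ P t) x y) => //.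
move=> t u nt nu tu [tS Pt].
have uS' : u \in S.
  by apply: (block_spanning spS foldS fullS xS yS xy); exact: rho_btw_block.
by split=> //; apply: PP tu Pt.
Qed.

End Rho.

End Refinement.

(** * Blocks cut by half-spaces *)

Definition point_set (X : Type) : Type := X -> Prop.
HB.instance Definition _ (X : Type) := gen_eqMixin (point_set X).
HB.instance Definition _ (X : Type) := gen_choiceMixin (point_set X).

Lemma point_set_eq (X : Type) (A B : point_set X) : (forall x, A x <-> B x) -> A = B.
Proof. by move=> AB; apply/funext => x; apply/propext. Qed.

Section Cuts.
Variables (G : groupType) (X : choiceType) (act : G -> X -> X).
Hypotheses (act1 : forall x, act 1 x = x)
  (actM : forall g h x, act (g * h) x = act g (act h x)).
Hypothesis fin_stab : forall x, fin_pred (fun g => act g x = x).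
Implicit Types (s : side X) (x y z t : X) (g h : G) (S : seq X) (B : point_set X).

Variable s0 : side X.
Hypothesis s0G : good act s0.
Let s0T := good_tree s0G.
Let s0E := good_equiv s0G.

(** The half-space is the side of [z] containing [c] in [s0]. Blocks are sets of points here, so
    that they do not depend on the pair naming them. *)
Definition cut s z c B : Prop :=
  exists p q, [/\ adj s p q, B = block s p q, s0 z c p & ~ s0 z c q].

Definition coarse_block s' B : point_set X :=
  fun t => exists p q, [/\ B p, B q, p <> q & block s' p q t].

Lemma half_space_convex z c p q t : z <> c -> s0 z c p -> s0 z c q -> ~ s0 t p q -> s0 z c t.
Proof.
move=> zc cp cq nt; case: (pselect (t = z)) => [tz|tz].
  case: nt; rewrite tz; apply: (side_trans s0T) cq; exact: (side_sym s0T).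
have zp : z <> p by move=> zp; apply: zc; move: cp; rewrite -zp => /(side_sym s0T)/(side_self s0T) ->.
case: (pselect (s0 z t p)) => [ztp|nztp].
  by apply: (side_trans s0T) cp _; exact: (side_sym s0T).
have ztq : ~ s0 z t q.
  move=> ztq; apply: nztp; apply: (side_trans s0T) ztq _.
  by apply: (side_trans s0T) (side_sym s0T cq) _.
have tzp : s0 t z p by case: (side_tree s0T p tz) => // zz; case: nztp.
have tzq : s0 t z q by case: (side_tree s0T q tz) => // zz; case: ztq.
by case: nt; apply: (side_trans s0T) tzq; exact: (side_sym s0T).
Qed.

Lemma half_space_coconvex z c p q t : z <> c -> ~ s0 z c p -> ~ s0 z c q -> ~ s0 t p q ->
  ~ s0 z c t.
Proof.
move=> zc np nq nt ct.
have tz : t <> z by move=> tz; apply: zc; move: ct; rewrite tz => /(side_sym s0T)/(side_self s0T) ->.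
have half r : ~ s0 z c r -> s0 t z r.
  move=> nr; case: (side_tree s0T r tz) => // ztr; case: nr.
  exact: (side_trans s0T) ct ztr.
apply: nt; apply: (side_trans s0T) (half q nq).
exact/(side_sym s0T)/half.
Qed.

Lemma cut_btw z c p q : s0 z c p -> ~ s0 z c q -> ~ s0 z p q.
Proof. by move=> cp nq pq; apply: nq; exact: (side_trans s0T) cp pq. Qed.

Section OneStructure.
Variable s : side X.
Hypothesis sG : good act s.

Lemma transporter_fin x y : fin_pred (fun g => act g x = y).
Proof.
case: (pselect (exists h, act h x = y)) => [[h hxy]|nex]; last first.
  by exists [::] => g gxy; case: nex; exists g.
have [l lP] := fin_stab x; exists [seq h * g | g <- l] => g gxy.
apply/mapP; exists (h^-1 * g); last by rewrite mulVKg.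
by apply: lP; rewrite actM gxy -hxy (actK act1 actM).
Qed.

(** Up to translation the block is named by one of finitely many pairs of [S]. The translate of [z]
    then lies between this pair for [s0], and finite stabilizers leave finitely many
    translations. *)
Lemma cut_fin z c : fin_pred (cut s z c).
Proof.
have [S [spS _ fullS]] := good_full act1 actM sG.
pose pairs := [seq (x, y) | x <- S, y <- S].
have [l1 l1P] := @fin_pred_union _ _ (fun (p : X * X) t => ~ s0 t p.1 p.2) pairs
  (fun p => side_fin s0T p.1 p.2).
have [l2 l2P] := @fin_pred_union _ _ (fun t g => act g t = z) l1
  (fun t => transporter_fin t z).
exists [seq block s (act g p.1) (act g p.2) | g <- l2, p <- pairs] => B.
case=> p [q [pq -> cp nq]].
have [g [p0 [q0 [p0S q0S ep eq]]]] := fullS _ _ pq.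
apply/allpairsP; exists (g, (p0, q0)); rewrite /= -ep -eq; split=> //; last first.
  by apply/allpairsP; exists (p0, q0).
apply: l2P; exists (act g^-1 z); last by rewrite (actVK act1 actM).
apply: l1P; exists (p0, q0) => /=; first by apply/allpairsP; exists (p0, q0).
move/(s0E g); rewrite (actVK act1 actM) -ep -eq; exact: (cut_btw cp nq).
Qed.

End OneStructure.

Definition translate g B : point_set X := fun t => B (act g^-1 t).

Lemma block_act s g p q : good act s ->
  translate g (block s p q) = block s (act g p) (act g q).
Proof.
move=> sG; have sE := good_equiv sG; apply: point_set_eq => t; rewrite /translate /block.
have e t' : (act g^-1 t = t') <-> (t = act g t').
  by split=> [<-|->]; rewrite ?(actVK act1 actM) ?(actK act1 actM).
have a t' : adj s (act g^-1 t) t' <-> adj s t (act g t').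
  split=> [/(adj_act act1 actM sE g)|/(adj_act act1 actM sE g^-1)].
    by rewrite (actVK act1 actM).
  by rewrite (actK act1 actM).
by rewrite !e !a.
Qed.

Lemma translateK g : cancel (translate g) (translate g^-1).
Proof.
by move=> B; apply: point_set_eq => t; rewrite /translate invgK (actK act1 actM).
Qed.

Lemma cut_act s g z c B : good act s -> cut s z c B ->
  cut s (act g z) (act g c) (translate g B).
Proof.
move=> sG [p [q [pq -> cp nq]]]; exists (act g p), (act g q); split.
- exact: (adj_act act1 actM (good_equiv sG) g pq).
- exact: block_act.
- exact: s0E.
- by move/(side_act act1 actM s0E).
Qed.

Lemma cut_side s z c c' : s0 z c c' -> cut s z c = cut s z c'.
Proof.
move=> cc'; apply: point_set_eq => B.
have e t : s0 z c t <-> s0 z c' t.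
  split=> h; last exact: (side_trans s0T) cc' h.
  by apply: (side_trans s0T) h; exact: (side_sym s0T).
by split=> -[p [q [pq -> cp nq]]]; exists p, q; split=> //;
  [exact/e | by move/e | exact/e | by move/e].
Qed.

(** * Cut blocks under coarsening *)

Section Comparison.
Variables s s' : side X.
Hypotheses (sG : good act s) (s'G : good act s').
Hypothesis sub : forall x y z, s x y z -> s' x y z.
Let sT := good_tree sG.
Let s'T := good_tree s'G.

Lemma adj_sub x y : adj s x y -> adj s' x y.
Proof. by case=> xy h; split=> // t tx ty; apply/sub/h. Qed.

Lemma block_sub p q t : block s p q t -> block s' p q t.
Proof.
case=> [|[|[tp tq]]]; [by left | by right; left |].
by right; right; split; exact: adj_sub.
Qed.

Lemma coarse_blockE p q : adj s p q -> coarse_block s' (block s p q) = block s' p q.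
Proof.
move=> pq; have pq' := adj_sub pq; apply: point_set_eq => t; split=> [|bt].
  case=> p' [q' [/block_sub bp' /block_sub bq' ne]].
  by move/(block_eq s'T pq' bp' bq' ne).
by exists p, q; split=> //; [left | right; left | case: pq].
Qed.

Lemma coarse_cut z c B : cut s z c B -> cut s' z c (coarse_block s' B).
Proof.
case=> p [q [pq -> cp nq]]; exists p, q; split=> //; first exact: adj_sub.
exact: coarse_blockE.
Qed.

Lemma crossing z c x y : s0 z c x -> ~ s0 z c y ->
  exists p q, [/\ adj s p q, s0 z c p, ~ s0 z c q, ~ s p x y & ~ s q x y].
Proof.
move=> cx ncy; apply: contrapT => nex; apply: ncy.
apply: (@geodesic_propagate _ _ sT (fun t => s0 z c t) x y) => // t u nt nu tu ct.
by apply: contrapT => ncu; apply: nex; exists t, u.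
Qed.

(** The geodesic of [s] joining points of [B'] on both sides crosses the half-space at an adjacent
    pair, and stays in [B']. *)
Lemma coarse_cut_surj z c B' : cut s' z c B' ->
  exists B, cut s z c B /\ coarse_block s' B = B'.
Proof.
case=> p' [q' [pq' -> cp' nq']].
have [p [q [pq cp nq np' nq2]]] := crossing cp' nq'.
exists (block s p q); split; first by exists p, q.
rewrite coarse_blockE //; apply: point_set_eq => t.
have bp := btw_block sT sub s'T pq' np'; have bq := btw_block sT sub s'T pq' nq2.
by apply: (block_eq s'T pq' bp bq); case: pq.
Qed.

(** The combinatorial meaning of equal norms: the hulls in [s0] of the pieces of one block of [s']
    share no edge. *)
Definition no_overlap : Prop := forall z c B1 B2, z <> c ->
  cut s z c B1 -> cut s z c B2 -> coarse_block s' B1 = coarse_block s' B2 -> B1 = B2.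

Lemma cut_card_leq z c : (card_pred (cut s' z c) <= card_pred (cut s z c))%N.
Proof.
apply: (@card_surj_leq _ _ _ _ (coarse_block s')); first exact: (cut_fin sG).
  exact: coarse_cut.
exact: coarse_cut_surj.
Qed.

Lemma cut_card_eq z c : z <> c -> no_overlap ->
  card_pred (cut s' z c) = card_pred (cut s z c).
Proof.
move=> zc nolap; apply: (@card_inj_eq _ _ _ _ (coarse_block s')); first exact: (cut_fin sG).
- exact: coarse_cut.
- exact: coarse_cut_surj.
by move=> B1 B2 c1 c2; exact: (nolap z c B1 B2 zc c1 c2).
Qed.

Lemma cut_card_no_overlap z c B1 B2 : card_pred (cut s' z c) = card_pred (cut s z c) ->
  cut s z c B1 -> cut s z c B2 -> coarse_block s' B1 = coarse_block s' B2 -> B1 = B2.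
Proof.
move=> e; apply: (@card_surj_inj _ _ _ _ (coarse_block s')) e B1 B2.
- exact: (cut_fin sG).
- exact: coarse_cut.
- exact: coarse_cut_surj.
Qed.

Lemma coarse_translate g B : (exists p q, adj s p q /\ B = block s p q) ->
  coarse_block s' (translate g B) = translate g (coarse_block s' B).
Proof.
case=> p [q [pq ->]]; have gpq := adj_act act1 actM (good_equiv sG) g pq.
by rewrite (block_act g p q sG) (coarse_blockE gpq) (coarse_blockE pq) (block_act g p q s'G).
Qed.

End Comparison.

(** ** The norm *)

Let S0 : seq X := projT1 (cid (good_full act1 actM s0G)).

Let S0P : [/\ spanning act s0 S0, folded act s0 S0 & full act s0 S0].
Proof. by rewrite /S0; case: cid. Qed.

Let walls := [seq p <- [seq (x, y) | x <- S0, y <- S0] | p.1 != p.2].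

(* The total size of the convex hulls in [s0] of representatives of the blocks
   of [s]: an edge of [s0] lies in the hull of a block when its half-space cuts
   that block. *)
Definition norm s : nat := (\sum_(p <- walls) card_pred (cut s p.1 p.2))%N.

Lemma norm_leq s s' : good act s -> good act s' ->
  (forall x y z, s x y z -> s' x y z) -> (norm s' <= norm s)%N.
Proof. by move=> sG s'G sub; apply: leq_sum => p _; exact: cut_card_leq. Qed.

Lemma norm_eq s s' : good act s -> good act s' ->
  (forall x y z, s x y z -> s' x y z) -> no_overlap s s' -> norm s' = norm s.
Proof.
move=> sG s'G sub nolap; rewrite /norm !big_seq; apply: eq_bigr => p.
by rewrite mem_filter => /andP[/eqP zc _]; exact: cut_card_eq.
Qed.

(** The norm sees only half-spaces at pairs of [S0]; every half-space is given by an adjacent pair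
    of [s0], which a translation brings into [S0]. *)
Lemma norm_no_overlap s s' : good act s -> good act s' ->
  (forall x y z, s x y z -> s' x y z) -> norm s' = norm s -> no_overlap s s'.
Proof.
move=> sG s'G sub e z c B1 B2 zc c1 c2 e12.
have [spS0 _ fullS0] := S0P.
have [g [z0 [a0 [z0S a0S ez ea]]]] := fullS0 _ _ (next_adj s0T zc).
have side_ca : s0 z c (next s0 z c).
  exact: (side_sym s0T (next_side s0T z c)).
have za0 : z0 <> a0.
  move=> za0; have [+ _] := next_adj s0T zc; apply.
  by rewrite ea -za0.
have wall : (z0, a0) \in walls.
  by rewrite mem_filter; apply/andP; split; [apply/eqP | apply/allpairsP; exists (z0, a0)].
have e0 : card_pred (cut s' z0 a0) = card_pred (cut s z0 a0).
  apply: (@sum_leq_eq _ walls (fun p => card_pred (cut s' p.1 p.2))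
    (fun p => card_pred (cut s p.1 p.2)) _ e _ wall) => p _.
  exact: cut_card_leq.
have back B : cut s z c B -> cut s z0 a0 (translate g^-1 B).
  rewrite (cut_side s side_ca) => /(cut_act g^-1 sG).
  by rewrite ea {1}ez !(actK act1 actM).
have isblock B : cut s z c B -> exists p q, adj s p q /\ B = block s p q.
  by case=> p [q [pq -> _ _]]; exists p, q.
apply: (can_inj (@translateK g^-1)).
apply: (cut_card_no_overlap sG s'G sub e0); [exact: back | exact: back |].
by rewrite !(coarse_translate sG s'G sub) ?e12 //; exact: isblock.
Qed.

End Cuts.

(** * Acyclicity of the poset of tree structures *)

Section Acyclicity.
Variables (G : groupType) (X : choiceType) (act : G -> X -> X).
Hypotheses (act1 : forall x, act 1 x = x)
  (actM : forall g h x, act (g * h) x = act g (act h x)).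
Hypothesis fin_stab : forall x, fin_pred (fun g => act g x = x).
Implicit Types (s : side X) (x y z t : X) (g h : G) (B : point_set X).

Variable s0 : side X.
Hypothesis s0G : good act s0.
Hypothesis s0_stab : forall u v (t g : G), u <> v -> t <> 1 -> act t u = u -> act t v = v ->
  act g u = u -> s0 u v (act g v) -> act g v = v.
Hypothesis s0_block : forall x y z (t : G), adj s0 x y -> adj s0 x z -> t <> 1 ->
  act t y = y -> act t z = z -> exists g, act g x = x /\ s0 x (act g y) z.
Let s0T := good_tree s0G.
Let s0E := good_equiv s0G.

Local Notation fold := (fold_side s0).
Local Notation rho := (rho s0).
Local Notation norm := (norm act1 actM s0G).

Lemma side_eq s s' : (forall x y z, s x y z -> s' x y z) ->
  (forall x y z, s' x y z -> s x y z) -> s = s'.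
Proof.
by move=> ss' s's; apply/funext => x; apply/funext => y; apply/funext => z;
  apply/propext; split; [exact: ss' | exact: s's].
Qed.

(** [x] is the projection to the first block of a point [r] of the second one lying outside the
    first. *)
Lemma blocks_separated s p1 q1 p2 q2 : tree_like s -> adj s p1 q1 -> adj s p2 q2 ->
  (block s p1 q1 : point_set X) <> block s p2 q2 ->
  exists x, block s p1 q1 x /\ forall p p', block s p1 q1 p -> block s p2 q2 p' ->
    p <> x -> p' <> x -> ~ s x p p'.
Proof.
move=> sT pq1 pq2 ne.
have [r [br nbr]] : exists r, block s p2 q2 r /\ ~ block s p1 q1 r.
  apply: contrapT => nex; apply: ne.
  have sub r : block s p2 q2 r -> block s p1 q1 r.
    by move=> br; apply: contrapT => nbr; apply: nex; exists r.
  have bp : block s p1 q1 p2 by apply: sub; left.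
  have bq : block s p1 q1 q2 by apply: sub; right; left.
  apply: point_set_eq => v; apply: iff_sym; apply: (block_eq sT pq1 bp bq).
  by case: pq2.
have p1r : p1 <> r by move=> e; apply: nbr; left.
suff [x [bx gx]] : exists x, block s p1 q1 x /\
    forall p, block s p1 q1 p -> p <> x -> ~ s x r p.
  exists x; split=> // p p' bp bp' px p'x sxpp'; apply: (gx p bp px).
  have xr : x <> r by move=> e; apply: nbr; rewrite -e.
  apply: (side_trans sT (z := p')); last exact: (side_sym sT).
  case: (pselect (r = p')) => [->|rp']; first exact: (side_refl sT).
  by have [_ h] := block_adj sT pq2 br bp' rp'; apply: h => //; move/esym.
case: (pselect (s p1 r q1)) => srq; last first.
  exists p1; split; first by left.
  move=> p [->//|[->//|[pp1 pq]]] ne1 srp; apply: srq.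
  apply: (side_trans sT) srp _; apply: adj_side => //; exact: adj_sym.
have [p1a na] := nextP sT p1r; set a := next s p1 r in p1a na.
have ba : block s p1 q1 a.
  case: (pselect (a = q1)) => [->|aq]; first by right; left.
  right; right; split; first exact: adj_sym.
  apply: (adj_block sT p1a pq1) => //; apply: (side_trans sT) srq.
  exact: next_side.
exists a; split=> // p bp pa sarp; apply: na.
apply: (side_trans sT (z := p)); last exact: (side_sym sT).
have ap1 : a <> p1 by case: p1a => + _ => /[swap] ->.
case: (pselect (p1 = p)) => [->|p1p]; first exact: (side_refl sT).
have bp1 : block s p1 q1 p1 by left.
by have [_ h] := block_adj sT pq1 bp1 bp p1p; apply: h => // /esym.
Qed.

(** Wherever [x] lies, it separates two points of the opposite side, against the convexity of that
    side. *)
Lemma overlap_absurd z c x p q p' q' : z <> c ->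
  s0 z c p -> ~ s0 z c q -> s0 z c p' -> ~ s0 z c q' ->
  (p <> x -> p' <> x -> ~ s0 x p p') -> (q <> x -> q' <> x -> ~ s0 x q q') -> False.
Proof.
move=> zc cp nq cp' nq' sepp sepq; case: (pselect (s0 z c x)) => cx.
  have n : ~ s0 x q q' by apply: sepq => e; [apply: nq | apply: nq']; rewrite e.
  exact: (half_space_coconvex s0G zc nq nq' n cx).
have n : ~ s0 x p p' by apply: sepp => e; apply: (cx); rewrite -e.
exact: cx (half_space_convex s0G zc cp cp' n).
Qed.

Section Norm.
Variable s : side X.
Hypothesis sG : good act s.
Let sT := good_tree sG.

Let rhoG : good act (rho s) := rho_good act1 actM s0G sG.
Let rhoT := good_tree rhoG.

(** Two pieces of a block of [s] are separated at one of its points; inside a block [rho] separates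
    as [s0] does, so no half-space cuts both. *)
Lemma rho_no_overlap : no_overlap s0 (rho s) s.
Proof.
move=> z c B1 B2 zc [p1 [q1 [pq1 -> cp1 nq1]]] [p2 [q2 [pq2 -> cp2 nq2]]] e.
apply: contrapT => ne.
have [x [bx sepx]] := blocks_separated rhoT pq1 pq2 ne.
have sub := @rho_sub X s0 s.
have adjr := @adj_rho X s0 s.
have in2 t : block (rho s) p2 q2 t -> block s p1 q1 t.
  move=> /(block_sub sub) bt; have := coarse_blockE sG sub pq1.
  by rewrite e (coarse_blockE sG sub pq2) => <-.
have in1 t : block (rho s) p1 q1 t -> block s p1 q1 t by exact: (block_sub sub).
have pq1' := adjr _ _ pq1.
have sep p p' : block (rho s) p1 q1 p -> block (rho s) p2 q2 p' ->
    p <> x -> p' <> x -> ~ s0 x p p'.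
  move=> bp bp' px p'x s0x; apply: (sepx p p') => //.
  have xp : adj s x p by apply: (block_adj sT pq1'); [exact: in1 | exact: in1 | exact/nesym].
  have xp' : adj s x p'.
    by apply: (block_adj sT pq1'); [exact: in1 | exact: in2 | exact/nesym].
  split; last by rewrite /fold_side (next_of_adj sT xp) (next_of_adj sT xp').
  case: (pselect (p = p')) => [->|pp']; first exact: (side_refl sT).
  apply: adj_side => //; apply: (block_adj sT pq1') => //; [exact: in1 | exact: in2].
apply: (@overlap_absurd z c x p1 q1 p2 q2) => // h1 h2; apply: sep => //.
- by left.
- by left.
- by right; left.
- by right; left.
Qed.

Lemma norm_rho : norm (rho s) = norm s.
Proof.
apply/esym/norm_eq => //; [exact: rho_sub | exact: rho_no_overlap].
Qed.

(** Reduce to neighbours [a] and [c] of [x]. The half-space at [x] containing both is crossed by the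
    geodesics of [s''] from [a] and from [c] to [x], in blocks inside one block of [s]. Equal norms
    make these blocks equal, which puts [a] and [c] on one side of [x]. *)
Lemma rho_finest s'' : good act s'' -> (forall x y z, s'' x y z -> s x y z) ->
  norm s = norm s'' -> forall x y z, rho s x y z -> s'' x y z.
Proof.
move=> s''G sub e x y z [sxyz f]; have s''T := good_tree s''G.
have nolap := norm_no_overlap fin_stab s''G sG sub e.
apply: contrapT => n.
have xy : x <> y.
  move=> xy; apply: n; move: sxyz; rewrite -xy => /(side_self sT) ->.
  exact: (side_refl s''T).
have xz : x <> z.
  move=> xz; apply: n; move: sxyz; rewrite -xz => /(side_sym sT)/(side_self sT) ->.
  exact: (side_refl s''T).
have [xa na] := nextP sT xy; have [xc nc] := nextP sT xz.
rewrite /fold_side in f; set a := next s x y in f xa na.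
set c := next s x z in f xc nc.
have ax : a <> x by case: xa => + _ => /[swap] ->.
have cx : c <> x by case: xc => + _ => /[swap] ->.
have sxay : s'' x a y by apply: (btw_sidel s''T _ ax) => /sub.
have sxcz : s'' x c z by apply: (btw_sidel s''T _ cx) => /sub.
have nac : ~ s'' x a c.
  move=> sac; apply: n; apply: (side_trans s''T (z := a)).
    exact: (side_sym s''T).
  exact: (side_trans s''T) sac sxcz.
have ac : a <> c by move=> ac; apply: nac; rewrite ac; exact: (side_refl s''T).
have adjac := next_side_block sT xy xz sxyz ac; rewrite -/a -/c in adjac.
have xa' : x <> a by move/esym.
have nax : ~ s0 x a x by move/(side_sym s0T)/(side_self s0T).
have ax_adj := adj_sym sT xa; have cx_adj := adj_sym sT xc.
have block_c : (block s c x : point_set X) = block s a x.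
  apply: point_set_eq => v; apply: (block_eq sT ax_adj) => //.
    by right; right; split=> //; exact: adj_sym.
  by right; left.
have [p [q [pq cp nq np nq2]]] := crossing s''G (side_refl s0T x a) nax.
have [p' [q' [pq' cp' nq' np' nq2']]] := crossing s''G f nax.
have coarse u v w : adj s w x -> adj s'' u v -> ~ s'' u w x -> ~ s'' v w x ->
    coarse_block s (block s'' u v) = block s w x.
  move=> wx uv nu nv; rewrite (coarse_blockE sG sub uv); apply: point_set_eq => k.
  have bu := btw_block s''T sub sT wx nu; have bv := btw_block s''T sub sT wx nv.
  by apply: (block_eq sT wx bu bv); case: uv.
have eB : (block s'' p q : point_set X) = block s'' p' q'.
  apply: (nolap x a) => //.
  - by exists p, q.
  - by exists p', q'.
  - by rewrite (coarse p q a) // (coarse p' q' c) // block_c.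
have px : p <> x by move=> px; apply: nax; rewrite -{2}px.
have p'x : p' <> x by move=> p'x; apply: nax; rewrite -{2}p'x.
have spa : s'' x p a by exact: (btw_side s''T np px).
have sp'c : s'' x p' c by exact: (btw_side s''T np' p'x).
apply: nac; apply: (side_trans s''T (z := p)); first exact: (side_sym s''T).
apply: (side_trans s''T) sp'c.
case: (pselect (p = p')) => [->|pp']; first exact: (side_refl s''T).
have bp' : block s'' p q p'.
  suff : (block s'' p q : point_set X) p' by [].
  by rewrite eB; left.
have bp : block s'' p q p by left.
have [_ h] := block_adj s''T pq bp bp' pp'.
by apply: h; exact/nesym.
Qed.

End Norm.

Lemma rho_norm_eq s s'' : good act s -> good act s'' ->
  (forall x y z, s'' x y z -> s x y z) -> norm s = norm s'' -> rho s'' = rho s.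
Proof.
move=> sG s''G sub e.
have rG := rho_good act1 actM s0G sG; have r''G := rho_good act1 actM s0G s''G.
have rs'' : forall x y z, rho s x y z -> s'' x y z by exact: rho_finest.
apply: side_eq.
  by apply: (rho_finest s''G rG rs''); rewrite norm_rho.
apply: (rho_finest sG r''G); last by rewrite norm_rho.
by move=> x y z /rho_sub; exact: sub.
Qed.

(** ** Folding a cut structure *)

Section Fold.
Variable s : side X.
Hypotheses (sG : good act s) (cut_s : forall x y z, s x y z -> fold s x y z).
Let sT := good_tree sG.
Let sE := good_equiv sG.

(** Along the geodesic of [s] from [x] to [y], the folding separates nothing at an interior point
    [u]: the steps before and after [u] are on one side for [s0]. By [s0_stab], what fixes [u] and
    the former fixes the latter. *)
Lemma fold_fixes x y g : x <> y -> (forall u, u <> x -> u <> y -> fold s u x y) ->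
  act g x = x -> act g (next s x y) = next s x y -> act g y = y.
Proof.
move=> xy hxy gx ga.
have [xa na] := nextP sT xy.
suff main u w : w = y -> ~ s u x w -> u <> x -> act g u = u ->
    act g (next s u x) = next s u x -> act g y = y.
  apply: (main (next s x y) y) => //; first exact: (next_neq sT).
  by rewrite (next_of_adj sT (adj_sym sT xa)).
move: u w; apply: (geodesic_ind sT) => u w IH wy; rewrite wy in IH * => nu ux gu gp.
case: (pselect (u = y)) => [<- //|uy].
have [uv nv] := nextP sT uy.
have v_side := next_side sT u y.
have IHv := IH uy (erefl y); set v := next s u y in uv nv v_side IHv.
have nuxv : ~ s u x v by move=> h; apply: nu; exact: (side_trans sT) h v_side.
have vx : v <> x.
  by move=> vx; apply: nu; rewrite -vx.
have gv : act g v = v.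
  have [t [t1 tu tv]] := good_fix sG uv.
  apply: (s0_stab (u := u) (t := t)) => //; first by case: uv.
  have := hxy u ux uy; rewrite /fold_side -/v => h.
  apply: (side_trans s0T (z := next s u x)); first exact: (side_sym s0T).
  by have := s0E g h; rewrite gu gp.
apply: IHv => //; first exact: (btw_transr sT nv nu).
have -> : next s v x = u.
  apply/esym/(next_uniq sT); first exact: adj_sym.
  exact: btw_sym.
by [].
Qed.

Lemma fold_good : good act (fold s).
Proof.
apply: (good_coarsen sG cut_s).
- by move=> x y z; exact: (side_sym s0T).
- by move=> x y z w; exact: (side_trans s0T).
- move=> x y; rewrite /fold_side next_self // => /(side_self s0T) e.
  by apply: contrapT => yx; apply: (next_neq sT (x := x) (y := y)) e => /esym.
- exact: fold_equivariant.
- move=> x y g [xy hxy] gx fxy; apply: (fold_fixes xy hxy gx).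
  have xa := next_adj sT xy; have [t [t1 tx ta]] := good_fix sG xa.
  apply: (s0_stab (u := x) (t := t)) => //; first by case: xa.
  by move: fxy; rewrite /fold_side -{3}gx (next_act act1 actM sT sE).
- move=> x y [xy hxy]; have [t [t1 tx ta]] := good_fix sG (next_adj sT xy).
  by exists t; split=> //; exact: (fold_fixes xy hxy tx ta).
Qed.

Definition meet s' : side X := fun x y z => s' x y z /\ fold s x y z.

Lemma meet_good s' : good act s' -> (forall x y z, s x y z -> s' x y z) -> good act (meet s').
Proof.
move=> s'G sub; have s'T := good_tree s'G.
have adj_meet x y : adj (meet s') x y -> adj s' x y.
  by case=> xy h; split=> // t tx ty; case: (h t tx ty).
apply: (good_coarsen sG).
- by move=> x y z sxyz; split; [exact: sub | exact: cut_s].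
- by move=> x y z [h f]; split; [exact: (side_sym s'T) | exact: (side_sym s0T)].
- move=> x y z w [h f] [h' f']; split; first exact: (side_trans s'T) h'.
  exact: (side_trans s0T) f'.
- by move=> x y [/(side_self s'T)].
- move=> g x y z [h f]; split; first exact: (good_equiv s'G).
  exact: fold_equivariant.
- by move=> x y g /adj_meet xy gx [h _]; exact: (good_stab s'G xy).
- by move=> x y /adj_meet; exact: (good_fix s'G).
Qed.

Section Coarser.
Variable s' : side X.
Hypotheses (s'G : good act s') (sub : forall x y z, s x y z -> s' x y z).
Let s'T := good_tree s'G.

(** With equal norms, [no_overlap] would identify the blocks of [s] through [x] and [a] and through
    [x] and [c], both cut by the half-space at [x] containing [a] and [c]. *)
Lemma meet_norm_lt x y z : s' x y z -> fold s x y z -> ~ s x y z ->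
  (norm s' < norm s)%N.
Proof.
move=> s'xyz f n; rewrite ltn_neqAle; apply/andP; split; last exact: norm_leq.
apply/eqP => e; have nolap := norm_no_overlap fin_stab sG s'G sub e.
have xy : x <> y.
  move=> xy; apply: n; move: s'xyz; rewrite -xy => /(side_self s'T) ->.
  exact: (side_refl sT).
have xz : x <> z.
  move=> xz; apply: n; move: s'xyz; rewrite -xz => /(side_sym s'T)/(side_self s'T) ->.
  exact: (side_refl sT).
have xa := next_adj sT xy; have xc := next_adj sT xz.
have sxay := next_side sT x y; have sxcz := next_side sT x z.
rewrite /fold_side in f; set a := next s x y in f xa sxay.
set c := next s x z in f xc sxcz.
have nac : ~ s x a c.
  move=> sac; apply: n; apply: (side_trans sT (z := a)); first exact: (side_sym sT).
  exact: (side_trans sT) sac sxcz.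
have s'ac : s' x a c.
  apply: (side_trans s'T (z := y)); first exact: sub.
  by apply: (side_trans s'T) s'xyz _; apply/(side_sym s'T)/sub.
have ac : a <> c by move=> ac; apply: nac; rewrite ac; exact: (side_refl sT).
have nax : ~ s0 x a x by move/(side_sym s0T)/(side_self s0T)/esym; case: xa.
have ax_adj := adj_sym sT xa; have cx_adj := adj_sym sT xc.
have xa' := adj_sub sub xa; have xc' := adj_sub sub xc.
have block_c : (block s' c x : point_set X) = block s' a x.
  apply: point_set_eq => v; apply: (block_eq s'T (adj_sym s'T xa')) => //.
  - right; right; split; last exact: adj_sym.
    by apply: adj_sym => //; exact: (adj_block s'T xa' xc').
  - by right; left.
  - by case: cx_adj.
have eB : (block s a x : point_set X) = block s c x.
  apply: (nolap x a).
  - by case: xa.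
  - by exists a, x; split=> //; exact: (side_refl s0T).
  - by exists c, x.
  - by rewrite (coarse_blockE s'G sub ax_adj) (coarse_blockE s'G sub cx_adj) block_c.
have bc : block s a x c.
  suff : (block s a x : point_set X) c by [].
  by rewrite eB; left.
apply: nac; apply: adj_side => //.
by apply: (block_adj sT ax_adj) => //; left.
Qed.

(** Inside a block of [s'], each cut made by [s] is then a cut of [s0], first at neighbours and by
    [local_to_global] along geodesics; so no half-space cuts two pieces. *)
Lemma meet_norm_eq : (forall x y z, s' x y z -> fold s x y z -> s x y z) ->
  norm s' = norm s.
Proof.
move=> nlap; apply: norm_eq => // z c B1 B2 zc.
case=> p1 [q1 [pq1 -> cp1 nq1]] [p2 [q2 [pq2 -> cp2 nq2]]].
rewrite (coarse_blockE s'G sub pq1) (coarse_blockE s'G sub pq2) => e.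
apply: contrapT => ne.
have [x [bx sepx]] := blocks_separated sT pq1 pq2 ne.
have pq1' := adj_sub sub pq1.
have in1 t : block s p1 q1 t -> block s' p1 q1 t by exact: (block_sub sub).
have in2 t : block s p2 q2 t -> block s' p1 q1 t.
  move=> /(block_sub sub) bt.
  suff : (block s' p1 q1 : point_set X) t by [].
  by rewrite e.
have adjin t u : block s' p1 q1 t -> block s' p1 q1 u -> t <> u -> adj s' t u.
  exact: (block_adj s'T pq1').
have side_in t u v : block s' p1 q1 t -> block s' p1 q1 u -> block s' p1 q1 v ->
    u <> t -> v <> t -> s' t u v.
  move=> bt bu bv ut vt; case: (pselect (u = v)) => [->|uv]; first exact: (side_refl s'T).
  by apply: adj_side; [exact/adjin/nesym | exact/adjin/nesym | exact: adjin].
have sep p p' : block s p1 q1 p -> block s p2 q2 p' ->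
    p <> x -> p' <> x -> ~ s0 x p p'.
  move=> bp bp' px p'x s0x.
  have xp : adj s x p by apply: (block_adj sT pq1) => //; exact/nesym.
  have nsx := sepx p p' bp bp' px p'x.
  have xp'n : x <> p' by move/esym.
  have xp's' : adj s' x p' by apply: adjin => //; [exact: in1 | exact: in2].
  have nfold t u v : block s' p1 q1 t -> block s' p1 q1 u -> block s' p1 q1 v ->
      u <> t -> v <> t -> ~ s t u v -> ~ fold s t u v.
    by move=> bt bu bv ut vt n f; apply: n; apply: nlap => //; exact: side_in.
  have geo t : ~ s t x p' -> block s' p1 q1 t.
    move=> nt; have bt := btw_block sT sub s'T xp's' nt.
    have bx' := in1 _ bx; have bp'' := in2 _ bp'.
    by apply/(block_eq s'T pq1' bx' bp'' xp'n t).
  have LG : forall t, ~ s t x p' -> ~ s0 t x p'.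
    apply: (local_to_global sT s0T) => t u v nt nu nv tu tv n.
    have := nfold t u v (geo _ nt) (geo _ nu) (geo _ nv) _ _ n.
    rewrite /fold_side (next_of_adj sT tu) (next_of_adj sT tv); apply.
      by case: tu => /nesym.
    by case: tv => /nesym.
  have [xa na] := nextP sT xp'n.
  have nf := nfold x p p' (in1 _ bx) (in1 _ bp) (in2 _ bp') px p'x nsx.
  apply: nf; rewrite /fold_side (next_of_adj sT xp).
  apply: (side_trans s0T) s0x _.
  apply: (side_sym s0T); have := LG _ na.
  move=> h; apply: (btw_sidel s0T h).
  by case: xa => + _ => /[swap] ->.
apply: (@overlap_absurd z c x p1 q1 p2 q2) => // h1 h2; apply: sep => //.
- by left.
- by left.
- by right; left.
- by right; left.
Qed.

End Coarser.

(** By [local_to_global], separation for [s] is separation for [s0]. Conversely, let [x] separate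
    its neighbours [a] and [c] for [s0] but not for [s]: a nontrivial element fixes both, [s0_block]
    moves [a] to the side of [c] by some [g] fixing [x], and [good_stab] for [s] gives
    [act g a = a], a contradiction. *)
Lemma fold_base : (forall x y z, fold s x y z -> s x y z) -> s = s0.
Proof.
move=> fs.
have sub0 x y z : s0 x y z -> s x y z.
  move=> s0xyz; apply: contrapT => n.
  apply: (local_to_global sT s0T _ n) s0xyz => t u v nt nu nv tu tv nt' s0t.
  apply: nt'; apply: fs; by rewrite /fold_side (next_of_adj sT tu) (next_of_adj sT tv).
apply: side_eq => // x y z sxyz.
apply: contrapT => n.
have xy : x <> y.
  move=> xy; apply: n; move: sxyz; rewrite -xy => /(side_self sT) ->.
  exact: (side_refl s0T).
have xz : x <> z.
  move=> xz; apply: n; move: sxyz; rewrite -xz => /(side_sym sT)/(side_self sT) ->.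
  exact: (side_refl s0T).
have xa := next_adj s0T xy; have xc := next_adj s0T xz.
have sxay := next_side s0T x y; have sxcz := next_side s0T x z.
set a := next s0 x y in xa sxay; set c := next s0 x z in xc sxcz.
have nac : ~ s0 x a c.
  move=> sac; apply: n; apply: (side_trans s0T (z := a)); first exact: (side_sym s0T).
  exact: (side_trans s0T) sac sxcz.
have sac : s x a c.
  apply: (side_trans sT (z := y)); first exact: sub0.
  by apply: (side_trans sT) sxyz _; apply/(side_sym sT)/sub0.
have xa' := adj_sub sub0 xa; have xc' := adj_sub sub0 xc.
have ac : a <> c by move=> ac; apply: nac; rewrite ac; exact: (side_refl s0T).
have [t [t1 ta tc]] := good_fix sG (adj_block sT xa' xc' sac ac).
have [g [gx s0ga]] := s0_block xa xc t1 ta tc.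
have ga : act g a = a.
  apply: (good_stab sG xa') => //; apply: (side_trans sT) sac _.
  by apply/(side_sym sT)/sub0.
by apply: nac; rewrite -ga.
Qed.

End Fold.

(** ** The poset *)

Definition structure : Type := {s : side X | `[< good act s >]}.
HB.instance Definition _ := gen_eqMixin (side X).
HB.instance Definition _ := gen_choiceMixin (side X).
HB.instance Definition _ := SubChoice.on structure.

Implicit Types (a b : structure).

Definition finer : rel structure := fun a b =>
  (a != b) && `[< forall x y z, val a x y z -> val b x y z >].

Lemma structure_good a : good act (val a).
Proof. exact/asboolP/(valP a). Qed.

Lemma finerxx : irreflexive finer.
Proof. by move=> a; rewrite /finer eqxx. Qed.

Lemma finer_trans : transitive finer.
Proof.
move=> b a c /andP[ab /asboolP sab] /andP[bc /asboolP sbc]; apply/andP; split.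
  apply: contraNneq ab => ac; rewrite ac in sab *; apply/eqP/val_inj.
  by apply: side_eq.
by apply/asboolP => x y z /sab/sbc.
Qed.

Lemma leP_finer a b : reflect (forall x y z, val a x y z -> val b x y z) (le finer a b).
Proof.
apply: (iffP orP) => [[/eqP->//|/andP[_ /asboolP]//]|sab].
by case: (eqVneq a b) => [->|ab]; [left | right; rewrite /finer ab; apply/asboolP].
Qed.

Lemma finer_sub a b : finer a b -> forall x y z, val a x y z -> val b x y z.
Proof. by case/andP=> _ /asboolP. Qed.

Definition base_structure : structure := Sub s0 (asboolT s0G).

Definition rho_structure a : structure :=
  Sub (rho (val a)) (asboolT (rho_good act1 actM s0G (structure_good a))).

Theorem structures_acyclic : acyclic_on finer predT.
Proof.
apply: (@acyclic_morse _ finer finerxx finer_trans predT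
  (fun a => norm (val a)) rho_structure base_structure) => //.
- move=> a _; apply/and3P; split=> //.
    by apply/leP_finer => x y z; exact: rho_sub.
  by apply/eqP/norm_rho/structure_good.
- move=> a b _ _ /finer_sub; apply: norm_leq => //; exact: structure_good.
- move=> a b _ _ /finer_sub ab e; apply: val_inj; apply: rho_norm_eq => //.
  + exact: structure_good.
  + exact: structure_good.
- move=> a _ ra ab; have aG := structure_good a.
  have cut_a x y z : val a x y z -> fold (val a) x y z.
    by rewrite -{1}ra => -[].
  exists (Sub (fold (val a)) (asboolT (fold_good aG cut_a))).
  apply/and3P; split=> //; first by apply/leP_finer.
  have [x [y [z [f n]]]] : exists x y z, fold (val a) x y z /\ ~ val a x y z.
    apply: contrapT => nex; apply/(elimN eqP ab)/val_inj/fold_base => // x y z f.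
    by apply: contrapT => n; apply: nex; exists x, y, z.
  by apply: (meet_norm_lt aG _ _ _ f n) => //; exact: fold_good.
move=> a _ ra ab; have aG := structure_good a.
have cut_a x y z : val a x y z -> fold (val a) x y z.
  by rewrite -{1}ra => -[].
(* The closure operator on the lower neighbours of [a] intersects [b] with the folding [phi] of [a];
   the default value concerns only [b] not above [a]. For [b] above [a], the norm drops exactly when
   this intersection differs from [a], so [f] preserves the set of lower neighbours. *)
pose f b : structure := insubd b (meet (val a) (val b)).
have fE b : le finer a b -> val (f b) = meet (val a) (val b).
  move=> /leP_finer ale; rewrite /f insubdK //; apply/asboolP.
  by apply: meet_good => //; exact: structure_good.
pose phi : structure := Sub (fold (val a)) (asboolT (fold_good aG cut_a)).
have norm_lt b : le finer a b -> (norm (val b) < norm (val a))%N ->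
    exists x y z, [/\ val b x y z, fold (val a) x y z & ~ val a x y z].
  move=> /leP_finer ale; rewrite ltnNge => /negP ltn; apply: contrapT => nex; apply: ltn.
  rewrite (meet_norm_eq aG (structure_good b) ale) // => x y z bxyz fxyz.
  by apply: contrapT => n; apply: nex; exists x, y, z.
have lt_norm b x y z : le finer a b -> val b x y z -> fold (val a) x y z -> ~ val a x y z ->
    (norm (val b) < norm (val a))%N.
  by move=> /leP_finer ale; apply: meet_norm_lt => //; exact: structure_good.
have aphi : le finer a phi by apply/leP_finer.
have norm_phi : (norm (val phi) < norm (val a))%N.
  have [x [y [z [fx n]]]] : exists x y z, fold (val a) x y z /\ ~ val a x y z.
    apply: contrapT => nex; apply/(elimN eqP ab)/val_inj/fold_base => // x y z fx.
    by apply: contrapT => n; apply: nex; exists x, y, z.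
  exact: (lt_norm phi x y z).
apply: (@acyclic_closure _ finer finerxx finer_trans _ f phi).
- by rewrite /= aphi.
- move=> b c /and3P[_ ale _] /and3P[_ alc _] /finer_sub bc; apply/leP_finer => x y z.
  by rewrite !fE // => -[bx fx]; split=> //; exact: bc.
- move=> b /and3P[_ ale ltb]; have aleP := elimT (leP_finer a b) ale.
  have afb : le finer a (f b).
    by apply/leP_finer => x y z ax; rewrite fE //; split; [exact: aleP | exact: (cut_a)].
  have [x [y [z [bx fx n]]]] := norm_lt b ale ltb.
  have ltf : (norm (val (f b)) < norm (val a))%N.
    by apply: (lt_norm _ x y z) => //; rewrite fE.
  rewrite /= afb ltf /=; apply/andP; split; apply/leP_finer => u v w; rewrite fE //.
    by case.
  by case.
Qed.

End Acyclicity.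

Lemma aut1E (G : groupType) (f : aut G) : f 1 = 1.
Proof. by apply: (@mulgI _ (f 1)); rewrite -autM !mulg1. Qed.

Lemma autV (G : groupType) (f : aut G) g : f g^-1 = (f g)^-1.
Proof. by apply: (@mulgI _ (f g)); rewrite -autM !mulgV aut1E. Qed.

(** * The action of the outer automorphism group on tree structures *)

Section Pull.
Variables (G : groupType) (X : choiceType) (act : G -> X -> X).
Hypotheses (act1 : forall x, act 1 x = x)
  (actM : forall g h x, act (g * h) x = act g (act h x)).
Variables (phi : aut G) (f f' : X -> X).
Hypotheses (fK : cancel f f') (fK' : cancel f' f)
  (f_act : forall g x, f (act g x) = act (phi g) (f x)).
Implicit Types (s : side X) (x y z t : X) (g h : G).

Definition pull s : side X := fun x y z => s (f x) (f y) (f z).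

Lemma adj_pull s x y : adj (pull s) x y <-> adj s (f x) (f y).
Proof.
split=> -[xy h].
  split=> [/(can_inj fK)//|t tx ty].
  by rewrite -(fK' t); apply: h => e; [apply: tx | apply: ty]; rewrite -e fK'.
by split=> [e|t tx ty]; [apply: xy; rewrite e | apply: h => /(can_inj fK)].
Qed.

Lemma pull_good s : good act s -> good act (pull s).
Proof.
move=> sG; have sT := good_tree sG.
have phiK g : phi (aut_inv phi g) = g by exact: aut_invVK.
have f'_act g x : f' (act g x) = act (aut_inv phi g) (f' x).
  by apply: (can_inj fK); rewrite f_act !fK' phiK.
split.
- split.
  + by move=> x y; exact: (side_refl sT).
  + by move=> x y z; exact: (side_sym sT).
  + by move=> x y z w; exact: (side_trans sT).
  + by move=> x y /(side_self sT)/(can_inj fK).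
  + by move=> x y z xy; apply: (side_tree sT) => /(can_inj fK).
  + move=> y z; have [l lP] := side_fin sT (f y) (f z).
    by exists (map f' l) => x /lP xl; apply/mapP; exists (f x); rewrite ?fK.
- by move=> g x y z; rewrite /pull !f_act; exact: (good_equiv sG).
- move=> x y g /adj_pull xy gx; rewrite /pull f_act => h.
  by apply: (can_inj fK); rewrite f_act; apply: (good_stab sG xy) => //; rewrite -f_act gx.
- move=> x y /adj_pull xy; have [g [g1 gx gy]] := good_fix sG xy.
  exists (aut_inv phi g); split.
  + by move=> e; apply: g1; rewrite -(phiK g) e aut1E.
  + by rewrite -{2}(fK x) -gx f'_act fK.
  + by rewrite -{2}(fK y) -gy f'_act fK.
have [S spS] := good_span sG; exists (map f' S); split.
- by rewrite map_inj_uniq; [exact: spanning_uniq spS | exact: can_inj fK'].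
- move=> x; have [g [y [yS fx]]] := spanning_cover spS (f x).
  exists (aut_inv phi g), (f' y); split; first exact: map_f.
  by rewrite -f'_act -fx fK.
- move=> g _ _ /mapP[x xS ->] /mapP[y yS ->] e; congr f'.
  apply: (spanning_orbit spS (g := phi g)) => //.
  by rewrite -(fK' y) e f_act fK'.
- move=> P PP _ _ /mapP[x xS ->] /mapP[y yS ->].
  apply: (spanning_conn spS (P := fun x => P (f' x))) => // {xS yS}x {}y xS yS xy.
  by apply: PP; [exact: map_f | exact: map_f | apply/adj_pull; rewrite !fK'].
move=> P P1 PM PV Pgen g; rewrite -(aut_invK phi g).
move: (phi g); apply: (spanning_gen spS) => [|h k Ph Pk|h Ph|x h xS hx].
- by rewrite aut1E.
- by rewrite autM; exact: PM.
- by rewrite autV; exact: PV.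
- apply: (Pgen (f' x)); first exact: map_f.
  by rewrite -f'_act hx.
Qed.

End Pull.

Section FixedPoint.
Variables (G : groupType) (X : choiceType) (act : G -> X -> X).
Hypotheses (act1 : forall x, act 1 x = x)
  (actM : forall g h x, act (g * h) x = act g (act h x)).
Variable s : side X.
Hypothesis sG : good act s.
Let sT := good_tree sG.
Let sE := good_equiv sG.

(* A minimal finite convex set invariant under [K] consists of extremal points,
   so any two of its points are adjacent; points of one orbit never are. *)
Lemma finite_subgroup_fixes (K : G -> Prop) : fin_pred K -> K 1 ->
  (forall g h, K g -> K h -> K (g * h)) -> (forall g, K g -> K g^-1) -> X ->
  exists x, forall g, K g -> act g x = x.
Proof.
move=> finK K1 KM KV xb.
pose inv (C : seq X) := forall g x, K g -> x \in C -> act g x \in C.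
pose convex (C : seq X) := forall x y t, x \in C -> y \in C -> ~ s t x y -> t \in C.
pose gen_conv (C : seq X) := [/\ exists c, c \in C, inv C & convex C].
have [C0 C0P] : exists C, gen_conv C.
  have [l lP] := finK; pose O := [seq act g xb | g <- l & `[< K g >]].
  have OP y : y \in O <-> exists2 g, K g & y = act g xb.
    split=> [/mapP[g]|[g Kg ->]].
      by rewrite mem_filter => /andP[/asboolP Kg _] ->; exists g.
    by apply: map_f; rewrite mem_filter lP // andbT; apply/asboolP.
  pose hull t := t \in O \/ exists x y, [/\ x \in O, y \in O & ~ s t x y].
  have [D DP] : fin_pred hull.
    pose I x y := projT1 (cid (side_fin sT x y)).
    exists (O ++ [seq t | p <- [seq (x, y) | x <- O, y <- O], t <- I p.1 p.2]).
    move=> t [tO|[x [y [xO yO nt]]]]; rewrite mem_cat; first by rewrite tO.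
    apply/orP; right; apply/allpairsPdep; exists (x, y), t; split=> //=.
      by apply/allpairsP; exists (x, y).
    by rewrite /I; case: cid => I' /=; exact.
  have oO g x : K g -> x \in O -> act g x \in O.
    by move=> Kg /OP[h Kh ->]; apply/OP; exists (g * h); [exact: KM | rewrite actM].
  exists [seq t <- D | `[< hull t >]].
  have CP t : t \in [seq t <- D | `[< hull t >]] <-> hull t.
    rewrite mem_filter; split=> [/andP[/asboolP]//|ht].
    by rewrite DP // andbT; apply/asboolP.
  have xO : xb \in O by apply/OP; exists 1; rewrite ?act1.
  split; first by exists xb; apply/CP; left.
  - move=> g t Kg /CP[tO|[x [y [xO' yO nt]]]]; apply/CP; first by left; exact: oO.
    right; exists (act g x), (act g y).
    by split; [exact: oO | exact: oO | move/(side_act act1 actM sE)].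
  - move=> p q t /CP hp /CP hq nt; apply/CP; apply: contrapT => nh; apply: nt.
    have nO : t \notin O by apply/negP => tO; apply: nh; left.
    have sO x y : x \in O -> y \in O -> s t x y.
      by move=> xO' yO; apply: contrapT => n; apply: nh; right; exists x, y.
    suff key r : hull r -> s t r xb.
      by apply: (side_trans sT) (key p hp) _; apply: (side_sym sT); exact: key.
    case=> [rO|[x [y [xO' yO nr]]]]; first exact: sO.
    apply: contrapT => n; apply: (nr).
    have tr : t <> r by move=> tr; apply: nr; rewrite -tr; exact: sO.
    have tx' x' : x' \in O -> s r t x'.
      move=> x'O; apply: (btw_sidel sT) tr => sx.
      by apply: n; apply: (side_trans sT) sx _; exact: sO.
    by apply: (side_trans sT (z := t)); [apply: (side_sym sT) |]; exact: tx'.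
have [n minn nP] : exists2 n, (exists2 C, gen_conv C & size C = n) &
    forall C, gen_conv C -> (n <= size C)%N.
  have ex : exists n, `[< exists2 C, gen_conv C & size C = n >].
    by exists (size C0); apply/asboolP; exists C0.
  exists (ex_minn ex); case: ex_minnP => n /asboolP h hmin //.
  by move=> C CP; apply: hmin; apply/asboolP; exists C.
have [C [[c cC] Cinv Cconv] sizeC] := minn.
have [y yC yext] : exists2 y, y \in C &
    forall p q, p \in C -> q \in C -> p <> y -> q <> y -> s y p q.
  (* [B y] holds the points of [C] beyond [y] as seen from [c]. Where it is smallest, it contains
     only [y], and [y] is extremal. *)
  pose B y z := `[< z = y \/ ~ s y c z >].
  have [k [y yC yk] kmin] : exists2 k, (exists2 y, y \in C & count (B y) C = k) &
      forall y, y \in C -> (k <= count (B y) C)%N.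
    have ex : exists k, `[< exists2 y, y \in C & count (B y) C = k >].
      by exists (count (B c) C); apply/asboolP; exists c.
    exists (ex_minn ex); case: ex_minnP => k /asboolP h hmin //.
    by move=> y yC; apply: hmin; apply/asboolP; exists y.
  exists y => // p q pC qC py qy; apply: contrapT => n1.
  suff [r [rC ry nr]] : exists r, [/\ r \in C, r <> y & ~ s y c r].
    have := kmin r rC; rewrite -yk leqNgt => /negP; apply.
    apply: (count_ltn (x := y)) => //.
    - move=> z zC /asboolP[->|nz]; apply/asboolP; right=> //.
      exact: (btw_trans sT nr nz).
    - by apply/asboolP; left.
    apply/asboolPn => -[/esym//|]; apply; apply: (side_sym sT).
    exact: (btw_side sT nr (nesym ry)).
  case: (pselect (s y c p)) => cp; last by exists p.
  exists q; split=> // cq; apply: n1; apply: (side_trans sT) cq.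
  exact: (side_sym sT).
(* Removing the orbit of an extremal point keeps invariance and convexity, so by minimality [C] is
   that orbit. *)
have orbC x : x \in C -> exists2 g, K g & x = act g y.
  move=> xC; apply: contrapT => nx.
  pose C' := [seq t <- C | ~~ `[< exists2 g, K g & t = act g y >]].
  have C'P t : t \in C' <-> t \in C /\ ~ exists2 g, K g & t = act g y.
    rewrite mem_filter andbC; split; first by case/andP=> -> /asboolPn.
    by case=> -> n1; apply/asboolPn.
  have : gen_conv C'.
    split; first by exists x; apply/C'P.
    - move=> g t Kg /C'P[tC nt]; apply/C'P; split; first exact: Cinv.
      case=> h Kh e; apply: nt; exists (g^-1 * h); first by apply: KM => //; exact: KV.
      by rewrite actM -e (actK act1 actM).
    - move=> p q t /C'P[pC np] /C'P[qC nq] nt; apply/C'P; split; first exact: Cconv nt.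
      case=> g Kg e; apply: nt; rewrite e -(actVK act1 actM g p) -(actVK act1 actM g q).
      apply: sE; apply: yext.
      + exact/Cinv/pC/KV.
      + exact/Cinv/qC/KV.
      + by move=> e'; apply: np; exists g; rewrite // -e' (actVK act1 actM).
      + by move=> e'; apply: nq; exists g; rewrite // -e' (actVK act1 actM).
  move/nP; rewrite -sizeC leqNgt => /negP; apply.
  rewrite size_filter -(count_predT C); apply: (count_ltn (x := y)) => //.
  by rewrite negbK; apply/asboolP; exists 1; rewrite ?act1.
have ext x p q : x \in C -> p \in C -> q \in C -> p <> x -> q <> x -> s x p q.
  move=> /orbC[g Kg ->] pC qC px qx.
  rewrite -(actVK act1 actM g p) -(actVK act1 actM g q); apply: sE; apply: yext.
  - exact/Cinv/pC/KV.
  - exact/Cinv/qC/KV.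
  - by move=> e'; apply: px; rewrite -e' (actVK act1 actM).
  - by move=> e'; apply: qx; rewrite -e' (actVK act1 actM).
exists y => g Kg; apply: contrapT => ne; apply: (adj_same_orbit act1 actM sG (x := y) (h := g)).
split=> [/esym//|t ty tgy]; apply: contrapT => nt.
have gyC : act g y \in C by exact: Cinv.
by apply: (nt); apply: ext => //; [exact: Cconv nt | exact/nesym | exact/nesym].
Qed.
End FixedPoint.

Section OuterAction.
Variables (G : groupType) (X : choiceType) (act : G -> X -> X).
Hypotheses (act1 : forall x, act 1 x = x)
  (actM : forall g h x, act (g * h) x = act g (act h x)).
Hypothesis fin_stab : forall x, fin_pred (fun g => act g x = x).
Variable s0 : side X.
Hypothesis s0G : good act s0.
Hypothesis separated : forall x y, x <> y -> exists g, act g x = x /\ act g y <> y.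
Implicit Types (s : side X) (x y z t : X) (g h : G) (phi psi : aut G).

Lemma stab_inj x y : (forall g, act g x = x -> act g y = y) -> x = y.
Proof.
by move=> xy; apply: contrapT => /separated[g [gx gy]]; apply/gy/xy.
Qed.

(* Point stabilizers are the maximal finite subgroups, so automorphisms permute
   them. *)
Lemma theta_exists phi x : exists y, forall g, act g x = x <-> act (phi g) y = y.
Proof.
have image psi u : exists y, forall g, act g u = u -> act (psi g) y = y.
  have [l lP] := fin_stab u.
  have [] := @finite_subgroup_fixes _ _ _ act1 actM s0 s0G
    (fun g => exists2 h, act h u = u & g = psi h).
  - by exists (map psi l) => g [h hu ->]; exact/map_f/lP.
  - by exists 1; rewrite ?act1 ?aut1E.
  - move=> g h [g' g'u ->] [h' h'u ->]; exists (g' * h'); last by rewrite autM.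
    by rewrite actM h'u.
  - move=> g [g' g'u ->]; exists g'^-1; last by rewrite autV.
    by rewrite -{1}g'u (actK act1 actM).
  - exact: u.
  by move=> y yP; exists y => g gu; apply: yP; exists g.
have [y yP] := image phi x; have [z zP] := image (aut_inv phi) y.
have xz : x = z.
  by apply: stab_inj => g /yP/zP; rewrite aut_invK.
exists y => g; split; first exact: yP.
by move/zP; rewrite aut_invK -xz.
Qed.

Definition theta phi x : X := projT1 (cid (theta_exists phi x)).

Lemma thetaP phi x g : act g x = x <-> act (phi g) (theta phi x) = theta phi x.
Proof. by rewrite /theta; case: cid => y /=. Qed.

Lemma theta_uniq phi x y : (forall g, act g x = x -> act (phi g) y = y) -> theta phi x = y.
Proof.
move=> xy; apply: stab_inj => g; rewrite -(aut_invVK phi g).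
by move/(thetaP phi x _)/xy.
Qed.

Lemma theta_act phi g x : theta phi (act g x) = act (phi g) (theta phi x).
Proof.
apply: theta_uniq => h hgx.
have /(thetaP phi) : act (g^-1 * h * g) x = x by rewrite !actM hgx (actK act1 actM).
rewrite !autM autV !actM => e.
by rewrite -{2}e (actVK act1 actM).
Qed.

Lemma theta_comp phi psi x : theta (phi * psi) x = theta phi (theta psi x).
Proof. by apply: theta_uniq => g /(thetaP psi)/(thetaP phi). Qed.

Lemma theta_inn a phi x : (forall g, phi g = g ^ a) -> theta phi x = act a^-1 x.
Proof.
move=> phiE; apply: theta_uniq => g gx.
by rewrite phiE conjgE !actM (actVK act1 actM) gx.
Qed.

Lemma theta1 x : theta 1 x = x.
Proof. exact: theta_uniq. Qed.

Lemma thetaK phi : cancel (theta phi) (theta phi^-1).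
Proof. by move=> x; rewrite -theta_comp mulVg theta1. Qed.

Lemma thetaKV phi : cancel (theta phi^-1) (theta phi).
Proof. by move=> x; rewrite -theta_comp mulgV theta1. Qed.

Definition transport phi s : side X := pull (theta phi^-1) s.

Lemma transport_good phi s : good act s -> good act (transport phi s).
Proof.
exact: (pull_good (thetaKV phi) (thetaK phi) (theta_act phi^-1)).
Qed.

Local Notation structure := (structure act).

Definition out_act (x : out G) (a : structure) : structure :=
  Sub (transport (repr x) (val a)) (asboolT (transport_good (repr x) (structure_good a))).

Local Open Scope quotient_scope.

(* Inner automorphisms act trivially on structures, which are [G]-invariant. *)
Lemma transport_inn phi psi s : good act s -> phi^-1 * psi \in @inn G ->
  transport phi s = transport psi s.
Proof.
move=> sG /innP[a aP]; apply/funext => x; apply/funext => y; apply/funext => z.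
rewrite /transport /pull.
have e t : theta phi^-1 t = act a^-1 (theta psi^-1 t).
  by rewrite -(theta_inn _ aP) theta_comp thetaKV.
rewrite !e; apply/propext; exact: (side_act act1 actM (good_equiv sG)).
Qed.

Lemma out_act_pi phi a : val (out_act (\pi_(out G) phi) a) = transport phi (val a).
Proof.
rewrite /= ; apply: transport_inn; first exact: structure_good.
exact: (quotient_repr (@inn_normal G)).
Qed.

Lemma out_act1 a : out_act 1 a = a.
Proof.
apply: val_inj; have -> : 1 = \pi_(out G) 1 by [].
rewrite out_act_pi /transport; apply/funext => x; apply/funext => y; apply/funext => z.
by rewrite /pull invg1 !theta1.
Qed.

Lemma out_actM p q a : out_act (p * q) a = out_act p (out_act q a).
Proof.
apply: val_inj; have -> : p * q = \pi_(out G) (repr p * repr q) by [].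
rewrite out_act_pi /= /transport /pull.
apply/funext => x; apply/funext => y; apply/funext => z.
by rewrite invgM !theta_comp.
Qed.

Lemma out_act_finer p a b : finer (out_act p a) (out_act p b) = finer a b.
Proof.
have mono q c d : finer c d -> finer (out_act q c) (out_act q d).
  case/andP=> cd /asboolP h; apply/andP; split; last first.
    by apply/asboolP => x y z; exact: h.
  apply: contraNneq cd => e; apply/eqP.
  by rewrite -(out_act1 c) -(out_act1 d) -(mulVg q) !out_actM e.
apply/idP/idP; last exact: mono.
move/(mono p^-1); by rewrite -!out_actM mulVg !out_act1.
Qed.

End OuterAction.

Lemma card_pred_leq (T : choiceType) (P : T -> Prop) (l : seq T) :
  (forall x, P x -> x \in l) -> (card_pred P <= size l)%N.
Proof.
move=> lP; have fP : fin_pred P by exists l.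
have [l' [ul' l'P]] := fin_pred_seq fP; rewrite (card_predE ul' l'P).
by apply: uniq_leq_size => // x /l'P/lP.
Qed.

Lemma card_pred_geq (T : choiceType) (P : T -> Prop) (l : seq T) : fin_pred P ->
  uniq l -> (forall x, x \in l -> P x) -> (size l <= card_pred P)%N.
Proof.
move=> fP ul lP; have [l' [ul' l'P]] := fin_pred_seq fP; rewrite (card_predE ul' l'P).
by apply: uniq_leq_size => // x /lP/l'P.
Qed.

(** * Chains of tree structures *)

Section ChainBound.
Variables (G : groupType) (X : choiceType) (act : G -> X -> X).
Hypotheses (act1 : forall x, act 1 x = x)
  (actM : forall g h x, act (g * h) x = act g (act h x)).
Implicit Types (s : side X) (x y z t : X) (g h : G) (S : seq X).

(** The union of the directions at [x] in one orbit of the stabilizer of [x]: an edge of the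
    quotient graph of groups at the image of [x]. *)
Definition flag_of s x y : point_set X :=
  fun z => z <> x /\ exists g, act g x = x /\ s x y (act g z).

Definition flag s x : point_set X -> Prop := fun A => exists2 y, y <> x & A = flag_of s x y.

Section OneStructure.
Variable s : side X.
Hypothesis sG : good act s.
Let sT := good_tree sG.
Let sE := good_equiv sG.

Lemma flag_of_self x y : y <> x -> flag_of s x y y.
Proof. by move=> yx; split=> //; exists 1; rewrite !act1; split=> //; exact: (side_refl sT). Qed.

Lemma flag_of_eq x y z g : y <> x -> z <> x -> act g x = x -> s x y (act g z) ->
  flag_of s x y = flag_of s x z.
Proof.
move=> yx zx gx syz; apply: point_set_eq => t; split=> -[tx [h [hx st]]]; split=> //.
  exists (g^-1 * h); split; first by rewrite actM hx -{1}gx (actK act1 actM).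
  apply: (side_trans sT (z := act g^-1 y)).
    by have := sE g^-1 (side_sym sT syz); rewrite (actK act1 actM) -{1}gx (actK act1 actM).
  by have := sE g^-1 st; rewrite -actM -{1}gx (actK act1 actM).
exists (g * h); split; first by rewrite actM hx.
apply: (side_trans sT) syz _.
by have := sE g st; rewrite gx -actM.
Qed.

Lemma flag_of_dir x y z : y <> x -> z <> x -> s x y z -> flag_of s x y = flag_of s x z.
Proof. by move=> yx zx syz; apply: (flag_of_eq (g := 1)); rewrite ?act1. Qed.

Lemma flag_of_inv x y z : y <> x -> z <> x -> flag_of s x y = flag_of s x z ->
  exists g, act g x = x /\ s x y (act g z).
Proof. by move=> yx zx e; have := flag_of_self zx; rewrite -e => -[]. Qed.

Section Full.
Variable S : seq X.
Hypotheses (spS : spanning act s S) (fullS : full act s S).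

Lemma flag_full x A : x \in S -> flag s x A ->
  exists y, [/\ y \in S, adj s x y & A = flag_of s x y].
Proof.
move=> xS [y yx ->]; have xy : x <> y by exact/nesym.
have xa := next_adj sT xy; set a := next s x y in xa.
have [g [x0 [a0 [x0S a0S ex ea]]]] := fullS xa.
have e0 : x = x0 by apply: (spanning_orbit spS (g := g)) => //.
rewrite -{}e0 in ex.
have xa0 : adj s x a0.
  by have := adj_act act1 actM sE g^-1 xa; rewrite {1}ex ea !(actK act1 actM).
exists a0; split=> //; apply: (flag_of_eq (g := g)) => //.
- by case: xa0 => /nesym.
- by rewrite -ea; apply: (side_sym sT); exact: next_side.
Qed.

Lemma flag_fin x : x \in S -> fin_pred (flag s x).
Proof.
move=> xS; exists (map (flag_of s x) S) => A /(flag_full xS)[y [yS _ ->]].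
exact: map_f.
Qed.

(* Besides the direction of a root [r], every direction at [x] comes from a
   point of [S] whose geodesic to [r] starts with a step to [x]. *)
Lemma flag_sum r : r \in S ->
  (\sum_(x <- S) card_pred (flag s x) <= 2 * (size S).-1)%N.
Proof.
move=> rS; have uS := spanning_uniq spS.
have sizeS : count (fun w => w != r) S = (size S).-1.
  rewrite -(count_predC (pred1 r) S) count_uniq_mem // rS add1n /=.
  by apply: eq_count.
pose below x w := (w != r) && (next s w r == x).
apply: (@leq_trans (\sum_(x <- S) ((x != r) + count (below x) S))).
  rewrite !big_seq; apply: leq_sum => x xS.
  pose l := (if x != r then [:: flag_of s x r] else [::]) ++
    map (flag_of s x) (filter (below x) S).
  have -> : ((x != r) + count (below x) S = size l)%N.
    by rewrite size_cat size_map size_filter; case: (x != r).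
  apply: card_pred_leq => A /(flag_full xS)[y [yS xy ->]]; rewrite mem_cat.
  have [xr _] := xy.
  case: (pselect (r <> x /\ s x y r)) => [[rx syr]|nr].
    apply/orP; left; case: eqVneq => [/esym//|_]; rewrite inE; apply/eqP.
    by apply: flag_of_dir => //; exact/nesym.
  apply/orP; right; apply: map_f; rewrite mem_filter yS andbT.
  have nyr : ~ s x y r.
    move=> h; case: (pselect (r = x)) => [rx|rx]; last by apply: nr.
    by move: h; rewrite rx => /(side_sym sT)/(side_self sT)/esym.
  apply/andP; split; first by apply/eqP => yr; apply: nyr; rewrite yr; exact: (side_refl sT).
  by apply/eqP/esym/(next_uniq sT) => //; exact: adj_sym.
rewrite big_split /= mul2n -addnn; apply: leq_add.
  by rewrite -sizeS -big_mkcond /= sum1_count.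
rewrite -sizeS.
under eq_bigr do rewrite -sum1_count big_mkcond.
rewrite exchange_big /= -sum1_count [leqRHS]big_mkcond /=; apply: leq_sum => w _.
rewrite /below; case: (w != r) => /=; last by rewrite big1.
rewrite -big_mkcond /= sum1_count.
rewrite (eq_count (a2 := pred1 (next s w r))) => [|x]; last by rewrite /= eq_sym.
by rewrite count_uniq_mem // leq_b1.
Qed.

End Full.

End OneStructure.

Section Coarsening.
Variables s s' : side X.
Hypotheses (sG : good act s) (s'G : good act s').
Hypothesis sub : forall x y z, s x y z -> s' x y z.
Let sT := good_tree sG.
Let s'T := good_tree s'G.

Let coarse x (A : point_set X) : point_set X :=
  fun z => z <> x /\ exists y g, [/\ A y, act g x = x & s' x y (act g z)].

Lemma coarse_flag x y : y <> x -> coarse x (flag_of s x y) = flag_of s' x y.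
Proof.
move=> yx; apply: point_set_eq => z; split=> -[zx].
  case=> t [g [[tx [h [hx st]]] gx s't]]; split=> //; exists (h * g); split.
    by rewrite actM gx.
  rewrite actM; apply: (side_trans s'T) (sub st) _.
  by have := good_equiv s'G h s't; rewrite hx.
case=> g [gx s'y]; split=> //; exists y, g; split=> //.
exact: flag_of_self.
Qed.

Lemma flag_surj x A : flag s' x A -> exists B, flag s x B /\ coarse x B = A.
Proof.
by case=> y yx ->; exists (flag_of s x y); split; [exists y | exact: coarse_flag].
Qed.

Lemma coarse_flagP x B : flag s x B -> flag s' x (coarse x B).
Proof. by case=> y yx ->; exists y => //; exact: coarse_flag. Qed.

Lemma flag_fin_coarse x : fin_pred (flag s x) -> fin_pred (flag s' x).
Proof.
case=> l lP; exists (map (coarse x) l) => A /flag_surj[B [/lP Bl <-]].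
exact: map_f.
Qed.

Lemma flag_card_leq x : fin_pred (flag s x) ->
  (card_pred (flag s' x) <= card_pred (flag s x))%N.
Proof.
by move=> fx; apply: (card_surj_leq fx (@coarse_flagP x)) => A /flag_surj.
Qed.

(** Equal numbers make coarsening injective on flags, so two merged directions were already
    translates by some [g] fixing [x]; [good_stab] for [s'] shows that [g] fixes [c]. *)
Lemma flag_card_eq x : fin_pred (flag s x) ->
  card_pred (flag s' x) = card_pred (flag s x) -> forall y z, s' x y z -> s x y z.
Proof.
move=> fx e y z s'yz; apply: contrapT => n.
have inj := card_surj_inj fx (@coarse_flagP x) (@flag_surj x) e.
have xy : x <> y.
  move=> xy; apply: n; move: s'yz; rewrite -xy => /(side_self s'T) ->.
  exact: (side_refl sT).
have xz : x <> z.
  move=> xz; apply: n; move: s'yz; rewrite -xz => /(side_sym s'T)/(side_self s'T) ->.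
  exact: (side_refl sT).
have [yx zx] := (nesym xy, nesym xz).
have xc := next_adj sT xz; set c := next s x z in xc.
have sxcz : s x c z by exact: next_side.
have cx : c <> x by case: xc => /nesym.
have s'yc : s' x y c by apply: (side_trans s'T) s'yz _; exact/(side_sym s'T)/sub.
have /(flag_of_inv sG yx cx)[g [gx sgc]] : flag_of s x y = flag_of s x c.
  apply: inj; [by exists y | by exists c |].
  by rewrite !coarse_flag // (flag_of_dir s'G yx cx).
have gc : act g c = c.
  apply: (good_stab s'G (adj_sub sub xc) gx); apply: (side_trans s'T (z := y)).
    exact: (side_sym s'T).
  exact: sub.
by apply: n; apply: (side_trans sT) sxcz; rewrite -gc.
Qed.

End Coarsening.

Lemma transversal_perm s s' S S' : spanning act s S -> spanning act s' S' ->
  exists f, (forall x, exists g, f x = act g x) /\ perm_eq (map f S) S'.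
Proof.
move=> spS spS'.
pose P x y := y \in S' /\ exists g, y = act g x.
have ex x : exists y, P x y.
  have [g [y [yS e]]] := spanning_cover spS' x; exists y; split=> //.
  by exists g^-1; rewrite e (actK act1 actM).
pose f x := projT1 (cid (ex x)).
have fP x : P x (f x) by rewrite /f; case: cid.
have fS' x : f x \in S' by case: (fP x).
exists f; split; first by move=> x; case: (fP x).
apply: uniq_perm; last first.
- move=> y; apply/idP/idP => [/mapP[x _ ->]//|yS'].
  have [g [x [xS e]]] := spanning_cover spS y; apply/mapP; exists x => //.
  have [_ [h fx]] := fP x; apply/esym/(spanning_orbit spS' (g := h * g^-1)) => //.
  by rewrite actM e (actK act1 actM).
- exact: spanning_uniq spS'.
rewrite map_inj_in_uniq ?(spanning_uniq spS) // => x y xS yS e.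
have [_ [g fx]] := fP x; have [_ [h fy]] := fP y.
apply/esym/(spanning_orbit spS (g := h^-1 * g)) => //.
by rewrite actM -fx e fy (actK act1 actM).
Qed.

Variables (valence : X -> nat) (s0 : side X) (S0 : seq X).
Hypothesis spS0 : spanning act s0 S0.
Hypothesis valence_act : forall g x, valence (act g x) = valence x.
Hypothesis valence_flags : forall s x, good act s -> exists l : seq X,
  [/\ size l = valence x, forall y, y \in l -> y <> x & uniq (map (flag_of s x) l)].
Hypothesis S0_neq0 : (0 < size S0)%N.

Theorem chain_size_bound (a : structure act) (c : seq (structure act)) :
  path (@finer _ _ act) a c ->
  (size (a :: c) + \sum_(x <- S0) valence x <= (2 * (size S0).-1).+1)%N.
Proof.
move=> ac.
have aG := structure_good a; have [S [spS _ fS]] := good_full act1 actM aG.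
have [f [fP fS0]] := transversal_perm spS spS0.
have -> : (\sum_(x <- S0) valence x = \sum_(x <- S) valence x)%N.
  rewrite -(perm_big _ fS0) big_map /=; apply: eq_bigr => x _.
  by have [g ->] := fP x.
have sizeS : size S = size S0 by rewrite -(perm_size fS0) size_map.
have [r rS] : exists r, r \in S.
  by case: (S) sizeS S0_neq0 => [<-//|r S' _ _]; exists r; rewrite mem_head.
(* The total number of flags over the transversal drops at each strict coarsening; it lies between
   the sum of the valences and the bound of [flag_sum]. *)
pose F (b : structure act) := (\sum_(x <- S) card_pred (flag (val b) x))%N.
suff main : (size c + \sum_(x <- S) valence x <= F a)%N.
  by rewrite addSn ltnS (leq_trans main) // -sizeS; exact: (flag_sum aG spS fS rS).
have fina x : x \in S -> fin_pred (flag (val a) x) by move=> xS; exact: (flag_fin aG spS fS xS).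
have cover := spanning_cover spS.
elim: c a {aG fS spS} ac fina => [|b c IH] a ac fina.
  rewrite /F !big_seq; apply: leq_sum => x xS.
  have [l [<- lx ul]] := valence_flags x (structure_good a).
  rewrite -(size_map (flag_of (val a) x)); apply: card_pred_geq => //; first exact: fina.
  by move=> A /mapP[y yl ->]; exists y => //; exact: lx.
move: ac => /= /andP[ab bc]; have sub := finer_sub ab.
have [aG bG] := (structure_good a, structure_good b).
have finb x : x \in S -> fin_pred (flag (val b) x).
  by move=> xS; apply: (flag_fin_coarse aG bG sub); exact: fina.
apply: leq_ltn_trans (IH b bc finb) _; rewrite ltnNge; apply/negP => leF.
have leq x : x \in S -> (card_pred (flag (val b) x) <= card_pred (flag (val a) x))%N.
  by move=> xS; apply: (flag_card_leq aG bG sub); exact: fina.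
have eqF : F b = F a.
  apply/eqP; rewrite eqn_leq leF andbT /F !big_seq; apply: leq_sum => x; exact: leq.
have eqx := sum_leq_eq leq eqF.
have [/eqP nab _] := andP ab; apply/nab/val_inj/side_eq => // x y z bxyz.
have [g [x0 [x0S ex]]] := cover x.
have := flag_card_eq aG bG sub (fina _ x0S) (eqx _ x0S).
move/(_ (act g^-1 y) (act g^-1 z)).
rewrite -(actK act1 actM g x0) -ex => h.
by apply/(side_act act1 actM (good_equiv aG) g^-1)/h/(good_equiv bG).
Qed.

End ChainBound.

(** * Rooted trees *)

Definition degree (V : finType) (e : rel V) u : nat := #|[set w | e u w]|.

Section RootedTree.
Variables (V : finType).

Record rooted (e : rel V) (r : V) (par : V -> V) : Prop := Rooted {
  par_root : par r = r;
  par_adj : forall v, v != r -> e v (par v);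
  par_edge : forall x y, e x y -> (x != r /\ y = par x) \/ (y != r /\ x = par y);
  par_reach : forall v, exists n, iter n par v = r;
  par_irr : irreflexive e;
  par_sym : symmetric e }.

Variables (e : rel V) (eirr : irreflexive e) (esym : symmetric e).

Let deleted x y : rel V := fun u v => e u v && ((u, v) \notin [:: (x, y); (y, x)]).

Lemma tree_bridge x y : acyclic_graph e -> e x y -> ~~ connect (deleted x y) x y.
Proof.
move=> acyc exy; apply/negP => /connectP[p0 /shortenP[p xp up _] ey].
have ep : path e x p by apply: sub_path xp => u v /andP[].
have /acyc : ucycle e (x :: p) by rewrite /ucycle /= rcons_path ep -ey esym exy.
case: p xp up ep ey => [|z [|//]] /=; first by move=> _ _ _ ex; rewrite ex eirr in exy.
by rewrite andbT => /andP[_ /negP nz] _ _ yz _; case: nz; rewrite yz mem_head.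
Qed.

(** The parent is a neighbour nearer to [r]. An edge joining no vertex to its parent could be
    deleted while both its ends stay connected to [r], against [tree_bridge]. *)
Lemma tree_rooted r : is_tree e -> exists par, rooted e r par.
Proof.
case=> conn acyc.
pose reach v n := `[< exists p, [/\ path e v p, last v p = r & size p = n] >].
have ex v : exists n, reach v n.
  by have /connectP[p ep er] := conn v r; exists (size p); apply/asboolP; exists p.
pose dist v := ex_minn (ex v).
have distP v : reach v (dist v) by rewrite /dist; case: ex_minnP.
have dist_min v n : reach v n -> (dist v <= n)%N by rewrite /dist; case: ex_minnP => k _; apply.
have exw v : exists w, v != r -> e v w && (dist w < dist v)%N.
  have /asboolP[[|w p] [/= pv lv sp]] := distP v.
    by exists v; rewrite lv eqxx.
  case/andP: pv => evw pw; exists w => _; rewrite evw -sp ltnS; apply: dist_min.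
  by apply/asboolP; exists p.
pose par v := if v == r then r else projT1 (cid (exw v)).
have parP v : v != r -> e v (par v) && (dist (par v) < dist v)%N.
  by move=> vr; rewrite /par ifN //; case: cid => w /= /(_ vr).
exists par; split=> //.
- by rewrite /par ifT.
- by move=> v /parP/andP[].
- move=> x y exy; apply: contrapT => n.
  have dsym : symmetric (deleted x y).
    by move=> u v; rewrite /deleted esym !inE !xpair_eqE; congr andb; rewrite orbC; congr (~~ (_ || _)); rewrite andbC.
  have toroot v : connect (deleted x y) v r.
    have [k] := ubnP (dist v); elim: k v => // k IH v ltk.
    case: (eqVneq v r) => [->//|vr]; have /andP[ev dv] := parP v vr.
    apply: connect_trans (connect1 _) (IH (par v) _); last exact: leq_trans dv ltk.
    rewrite /deleted ev !inE !xpair_eqE /=; apply/negP => /orP[] /andP[/eqP vx /eqP pv].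
      by apply: n; left; rewrite -vx.
    by apply: n; right; rewrite -vx.
  have := tree_bridge acyc exy; apply/negP/negPn.
  by apply: connect_trans (toroot x) _; rewrite (sym_connect_sym dsym).
move=> v; have [k] := ubnP (dist v); elim: k v => // k IH v ltk.
case: (eqVneq v r) => [->|vr]; first by exists 0%N.
have /andP[_ dv] := parP v vr; have [n <-] := IH (par v) (leq_trans dv ltk).
by exists n.+1; rewrite iterSr.
Qed.

End RootedTree.

Section Rooted.
Variables (V : finType) (e : rel V) (r : V) (par : V -> V).
Hypothesis T : rooted e r par.

Lemma par_ind (P : V -> Prop) : P r -> (forall v, v != r -> P (par v) -> P v) ->
  forall v, P v.
Proof.
move=> Pr PP v; have [n] := par_reach T v; elim: n v => [v /= ->//|n IH v].
rewrite iterSr => /IH Pv; case: (eqVneq v r) => [->//|vr]; exact: PP.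
Qed.

Lemma par_neq v : v != r -> par v != v.
Proof. by move=> vr; apply: contraTneq (par_adj T vr) => ->; rewrite (par_irr T). Qed.

Definition desc (w : V) : pred V := fun v => `[< exists n, iter n par v = w >].

Lemma desc_refl w : desc w w.
Proof. by apply/asboolP; exists 0%N. Qed.

Lemma desc_trans u v w : desc u v -> desc v w -> desc u w.
Proof.
move=> /asboolP[n <-] /asboolP[k <-]; apply/asboolP; exists (n + k)%N.
by rewrite iterD.
Qed.

Lemma desc_par u v : desc u v -> v != u -> desc u (par v).
Proof.
move=> /asboolP[[|n] /= e1]; first by rewrite e1 eqxx.
by move=> _; apply/asboolP; exists n; rewrite -iterSr.
Qed.

Lemma par_desc u v : desc u (par v) -> desc u v.
Proof. by move=> /asboolP[n en]; apply/asboolP; exists n.+1; rewrite iterSr. Qed.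

Lemma desc_root u : desc u r -> u = r.
Proof.
by move=> /asboolP[n <-]; elim: n => //= n ->; exact: par_root T.
Qed.

Lemma par_cycle v n : iter n.+1 par v = v -> v = r.
Proof.
move=> cyc; apply: (@desc_root v); have [k <-] := par_reach T v.
elim: k => [|k IH] /=; first exact: desc_refl.
case: (eqVneq (iter k par v) v) => [->|ne]; last exact: desc_par.
by apply/asboolP; exists n; rewrite -iterSr.
Qed.

Lemma desc_anti u v : desc u v -> desc v u -> u = v.
Proof.
move=> /asboolP[[|n] /= en] /asboolP[[|k] /= ek] //.
have vr : v = r by apply: (@par_cycle v (k + n.+1)); rewrite -addSn iterD /= en.
by rewrite -en vr -iterS; elim: n.+1 => //= m ->; rewrite (par_root T).
Qed.

Lemma desc_par_neq w v : w != r -> desc w v -> v != par w.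
Proof.
move=> wr wv; apply: contraNneq wr => vw; rewrite {}vw in wv.
have : desc (par w) w by apply: par_desc; exact: desc_refl.
move=> /(desc_anti wv) e1; case: (eqVneq w r) => // wr; by have := par_neq wr; rewrite -e1 eqxx.
Qed.

Lemma desc_boundary w x y : e x y -> desc w x -> ~~ desc w y -> x = w /\ y = par w.
Proof.
case/(par_edge T) => -[nr ->] dx ndy.
  case: (eqVneq x w) => [->//|xw]; case/negP: ndy; exact: desc_par.
by case/negP: ndy; apply: par_desc.
Qed.

End Rooted.

Lemma val_ZpD n (a b : 'Z_n) : (1 < n)%N -> (a + b)%R = ((a + b) %% n)%N :> nat.
Proof. by move=> n1 /=; congr (_ %% _)%N; exact: Zp_cast. Qed.

(** * Graph products of cyclic groups *)

Section GraphProduct.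
Variables (V : finType) (e : rel V) (m : V -> nat).
Hypotheses (m_gt1 : forall v, (1 < m v)%N) (e_sym : symmetric e).
Local Notation W := (graph_product e m).
Implicit Types (g h : W) (u v w : V).

Let R := graph_product_rel e m.

Definition gp_word (l : word V) : W := \pi_(presented R)%qT l.
Definition gen v : W := gp_word [:: (v, false)].

Lemma gp_word_cat (k l : word V) : gp_word (k ++ l) = gp_word k * gp_word l.
Proof.
apply/esym; apply/presented_eq.
by apply: wc_cat; exact: presented_repr.
Qed.

Lemma gp_word_inv v : gp_word [:: (v, true)] = (gen v)^-1.
Proof.
apply: (@mulgI _ (gen v)); rewrite mulgV -gp_word_cat.
by apply/presented_eq; exact: (wc_cancel _ (v, false)).
Qed.

Lemma gen_order v : gen v ^+ m v = 1.
Proof.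
have h n : gen v ^+ n = gp_word (nseq n (v, false)).
  by elim: n => // n IH; rewrite expgS IH -gp_word_cat.
by rewrite h; apply/presented_eq/wc_rel/gp_order.
Qed.

Lemma gen_comm v w : e v w -> gen v * gen w = gen w * gen v.
Proof.
by move=> vw; rewrite -!gp_word_cat; apply/presented_eq/wc_rel/gp_comm.
Qed.

Lemma gp_ind (P : W -> Prop) : P 1 -> (forall g v, P g -> P (g * gen v)) -> forall g, P g.
Proof.
move=> P1 PP g; have Pn v n h : P h -> P (h * gen v ^+ n).
  by move=> Ph; elim: n => [|n IH]; rewrite ?mulg1 // expgSr mulgA; exact: PP.
rewrite -[g]reprK; elim/last_ind: (repr g) => [//|l [v b] IH].
rewrite -cats1 -/(gp_word _) gp_word_cat; case: b; last exact: PP.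
rewrite gp_word_inv; have -> : (gen v)^-1 = gen v ^+ (m v).-1; last exact: Pn.
apply: (@mulgI _ (gen v)); rewrite mulgV -expgS prednK ?gen_order //.
exact: ltnW.
Qed.

Section Run.
Variables (A : Type) (step : V -> A -> A).
Hypotheses (step_order : forall v a, iter (m v) (step v) a = a)
  (step_comm : forall v w a, e v w -> step v (step w a) = step w (step v a)).

Let stepb (a : A) (l : V * bool) := iter (if l.2 then (m l.1).-1 else 1%N) (step l.1) a.

Let stepK v a : iter (m v).-1 (step v) (step v a) = a.
Proof. by rewrite -iterSr prednK ?step_order // ltnW. Qed.

Let stepKV v a : step v (iter (m v).-1 (step v) a) = a.
Proof. by rewrite -iterS prednK ?step_order // ltnW. Qed.

Let run_cong (k l : word V) : word_cong R k l -> forall a, foldl stepb a k = foldl stepb a l.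
Proof.
elim=> {k l} [_ _ [v a|v w vw a]|[v b] a|k k' l l' _ IHk _ IHl a|l a|k l _ IH a|k l n _ IH1 _ IH2 a].
- rewrite -[RHS](step_order v) /=; elim: (m v) a => //= n IHn b.
  by rewrite IHn -iterSr.
- exact/esym/step_comm.
- by rewrite /= /stepb /=; case: b => /=; rewrite ?stepK ?stepKV.
- by rewrite !foldl_cat IHk IHl.
- by [].
- by rewrite IH.
- by rewrite IH1 IH2.
Qed.

(** The universal property as an action on an arbitrary set; it yields homomorphisms, exponent sums
    and crossing counts alike. *)
Lemma gp_run : exists run : W -> A -> A, (forall a, run 1 a = a) /\
  forall g v a, run (g * gen v) a = step v (run g a).
Proof.
exists (fun g a => foldl stepb a (repr g)); split=> [a|g v a].
  by rewrite (run_cong (presented_repr R [::])).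
have -> : g * gen v = gp_word (repr g ++ [:: (v, false)]) by rewrite gp_word_cat /gp_word reprK.
by rewrite (run_cong (presented_repr R _)) foldl_cat.
Qed.

End Run.

Lemma gp_hom (K : groupType) (f : V -> K) : (forall v, f v ^+ m v = 1) ->
  (forall v w, e v w -> f v * f w = f w * f v) ->
  exists F : W -> K, {morph F : x y / x * y} /\ forall v, F (gen v) = f v.
Proof.
move=> fo fc; have [||run [run1 runM]] := @gp_run K (fun v a => a * f v).
- move=> v a; have h n : iter n (fun b => b * f v) a = a * f v ^+ n.
    by elim: n => [|n /= ->]; rewrite ?mulg1 // expgSr mulgA.
  by rewrite h fo mulg1.
- by move=> v w a vw; rewrite -!mulgA (fc v w vw).
exists (run^~ 1); split=> [x y|v]; last by rewrite -[gen v]mul1g runM run1 mul1g.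
by elim/gp_ind: y => [|y v IH]; rewrite ?mulg1 ?run1 ?mulg1 // mulgA !runM IH mulgA.
Qed.

Lemma hom1 (G K : groupType) (F : G -> K) : {morph F : x y / x * y} -> F 1 = 1.
Proof. by move=> FM; apply: (@mulgI _ (F 1)); rewrite -FM !mulg1. Qed.

Lemma gp_hom_ext (K : groupType) (F F' : W -> K) : {morph F : x y / x * y} ->
  {morph F' : x y / x * y} -> (forall v, F (gen v) = F' (gen v)) -> F =1 F'.
Proof.
move=> FM F'M FF'; elim/gp_ind => [|g v IH]; first by rewrite !hom1.
by rewrite FM F'M IH FF'.
Qed.

(** ** Exponent sums *)

Local Open Scope ring_scope.

Lemma eps_exists v : exists f : W -> 'Z_(m v),
  f 1%g = 0 /\ forall g u, f (g * gen u)%g = f g + (u == v)%:R.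
Proof.
have [||run [run1 runM]] := @gp_run 'Z_(m v) (fun u a => a + (u == v)%:R).
- move=> u a; have h n : iter n (fun b : 'Z_(m v) => b + (u == v)%:R) a = a + (u == v)%:R *+ n.
    by elim: n => [|n /= ->]; rewrite ?mulr0n ?GRing.addr0 // GRing.mulrSr GRing.addrA.
  rewrite h; case: eqP => [->|_]; last by rewrite GRing.mul0rn GRing.addr0.
  by rewrite pchar_Zp // GRing.addr0.
- by move=> u w a _; rewrite GRing.addrAC.
by exists (run^~ 0).
Qed.

Definition eps v : W -> 'Z_(m v) := projT1 (cid (eps_exists v)).

Lemma eps1 v : eps v 1%g = 0.
Proof. by rewrite /eps; case: cid => f []. Qed.

Lemma epsM_gen v g u : eps v (g * gen u)%g = eps v g + (u == v)%:R.
Proof. by rewrite /eps; case: cid => f []. Qed.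

Lemma epsM v g h : eps v (g * h)%g = eps v g + eps v h.
Proof.
elim/gp_ind: h => [|h u IH]; first by rewrite mulg1 eps1 GRing.addr0.
by rewrite mulgA !epsM_gen IH GRing.addrA.
Qed.

Lemma eps_gen v u : eps v (gen u) = (u == v)%:R.
Proof. by rewrite -[gen u]mul1g epsM_gen eps1 GRing.add0r. Qed.

Lemma epsV v g : eps v g^-1%g = - eps v g.
Proof. by apply: (@GRing.addrI _ (eps v g)); rewrite -epsM mulgV eps1 GRing.addrN. Qed.

Lemma epsX v g n : eps v (g ^+ n)%g = eps v g *+ n.
Proof.
elim: n => [|n IH]; first by rewrite expg0 eps1.
by rewrite expgS epsM IH GRing.mulrS.
Qed.

Lemma epsJ v g h : eps v (g ^ h)%g = eps v g.
Proof. by rewrite conjgE !epsM epsV GRing.addrC GRing.addrK. Qed.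

(** Since additive maps to cyclic groups factor through the exponent sums, automorphisms preserve
    the common kernel of these sums. *)
Lemma additive_eps (n : nat) (d : W -> 'Z_n) : {morph d : x y / (x * y)%g >-> x + y} ->
  forall g, d g = \sum_v d (gen v) *+ eps v g.
Proof.
move=> dM; have d1 : d 1%g = 0.
  by apply: (@GRing.addrI _ (d 1%g)); rewrite -dM mulg1 GRing.addr0.
have dX g k : d (g ^+ k)%g = d g *+ k.
  by elim: k => [|k IH]; rewrite ?expg0 // expgS dM IH GRing.mulrS.
elim/gp_ind => [|g u IH].
  by rewrite d1 big1 // => v _; rewrite eps1 GRing.mulr0n.
rewrite dM IH (bigD1 u) //= [RHS](bigD1 u) //= epsM_gen eqxx.
rewrite GRing.addrAC; congr (_ + _); last first.
  by apply: eq_bigr => v vu; rewrite epsM_gen eq_sym (negPf vu) GRing.addr0.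
rewrite -GRing.mulrSr.
have mod k : d (gen u) *+ (k %% m u) = d (gen u) *+ k.
  by rewrite {2}(divn_eq k (m u)) GRing.mulrnDr mulnC GRing.mulrnA -(dX _ (m u)) gen_order d1 GRing.mul0rn GRing.add0r.
rewrite -[LHS]mod -[RHS]mod; congr (_ *+ _).
have e1 : (((true : nat)%:R : 'Z_(m u)) : nat) = 1%N by rewrite /= modn_small.
by rewrite val_ZpD // e1 modn_mod addn1.
Qed.

(** ** Vertex and edge subgroups *)

Local Open Scope group_scope.

Lemma gen_mod v n : gen v ^+ (n %% m v) = gen v ^+ n.
Proof. by rewrite {2}(divn_eq n (m v)) expgnDr mulnC expgnA gen_order expg1n mul1g. Qed.

Lemma val_eps_gen v n : (eps v (gen v ^+ n) : nat) = (n %% m v)%N.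
Proof. by rewrite epsX eps_gen eqxx val_Zp_nat. Qed.

Lemma eps_genX u v n : u != v -> eps v (gen u ^+ n) = 0%R.
Proof. by move=> uv; rewrite epsX eps_gen (negPf uv) GRing.mul0rn. Qed.

Lemma gen_epsM v g h : gen v ^+ eps v (g * h) = gen v ^+ eps v g * gen v ^+ eps v h.
Proof.
by rewrite epsM val_ZpD // gen_mod expgnDr.
Qed.

(** Membership in the subgroup generated by [u], expressed by the exponents of [g] itself: elements
    of vertex and edge subgroups are determined by their exponent sums. *)
Definition vert u g := g = gen u ^+ eps u g.
Definition edge u w g := g = gen u ^+ eps u g * gen w ^+ eps w g.

Lemma vertX u n : vert u (gen u ^+ n).
Proof. by rewrite /vert val_eps_gen gen_mod. Qed.

Lemma vert1 u : vert u 1. Proof. by rewrite /vert eps1 expg0. Qed.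

Lemma vertM u g h : vert u g -> vert u h -> vert u (g * h).
Proof. by rewrite /vert gen_epsM => <- <-. Qed.

Lemma vertV u g : vert u g -> vert u g^-1.
Proof.
move=> ug; rewrite /vert; apply: (@mulgI _ g); rewrite mulgV {1}ug -gen_epsM mulgV.
by rewrite eps1.
Qed.

Lemma vert_eps u v g : vert u g -> u != v -> eps v g = 0%R.
Proof. by move=> -> uv; rewrite eps_genX. Qed.

Lemma gen_Zp0 v n : gen v ^+ (0%R : 'Z_n) = 1.
Proof. by []. Qed.

Lemma edgeI u w i j : u != w -> edge u w (gen u ^+ i * gen w ^+ j).
Proof.
move=> uw; have wu : w != u by rewrite eq_sym.
by rewrite /edge !gen_epsM (eps_genX _ uw) (eps_genX _ wu) !gen_Zp0 mulg1 mul1g !val_eps_gen !gen_mod.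
Qed.

Lemma edge_eps u w v g : edge u w g -> v != u -> v != w -> eps v g = 0%R.
Proof.
by move=> -> vu vw; rewrite epsM !eps_genX ?(eq_sym _ v) // GRing.addr0.
Qed.

Lemma edge_vert u w g : edge u w g -> eps w g = 0%R -> vert u g.
Proof. by rewrite /edge => + e0; rewrite e0 gen_Zp0 mulg1. Qed.

Lemma edge_inj u w g h : edge u w g -> edge u w h -> eps u g = eps u h ->
  eps w g = eps w h -> g = h.
Proof. by move=> eg eh eu ew; rewrite [LHS]eg [RHS]eh eu ew. Qed.

Lemma edge_fin u w : exists l : seq W, forall g, edge u w g -> g \in l.
Proof.
exists [seq gen u ^+ i * gen w ^+ j | i <- iota 0 (m u), j <- iota 0 (m w)] => g ->.
have lt v : (eps v g < m v)%N by rewrite -{2}(Zp_cast (m_gt1 v)).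
by apply/allpairsP; exists (eps u g : nat, eps w g : nat); rewrite !mem_iota /= !lt.
Qed.

Section Edge.
Variables u w : V.
Hypothesis uw : e u w.
Hypothesis unw : u != w.

Lemma gen_commX i j : gen u ^+ i * gen w ^+ j = gen w ^+ j * gen u ^+ i.
Proof. exact/commuteX2/gen_comm. Qed.

Lemma edge_sym g : edge u w g -> edge w u g.
Proof. by rewrite /edge gen_commX. Qed.

Lemma edge1 : edge u w 1.
Proof. by rewrite /edge !eps1 !gen_Zp0 mulg1. Qed.

Lemma edgeM g h : edge u w g -> edge u w h -> edge u w (g * h).
Proof.
by move=> eg eh; rewrite /edge !gen_epsM -mulgA (mulgA (gen u ^+ eps u h)) gen_commX -!mulgA -eh mulgA -eg.
Qed.

Lemma edge_comm g h : edge u w g -> edge u w h -> g * h = h * g.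
Proof.
move=> eg eh; apply: (edge_inj (edgeM eg eh) (edgeM eh eg)).
  by rewrite !epsM GRing.addrC.
by rewrite !epsM GRing.addrC.
Qed.

Lemma edgeV g : edge u w g -> edge u w g^-1.
Proof.
move=> eg; pose h := gen u ^+ eps u g^-1 * gen w ^+ eps w g^-1.
have eh : edge u w h by exact: edgeI.
have gh : g * h = 1.
  rewrite {1}eg /h -mulgA (mulgA (gen w ^+ _)) -gen_commX -!mulgA -gen_epsM mulgV eps1.
  by rewrite gen_Zp0 mulg1 -gen_epsM mulgV eps1.
by have -> : g^-1 = h by apply: (@mulgI _ g); rewrite mulgV gh.
Qed.

Lemma vert_edge g : vert u g -> edge u w g.
Proof. by move=> eg; rewrite /edge (vert_eps eg unw) gen_Zp0 mulg1. Qed.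

Lemma vert_edger g : vert w g -> edge u w g.
Proof. by move=> eg; rewrite /edge (vert_eps eg (u := w)) ?(eq_sym w) // gen_Zp0 mul1g. Qed.

End Edge.

(** ** Functions counting crossings *)

(* [chi] is a 1-cochain integrated along words: multiplying by a generator in
   [T] adds the difference of the indicator of [P]. The hypothesis is what the
   commutation relations between [T] and its complement require. *)
Lemma crossing_function (P : W -> Prop) (T : pred V) :
  (forall v w, e v w -> T v -> ~~ T w -> forall g, P (g * gen w) <-> P g) ->
  exists chi : W -> int, chi 1 = 0%R /\ forall g v, chi (g * gen v) =
    (chi g + (T v && `[< P g >] : nat)%:Z - (T v && `[< P (g * gen v)%g >] : nat)%:Z)%R.
Proof.
move=> PT; pose step v (a : W * int) := (a.1 * gen v,
  (a.2 + (T v && `[< P a.1 >] : nat)%:Z - (T v && `[< P (a.1 * gen v)%g >] : nat)%:Z)%R).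
have [||run [run1 runM]] := @gp_run _ step.
- move=> v [g k]; have h n : iter n (step v) (g, k) = (g * gen v ^+ n,
     (k + (T v && `[< P g >] : nat)%:Z - (T v && `[< P (g * gen v ^+ n)%g >] : nat)%:Z)%R).
    elim: n => [|n IH]; first by rewrite expg0 mulg1 GRing.addrK.
    rewrite iterS IH /step /= expgSr mulgA; congr pair.
    by rewrite GRing.addrNK.
  by rewrite h gen_order mulg1 GRing.addrK.
- move=> v w [g k] vw; rewrite /step /=; congr pair; first by rewrite -!mulgA (gen_comm vw).
  rewrite -!mulgA (gen_comm vw) !mulgA.
  have tw := PT _ _ vw; have wv := PT _ _ (etrans (e_sym w v) vw).
  have eqA (A B : Prop) : (A <-> B) -> `[< A >] = `[< B >].
    by move=> AB; apply/asboolP/asboolP => /AB.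
  case: (boolP (T v)) tw wv => tv; case: (boolP (T w)) => tw //= h1 h2.
  + lia.
  + have := eqA _ _ (h1 isT isT g); have := eqA _ _ (h1 isT isT (g * gen v)).
    rewrite -!mulgA (gen_comm vw) => -> ->; lia.
  + have := eqA _ _ (h2 isT isT g); have := eqA _ _ (h2 isT isT (g * gen w)).
    rewrite -!mulgA -(gen_comm vw) => -> ->; lia.
have run1E g : (run g (1, 0%R)).1 = g.
  by elim/gp_ind: g => [|g v IH]; rewrite ?run1 // runM /= IH.
exists (fun g => (run g (1, 0%R)).2); split=> [|g v]; first by rewrite run1.
by rewrite runM /= run1E.
Qed.

End GraphProduct.

(** * The tree structure on cosets of edge subgroups *)

Section CosetTree.
Variables (V : finType) (e : rel V) (m : V -> nat) (r : V) (par : V -> V).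
Hypotheses (m_gt1 : forall v, (1 < m v)%N) (T : rooted e r par).
Variable c0 : V.
Hypothesis c0r : c0 != r.
Local Notation W := (graph_product e m).
Local Notation gen := (gen e m).
Local Notation vert := (vert m_gt1).
Local Notation edge := (edge m_gt1).
Let e_sym : symmetric e := par_sym T.
Implicit Types (u v w : V) (g h k : W).

Lemma edge_neq u w : e u w -> u != w.
Proof. by move=> uw; apply: contraTneq uw => ->; rewrite (par_irr T). Qed.

Lemma eEdgeM u w g h : e u w -> edge u w g -> edge u w h -> edge u w (g * h).
Proof. move=> uw; exact: (edgeM uw). Qed.

Lemma eEdgeV u w g : e u w -> edge u w g -> edge u w g^-1.
Proof. by move=> uw; apply: edgeV => //; exact: edge_neq. Qed.

Lemma eEdge_sym u w g : e u w -> edge u w g -> edge w u g.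
Proof. by move=> uw; exact: edge_sym. Qed.

Lemma eVert_edge u w g : e u w -> vert u g -> edge u w g.
Proof. by move=> uw; apply: vert_edge; exact: edge_neq. Qed.

Definition coset u w g : point_set W := fun h => edge u w (g^-1 * h).

(* Two left cosets of edge subgroups are [near] when they contain a common left
   coset of a vertex subgroup. *)
Definition vertex : Type := {A : point_set W |
  `[< exists u w g, e u w /\ A = coset u w g >]}.
HB.instance Definition _ := SubChoice.on vertex.
Implicit Types x y z t : vertex.

Lemma coset_in u w g : e u w -> `[< exists u' w' g', e u' w' /\ coset u w g = coset u' w' g' >].
Proof. by move=> uw; apply/asboolP; exists u, w, g. Qed.

Definition base_vertex : vertex := Sub (coset c0 (par c0) 1) (coset_in 1 (par_adj T c0r)).

(* A junk vertex unless [u] and [w] are adjacent. *)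
Definition pt u w g : vertex := insubd base_vertex (coset u w g).

Lemma val_pt u w g : e u w -> val (pt u w g) = coset u w g.
Proof. by move=> uw; rewrite insubdK //; exact: coset_in. Qed.

Lemma ptP x : exists u w g, e u w /\ x = pt u w g.
Proof.
have /asboolP[u [w [g [uw xE]]]] := valP x; exists u, w, g; split=> //.
by apply: val_inj; rewrite val_pt.
Qed.

Lemma pt_eq u w g h : e u w -> edge u w (g^-1 * h) -> pt u w g = pt u w h.
Proof.
move=> uw gh; apply: val_inj; rewrite !val_pt //; apply: point_set_eq => k; split; rewrite /coset => ek.
  have -> : h^-1 * k = (g^-1 * h)^-1 * (g^-1 * k) by rewrite invgM invgK -mulgA mulVKg.
  by apply: eEdgeM => //; exact: eEdgeV.
have -> : g^-1 * k = (g^-1 * h) * (h^-1 * k) by rewrite -mulgA mulVKg.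
exact: eEdgeM.
Qed.

Lemma pt_swap u w g : e u w -> pt u w g = pt w u g.
Proof.
move=> uw; have wu : e w u by rewrite e_sym.
by apply: val_inj; rewrite !val_pt //; apply: point_set_eq => k; split; exact: eEdge_sym.
Qed.

Lemma vert_gen u : vert u (gen u).
Proof. by have := vertX e m_gt1 u 1; rewrite expg1. Qed.

Lemma edge_gen u w v : edge u w (gen v) -> v = u \/ v = w.
Proof.
move=> ev; case: (eqVneq v u) => [|vu]; first by left.
case: (eqVneq v w) => [|vw]; first by right.
have := edge_eps ev vu vw; rewrite eps_gen eqxx => /(congr1 (@nat_of_ord _)).
by rewrite /= modn_small.
Qed.

(** A coset remembers its edge, because [u] and [w] are the only vertices with generators in the
    subgroup. *)
Lemma pt_inj u w g u' w' g' : e u w -> e u' w' -> pt u w g = pt u' w' g' ->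
  edge u w (g^-1 * g') /\ ((u' = u /\ w' = w) \/ (u' = w /\ w' = u)).
Proof.
move=> uw u'w' /(congr1 val); rewrite !val_pt // => E.
have gg' : edge u w (g^-1 * g').
  have : coset u' w' g' g' by rewrite /coset mulVg; exact: edge1.
  by rewrite -E.
have mem v : edge u' w' (gen v) -> edge u w (gen v).
  move=> ev; have : coset u' w' g' (g' * gen v) by rewrite /coset mulKg.
  rewrite -E /coset mulgA => e2.
  have := eEdgeM uw (eEdgeV uw gg') e2; by rewrite mulKg.
have gu : edge u' w' (gen u') by apply: eVert_edge => //; exact: vert_gen.
have gw : edge u' w' (gen w').
  apply: eEdge_sym; first by rewrite e_sym.
  by apply: eVert_edge; [rewrite e_sym | exact: vert_gen].
have ne := edge_neq u'w'; split=> //.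
move: ne; case: (edge_gen (mem _ gu)) (edge_gen (mem _ gw)) => -> [] ->; rewrite ?eqxx //.
  by left.
by right.
Qed.

Lemma pt_eq_edge u w g h : e u w -> pt u w g = pt u w h -> edge u w (g^-1 * h).
Proof. by move=> uw /(pt_inj uw uw)[]. Qed.

(** ** The action by left translation *)

Definition act h x : vertex := insubd base_vertex (fun k => val x (h^-1 * k)).

Lemma act_pt h u w g : e u w -> act h (pt u w g) = pt u w (h * g).
Proof.
move=> uw; apply: val_inj; rewrite /act val_pt // val_pt //.
have -> : (fun k => coset u w g (h^-1 * k)) = coset u w (h * g).
  by apply: point_set_eq => k; rewrite /coset invgM mulgA.
by rewrite insubdK //; exact: coset_in.
Qed.

Lemma act1 x : act 1 x = x.
Proof. by have [u [w [g [uw ->]]]] := ptP x; rewrite act_pt // mul1g. Qed.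

Lemma actM g h x : act (g * h) x = act g (act h x).
Proof. by have [u [w [k [uw ->]]]] := ptP x; rewrite !act_pt // mulgA. Qed.

Lemma stabP u w g h : e u w -> act h (pt u w g) = pt u w g <-> edge u w (h ^ g).
Proof.
move=> uw; rewrite act_pt // conjgE; split=> [/esym/(pt_eq_edge uw)//|eh].
by apply/esym/pt_eq.
Qed.

Lemma fin_stab x : fin_pred (fun g => act g x = x).
Proof.
have [u [w [g [uw ->]]]] := ptP x; have [l lP] := edge_fin e m_gt1 u w.
exists [seq h ^ g^-1 | h <- l] => h /(stabP _ _ uw)/lP hl.
by apply/mapP; exists (h ^ g); rewrite ?conjgK.
Qed.

(** ** Walks *)

Definition near x y := exists u w w' g, [/\ e u w, e u w', x = pt u w g & y = pt u w' g].
Definition nearb : rel vertex := fun x y => `[< near x y >].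

Lemma near_sym x y : near x y -> near y x.
Proof. by case=> u [w [w' [g [uw uw' -> ->]]]]; exists u, w', w, g. Qed.

Lemma near_act h x y : near x y -> near (act h x) (act h y).
Proof.
case=> u [w [w' [g [uw uw' -> ->]]]]; exists u, w, w', (h * g).
by rewrite !act_pt.
Qed.

Definition avoids t x y := exists p, [/\ path nearb x p, last x p = y & t \notin x :: p].

Lemma avoids_refl t x : t <> x -> avoids t x x.
Proof. by move=> tx; exists [::]; split=> //; rewrite inE; apply/eqP. Qed.

Lemma avoids_trans t x y z : avoids t x y -> avoids t y z -> avoids t x z.
Proof.
case=> p [xp <- tp] [q [yq <- tq]]; exists (p ++ q); rewrite cat_path last_cat xp yq.
split=> //; move: tp tq; rewrite !inE mem_cat !negb_or => /andP[-> ->] /andP[_ ->].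
by [].
Qed.

Lemma avoids_near t x y : t <> x -> t <> y -> near x y -> avoids t x y.
Proof.
move=> tx ty xy; exists [:: y]; split=> //=; first by rewrite andbT; apply/asboolP.
by rewrite !inE negb_or; apply/andP; split; apply/eqP.
Qed.

Lemma avoids_ind t (P : vertex -> Prop) x y :
  (forall a b, t <> a -> t <> b -> near a b -> P a -> P b) ->
  avoids t x y -> P x -> P y.
Proof.
move=> PP [p [+ <-]]; elim: p x => [//|b p IH] x /= /andP[/asboolP xb bp] tp Px.
move: tp; rewrite inE negb_or => /andP[/eqP tx tbp].
have tb : t <> b by move: tbp; rewrite inE negb_or => /andP[/eqP].
by apply: IH bp tbp _; apply: PP Px.
Qed.

Lemma avoids_sym t x y : avoids t x y -> avoids t y x.
Proof.
move=> xy; have tx : t <> x by case: xy => p [_ _]; rewrite inE negb_or => /andP[/eqP].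
apply: (avoids_ind (P := fun b => avoids t b x) _ xy); last exact: avoids_refl.
move=> a b ta tb ab ax; apply: avoids_trans ax; exact/avoids_near/near_sym.
Qed.

Lemma avoids_neql t x y : avoids t x y -> t <> x.
Proof. by case=> p [_ _]; rewrite inE negb_or => /andP[/eqP]. Qed.

Lemma avoids_neqr t x y : avoids t x y -> t <> y.
Proof. by move/avoids_sym/avoids_neql. Qed.

Lemma avoids_act h t x y : avoids t x y -> avoids (act h t) (act h x) (act h y).
Proof.
move=> xy; apply: (avoids_ind (P := fun b => avoids (act h t) (act h x) (act h b)) _ xy).
  move=> a b ta tb ab xa; apply: avoids_trans xa _.
  by apply: avoids_near (near_act _ ab) => /(act_inj act1 actM).
by apply: avoids_refl => /(act_inj act1 actM); exact: avoids_neql xy.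
Qed.

Lemma root_edge : exists w, e r w.
Proof.
have : c0 != r -> exists w, e r w.
  elim/(par_ind T) : c0 => [|v vr IH _]; first by rewrite eqxx.
  case: (eqVneq (par v) r) => [pr|/IH//]; exists v.
  by rewrite e_sym -pr; exact: par_adj T v vr.
exact.
Qed.

(** Within one translate, walk up the tree to the root; multiplying by a generator preserves any
    coset of an edge subgroup that contains it. *)
Lemma connected x y : exists p, path nearb x p /\ last x p = y.
Proof.
pose lk x y := exists p, path nearb x p /\ last x p = y.
have lk_refl z : lk z z by exists [::].
have lk_trans a b c : lk a b -> lk b c -> lk a c.
  by case=> p [ap <-] [q [bq <-]]; exists (p ++ q); rewrite cat_path last_cat ap bq.
have lk_near a b : near a b -> lk a b.
  by move=> ab; exists [:: b]; rewrite /= andbT; split=> //; apply/asboolP.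
have lk_sym a b : lk a b -> lk b a.
  case=> p []; elim: p a => [a _ <-|c p IH a /= /andP[/asboolP/near_sym/lk_near ca] cp lb].
    exact: lk_refl.
  exact: lk_trans (IH _ cp lb) ca.
have [w0 rw0] := root_edge.
have toroot g v w : e v w -> lk (pt v w g) (pt r w0 g).
  elim/(par_ind T): v w => [w rw|v vr IH w vw]; first by apply: lk_near; exists r, w, w0, g.
  have vp := par_adj T vr; have pv : e (par v) v by rewrite e_sym.
  apply: lk_trans (IH v pv); rewrite -(pt_swap _ vp).
  by apply: lk_near; exists v, w, (par v), g.
have nb v : exists w, e v w.
  case: (eqVneq v r) => [->|vr]; first by exists w0.
  by exists (par v); exact: par_adj T v vr.
have base g : lk (pt r w0 g) (pt r w0 1).
  elim/(@gp_ind V e m m_gt1): g => [//|g v IH]; apply: (lk_trans) IH.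
  have [w vw] := nb v; apply: (lk_trans) (lk_sym _ _ (toroot (g * gen v) v w vw)) _.
  rewrite -(pt_eq (g := g)) //; first exact: toroot.
  by rewrite mulKg; apply: eVert_edge => //; exact: vert_gen.
have all z : lk z (pt r w0 1).
  have [u [w [g [uw ->]]]] := ptP z; exact: lk_trans (toroot g u w uw) (base g).
exact: lk_trans (all x) (lk_sym _ _ (all y)).
Qed.

Definition side0 : side vertex := fun t x y => (x = t /\ y = t) \/ avoids t x y.

Lemma side0_tree x y z : x <> y -> side0 x y z \/ side0 y x z.
Proof.
move=> xy; have [p0 [+ +]] := connected y z; move=> /shortenP[p yp up _] lz.
case: (boolP (x \in y :: p)) => [|nx]; last by left; right; exists p.
rewrite inE => /predU1P[//|xp]; right; right.
case/splitPr: xp yp up lz => p1 p2; rewrite cat_path last_cat /= => /and3P[_ _ xp2].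
by rewrite mem_cat negb_or => /andP[/andP[_ yp2] _] lz; exists p2.
Qed.

Lemma side0_tree_like : tree_like side0.
Proof.
split.
- move=> x y; case: (pselect (x = y)) => [->|xy]; first by left.
  by right; exact: avoids_refl.
- by move=> t x y [[-> ->]|xy]; [left | right; exact: avoids_sym].
- move=> t x y z [[-> ->]|xy] [[ty ->]|yz]; try by [left | right].
  + by have := avoids_neqr xy; rewrite ty.
  + by right; exact: avoids_trans yz.
- by move=> x y [[]|/avoids_neql].
- exact: side0_tree.
- move=> y z; have [p [yp lz]] := connected y z; exists (y :: p) => x nx.
  by apply/negPn/negP => xp; apply: nx; right; exists p.
Qed.

Lemma side0_equiv : equivariant act side0.
Proof.
by move=> g t x y [[-> ->]|xy]; [left | right; exact: avoids_act].
Qed.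

End CosetTree.

(** * The coset tree structure is good *)

Section CosetTreeGood.
Variables (V : finType) (e : rel V) (m : V -> nat) (r : V) (par : V -> V).
Hypotheses (m_gt1 : forall v, (1 < m v)%N) (T : rooted e r par).
Variable c0 : V.
Hypothesis c0r : c0 != r.
Local Notation W := (graph_product e m).
Local Notation gen := (gen e m).
Local Notation vert := (vert m_gt1).
Local Notation edge := (edge m_gt1).
Local Notation vertex := (vertex e m_gt1).
Local Notation pt := (pt m_gt1 T c0r).
Local Notation act := (@act V e m r par m_gt1 T c0 c0r).
Local Notation near := (@near V e m r par m_gt1 T c0 c0r).
Local Notation side0 := (@side0 V e m r par m_gt1 T c0 c0r).
Let e_sym : symmetric e := par_sym T.
Let act1 := act1 (m_gt1 := m_gt1) T c0r.
Let actM := actM (m_gt1 := m_gt1) T c0r.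
Let s0T := side0_tree_like m_gt1 T c0r.
Let gen_ind := @gp_ind V e m m_gt1.
Let s0E := @side0_equiv V e m r par m_gt1 T c0 c0r.
Implicit Types (u v w : V) (g h k : W) (x y z t : vertex).

Lemma edge_side u w : e u w -> exists D : pred V, [/\ D w, ~~ D u &
  forall v v', e v v' -> D v -> ~~ D v' -> v = w /\ v' = u].
Proof.
case/(par_edge T) => -[nr ->]; last first.
  exists (desc par w); split; first exact: desc_refl.
    by apply/negP => /(desc_par_neq T nr); rewrite eqxx.
  by move=> v v' vv' dv ndv'; have [-> ->] := desc_boundary T vv' dv ndv'.
exists (predC (desc par u)); split=> /=; rewrite ?negbK ?desc_refl //.
  by apply/negP => /(desc_par_neq T nr); rewrite eqxx.
move=> v v'; rewrite e_sym /= negbK => vv' ndv dv'.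
by have [-> ->] := desc_boundary T vv' dv' ndv.
Qed.

Lemma vert_mulgen u g : vert u (g * gen u) <-> vert u g.
Proof.
have vu : vert u (gen u) by exact: vert_gen.
split=> [h|h]; last exact: vertM.
by rewrite -(mulgK (gen u) g); apply: vertM => //; exact: vertV.
Qed.

(* The indicator of the component that contains [pt u w 1] once the block of
   [vert u] is removed from the tree. *)
Lemma half_space u w : e u w -> exists f : vertex -> int,
  [/\ forall x y, near x y -> x <> pt u w 1 -> y <> pt u w 1 -> f x = f y,
      forall w' h, e u w' -> w' != w -> edge u w h ->
        f (pt u w' h) = Posz (~~ `[< vert u h >])
    & forall w' h, e w w' -> w' != u -> edge u w h -> f (pt w w' h) = 1%R].
Proof.
move=> uw; have [D [Dw nDu Dedge]] := edge_side uw.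
have [|chi [chi1 chiM]] := @crossing_function _ _ _ m_gt1 e_sym (vert u) D.
  by move=> v v' vv' Dv nDv' g; have [_ ->] := Dedge _ _ vv' Dv nDv'; exact: vert_mulgen.
(* The correction makes [F] constant on cosets: generators in [D] preserve [chi] plus the indicator
   of [vert u], and the only edge leaving [D] ends at [u], whose generator preserves [vert u]. *)
pose F u' w' g : int := (chi g + Posz ((D u' || D w') && `[< vert u g >]))%R.
have asb g : `[< vert u (g * gen u) >] = `[< vert u g >].
  by apply/asboolP/asboolP => /vert_mulgen.
have Fgen u' w' g : e u' w' -> F u' w' (g * gen u') = F u' w' g.
  move=> u'w'; rewrite /F chiM; case: (boolP (D u')) => /= Du; first by lia.
  case: (boolP (D w')) => /= Dw'; last by lia.
  rewrite e_sym in u'w'; have [_ ->] := Dedge _ _ u'w' Dw' Du.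
  by rewrite asb; lia.
have FX u' w' g n : e u' w' -> F u' w' (g * gen u' ^+ n) = F u' w' g.
  by move=> u'w'; elim: n => [|n IH]; rewrite ?mulg1 // expgSr mulgA Fgen.
have FC u' w' g : F u' w' g = F w' u' g by rewrite /F orbC.
have Fedge u' w' g h : e u' w' -> edge u' w' h -> F u' w' (g * h) = F u' w' g.
  by move=> u'w' ->; rewrite mulgA FC FX 1?e_sym // FC FX.
have ex x : exists k : int, forall u' w' g, e u' w' -> x = pt u' w' g -> F u' w' g = k.
  have [u1 [w1 [g1 [uw1 ->]]]] := ptP T c0r x; exists (F u1 w1 g1) => u' w' g u'w'.
  case/(pt_inj uw1 u'w') => eg uE.
  rewrite -(Fedge u1 w1 g1 (g1^-1 * g)) // mulVKg.
  by case: uE => -[-> ->].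
pose f x := projT1 (cid (ex x)).
have fE u' w' g : e u' w' -> f (pt u' w' g) = F u' w' g.
  by move=> u'w'; rewrite /f; case: cid => k /= kP; rewrite (kP u' w' g).
have v1 : `[< vert u (1 : W) >] by apply/asboolP; exact: vert1.
have chiE h : edge u w h -> chi h = Posz (~~ `[< vert u h >]).
  move=> eh; have := Fedge u w 1 h uw eh; rewrite mul1g /F Dw orbT /= chi1 v1.
  by case: `[< vert u h >] => /=; lia.
exists f; split.
- move=> _ _ [v [v1' [v2 [g [vv1 vv2 -> ->]]]]] n1 n2; rewrite !fE // /F.
  case: (boolP (D v)) => //= nDv; congr (_ + Posz _)%R.
  have key v' : e v v' -> D v' -> pt v v' g <> pt u w 1 -> `[< vert u g >] = false.
    move=> vv' Dv' n; apply/negbTE/asboolPn => vg; apply: n.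
    rewrite e_sym in vv'; have [-> ->] := Dedge _ _ vv' Dv' nDv.
    by apply/esym/(pt_eq T c0r) => //; rewrite invg1 mul1g; exact: (eVert_edge T uw).
  case: (boolP (D v1')) => D1; case: (boolP (D v2)) => D2 //=.
    by rewrite (key v1').
  by rewrite (key v2).
- move=> w' h uw' w'w eh; rewrite fE // /F (negPf nDu) /= chiE //.
  case: (boolP (D w')) => [Dw'|_]; last by rewrite /= GRing.addr0.
  rewrite e_sym in uw'; have [e1 _] := Dedge _ _ uw' Dw' nDu.
  by rewrite e1 eqxx in w'w.
move=> w' h ww' w'u eh; rewrite fE // /F Dw /= chiE //.
by case: `[< vert u h >].
Qed.

(** Translate [t] to [pt u w 1]. The function of [half_space] is constant along walks missing this
    point and, among its neighbours, vanishes only on those sharing the coset [vert u] with it. *)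
Lemma near_sep t x z : near t x -> near t z -> t <> x -> t <> z -> side0 t x z -> near x z.
Proof.
case=> u [w [w' [g [uw uw' tE xE]]]] [u2 [w2 [w2' [g2 [uw2 uw2' tE2 zE]]]]] tx tz.
case=> [[/esym//]|av].
have [f [f_near f_same f_opp]] := half_space uw.
have tr h v v' k : e v v' -> act h (pt v v' k) = pt v v' (h * k) by exact: act_pt.
have near_f : f (act g^-1 x) = f (act g^-1 z).
  apply: (avoids_ind (P := fun b => f (act g^-1 x) = f (act g^-1 b)) _ av) => // a b ta tb ab ->.
  have gt : pt u w 1 = act g^-1 t by rewrite tE tr // mulVg.
  apply: f_near; first exact: near_act.
    by rewrite gt => /(act_inj act1 actM)/esym.
  by rewrite gt => /(act_inj act1 actM)/esym.
have w'w : w' != w by apply/eqP => e1; apply: tx; rewrite tE xE e1.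
have w2'w2 : w2' != w2 by apply/eqP => e1; apply: tz; rewrite tE2 zE e1.
have v1 : `[< vert u (1 : W) >] by apply/asboolP; exact: vert1.
have fx : f (act g^-1 x) = 0%R.
  have e1 : edge u w (1 : W) by exact: edge1.
  by rewrite xE tr // mulVg (f_same _ _ uw' w'w e1) v1.
move: near_f; rewrite fx zE tr //.
have [eg uE] := pt_inj uw uw2 (etrans (esym tE) tE2).
case: uE uw2' w2'w2 zE uw2 => -[-> ->] uw2' w2'w2 zE uw2; last by rewrite f_opp.
rewrite f_same //; case: asboolP => // vg _.
exists u, w', w2', g; split=> //; apply/esym/(pt_eq T c0r) => //.
exact: (eVert_edge T).
Qed.

Lemma near_adj x y : near x y -> x <> y -> adj side0 x y.
Proof. by move=> xy ne; split=> // t tx ty; right; exact: avoids_near. Qed.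

(* On a shortest walk consecutive steps are in distinct blocks, so by
   [near_sep] an interior vertex separates its neighbours. *)
Lemma adj_near x y : adj side0 x y -> near x y.
Proof.
case=> xy sep; pose walk n := `[< exists p, [/\ path (nearb T c0r) x p, last x p = y & size p = n] >].
have ex : exists n, walk n.
  by have [p [xp lp]] := connected T c0r x y; exists (size p); apply/asboolP; exists p.
have [p0 [xp0 lp0 min0]] : exists p, [/\ path (nearb T c0r) x p, last x p = y &
    forall q, path (nearb T c0r) x q -> last x q = y -> (size p <= size q)%N].
  case: (ex_minnP ex) => n /asboolP[p [xp lp sp]] minn; exists p; split=> // q xq lq.
  by rewrite sp; apply: minn; apply/asboolP; exists q.
have [p [xp lp up minp]] : exists p, [/\ path (nearb T c0r) x p, last x p = y, uniq (x :: p) &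
    forall q, path (nearb T c0r) x q -> last x q = y -> (size p <= size q)%N].
  case: (shortenP xp0) lp0 => p xp up subp lp; exists p; split=> // q xq lq.
  by apply: leq_trans (min0 q xq lq); case/andP: up => _ up; exact: uniq_leq_size.
case: p xp lp up minp => [|t [|z q]]; first by move=> _ /xy.
  by rewrite /= andbT => /asboolP + <-.
move=> /and3P[/asboolP xt /asboolP tz zq] lq up minp.
have ntx : x <> t by move=> E; move: up; rewrite E cons_uniq mem_head.
have ntz : t <> z by move=> E; move: up; rewrite E !cons_uniq mem_head andbF.
have tq : t \notin q.
  by move: up; rewrite !cons_uniq => /andP[_ /andP[+ _]]; rewrite in_cons negb_or => /andP[].
have nty : t <> y.
  move=> ty; have /minp : path (nearb T c0r) x [:: t] by rewrite /= andbT; apply/asboolP.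
  by move/(_ ty).
have nxz : ~ near x z.
  move=> xz; have /minp : path (nearb T c0r) x (z :: q).
    by apply/andP; split; [apply/asboolP | exact: zq].
  by move/(_ lq); rewrite /= ltnn.
case: nxz; apply: near_sep (near_sym xt) tz (nesym ntx) (ntz) _.
apply: (side_trans s0T) (sep t (nesym ntx) nty) _; right.
apply: avoids_sym; exists q; split; [exact: zq | exact: lq |].
by rewrite in_cons negb_or tq andbT; apply/eqP.
Qed.

Lemma gen_neq1 v : gen v <> 1.
Proof.
move=> E; have := eps_gen e m_gt1 v v; rewrite E eps1 eqxx => /(congr1 (@nat_of_ord _)).
by rewrite /= modn_small.
Qed.

Lemma side0_stabilizer x y g : adj side0 x y -> act g x = x -> side0 x y (act g y) -> act g y = y.
Proof.
move=> xy gx sxy; have [ne _] := xy; have nxy := adj_near xy.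
have gxy : near x (act g y) by rewrite -{1}gx; exact: near_act.
have ne' : x <> act g y by rewrite -{1}gx => /(act_inj act1 actM).
have [u [w [w' [h [uw uw' yE gyE]]]]] := near_sep nxy gxy ne ne' sxy.
rewrite gyE; move: gyE; rewrite {1}yE act_pt // => /(pt_inj uw uw')[_].
by case=> -[e1 e2]; rewrite yE e2 // e1.
Qed.

Lemma near_fix x y : near x y -> exists g, [/\ g <> 1, act g x = x & act g y = y].
Proof.
case=> u [w [w' [g [uw uw' -> ->]]]]; exists (gen u ^ g^-1); split.
- by move/(canRL (conjgKV g)); rewrite conj1g; exact: gen_neq1.
- by apply/(stabP _ _ _ _ _ uw); rewrite conjgKV; apply: (eVert_edge T uw); exact: vert_gen.
- by apply/(stabP _ _ _ _ _ uw'); rewrite conjgKV; apply: (eVert_edge T uw'); exact: vert_gen.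
Qed.

(** One coset for each edge of the tree, indexed by the end farther from the root: a transversal of
    the orbits. *)
Definition edge_points : seq vertex := [seq pt v (par v) 1 | v <- enum (predC1 r)].

Lemma edge_pointsP x : x \in edge_points <-> exists2 v, v != r & x = pt v (par v) 1.
Proof.
by split=> [/mapP[v]|[v vr ->]]; [rewrite mem_enum => vr ->; exists v | apply: map_f; rewrite mem_enum].
Qed.

Lemma edge_parent u w : e u w -> exists2 v, v != r & forall g, pt u w g = pt v (par v) g.
Proof.
move=> uw; case: (par_edge T uw) => -[nr E]; first by exists u => //; rewrite E.
by exists w => // g; rewrite pt_swap // E.
Qed.

Lemma pt_par_inj v v' g g' : v != r -> v' != r -> pt v (par v) g = pt v' (par v') g' -> v' = v.
Proof.
move=> vr v'r /(pt_inj (par_adj T vr) (par_adj T v'r))[_ [[-> //]|[e1 e2]]].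
have := @par_cycle _ _ _ _ T v 1; rewrite /= -e1 e2 => /(_ erefl) vr'.
by rewrite vr' eqxx in vr.
Qed.

Lemma edge_points_spanning : spanning act side0 edge_points.
Proof.
split.
- rewrite map_inj_in_uniq ?enum_uniq // => v v'; rewrite !mem_enum => vr v'r.
  by move/(pt_par_inj vr v'r).
- move=> x; have [u [w [g [uw ->]]]] := ptP T c0r x; have [v vr vE] := edge_parent uw.
  exists g, (pt v (par v) 1); split; first by apply/edge_pointsP; exists v.
  by rewrite vE act_pt ?mulg1 //; exact: par_adj T v vr.
- move=> g _ _ /edge_pointsP[v vr ->] /edge_pointsP[v' v'r ->].
  rewrite act_pt; last exact: par_adj T v vr.
  by move/(pt_par_inj v'r vr) => ->.
- move=> P PP; have [w0 rw0] := root_edge T c0r.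
  have top v w w' : e v w -> e v w' -> P (pt v w 1) -> P (pt v w' 1).
    move=> vw vw'; case: (pselect (pt v w 1 = pt v w' 1)) => [->//|ne].
    have [x xr xE] := edge_parent vw; have [y yr yE] := edge_parent vw'.
    apply: PP; [by rewrite xE; apply/edge_pointsP; exists x |
      by rewrite yE; apply/edge_pointsP; exists y |].
    by apply: near_adj => //; exists v, w, w', 1.
  have toroot v w : e v w -> (P (pt v w 1) -> P (pt r w0 1)) /\ (P (pt r w0 1) -> P (pt v w 1)).
    elim/(par_ind T): v w => [w rw|v vr IH w vw]; first by split; exact: top.
    have vp := par_adj T vr; have pv : e (par v) v by rewrite e_sym.
    have [h1 h2] := IH v pv; split=> [Pv|/h2].
      by apply: h1; rewrite -pt_swap //; exact: top Pv.
    by rewrite -pt_swap //; exact: top.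
  move=> x y /edge_pointsP[v vr ->] /edge_pointsP[v' v'r ->].
  have [h1 _] := toroot _ _ (par_adj T vr); have [_ h2] := toroot _ _ (par_adj T v'r).
  by move/h1/h2.
move=> P P1 PM PV Pstab g; elim/gen_ind: g => [//|g v Pg]; apply: PM Pg _.
have [w vw] : exists w, e v w.
  case: (eqVneq v r) => [->|vr]; first by have [w0 rw0] := root_edge T c0r; exists w0.
  by exists (par v); exact: par_adj T v vr.
have [x xr xE] := edge_parent vw.
apply: (Pstab (pt v w 1)); first by rewrite xE; apply/edge_pointsP; exists x.
by apply/(stabP _ _ _ _ _ vw); rewrite conjg1; apply: (eVert_edge T vw); exact: vert_gen.
Qed.

Theorem side0_good : good act side0.
Proof.
split.
- exact: s0T.
- exact: s0E.
- exact: side0_stabilizer.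
- by move=> x y /adj_near/near_fix.
- by exists edge_points; exact: edge_points_spanning.
Qed.

End CosetTreeGood.

(** * The coset tree structure and its stabilizers *)

Section CosetStabilizers.
Variables (V : finType) (e : rel V) (m : V -> nat) (r : V) (par : V -> V).
Hypotheses (m_gt1 : forall v, (1 < m v)%N) (T : rooted e r par).
Variable c0 : V.
Hypothesis c0r : c0 != r.
Local Notation W := (graph_product e m).
Local Notation gen := (gen e m).
Local Notation vert := (vert m_gt1).
Local Notation edge := (edge m_gt1).
Local Notation eps := (@eps V e m m_gt1).
Local Notation vertex := (vertex e m_gt1).
Local Notation pt := (pt m_gt1 T c0r).
Local Notation act := (@act V e m r par m_gt1 T c0 c0r).
Local Notation near := (@near V e m r par m_gt1 T c0 c0r).
Local Notation side0 := (@side0 V e m r par m_gt1 T c0 c0r).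
Let e_sym : symmetric e := par_sym T.
Let act1 := act1 (m_gt1 := m_gt1) T c0r.
Let actM := actM (m_gt1 := m_gt1) T c0r.
Let s0T := side0_tree_like m_gt1 T c0r.
Let s0E := @side0_equiv V e m r par m_gt1 T c0 c0r.
Implicit Types (u v w : V) (g h k : W) (x y z t : vertex).

Lemma conj_edge u w g h : e u w -> edge u w g -> edge u w h -> g ^ h = g.
Proof. by move=> uw eg eh; rewrite conjgE (edge_comm uw eg eh) mulKg. Qed.

Lemma stab_conj u w k g h : e u w -> act g (pt u w k) = pt u w k -> edge u w h ->
  g ^ (k * h) = g ^ k.
Proof. by move=> uw /(stabP _ _ _ _ _ uw) gk eh; rewrite conjgM; apply: conj_edge uw gk eh. Qed.

Lemma near_stab x a : near x a -> x <> a -> exists u w w' k,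
  [/\ e u w, e u w', w' != w, a = pt u w k & x = pt u w' k] /\
  forall g, act g x = x -> act g a = a -> vert u (g ^ k).
Proof.
case=> u [w' [w [k [uw' uw xE aE]]]] xa; exists u, w, w', k.
have w'w : w' != w by apply/eqP => E; apply: xa; rewrite xE aE E.
split=> // g; rewrite xE aE => /(stabP _ _ _ _ _ uw') g1 /(stabP _ _ _ _ _ uw) g2.
apply: (edge_vert g2); apply: (edge_eps g1); last by rewrite eq_sym.
by rewrite eq_sym; exact: (edge_neq T uw).
Qed.

(** Neighbours of [a] are attached along cosets of [vert u] or of [vert w]; fixing one of the latter
    would force the [u]-exponent of [t] to vanish. *)
Lemma near_block u w k a z (t : W) : e u w -> a = pt u w k -> near a z -> a <> z -> t <> 1 ->
  vert u (t ^ k) -> act t z = z ->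
  exists w2 h, [/\ e u w2, edge u w h & z = pt u w2 (k * h)].
Proof.
move=> uw aE [u2 [w2 [w2' [k2 [uw2 uw2' aE2 zE]]]]] az t1 vt tz.
have [eh uE] := pt_inj uw uw2 (etrans (esym aE) aE2).
case: uE uw2 uw2' aE2 zE => -[-> ->] uw2 uw2' aE2 zE.
  by exists w2', (k^-1 * k2); rewrite mulVKg.
have et := eVert_edge T uw vt.
have w2'u : u != w2' by apply/eqP => E; apply: az; rewrite zE aE2 E.
move: tz; rewrite zE => /(stabP _ _ _ _ _ uw2').
have -> : t ^ k2 = t ^ k by rewrite -(mulVKg k k2) conjgM; exact: conj_edge uw et eh.
move=> et2; have eu : eps u (t ^ k) = 0%R by apply: (edge_eps et2) => //; exact: (edge_neq T uw).
case: t1; apply: (can_inj (conjgK k)); rewrite conj1g.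
by have E : t ^ k = gen u ^+ eps u (t ^ k) := vt; rewrite [LHS]E eu.
Qed.

Lemma near_stab_next x a z (t g : W) : near x a -> x <> a -> near a z -> a <> z -> t <> 1 ->
  act t x = x -> act t a = a -> act t z = z -> act g x = x -> act g a = a -> act g z = z.
Proof.
move=> xa nxa az naz t1 tx ta tz gx ga.
have [u [w [w' [k [[uw uw' w'w aE xE] sP]]]]] := near_stab xa nxa.
have [w2 [h [uw2 eh ->]]] := near_block uw aE az naz t1 (sP t tx ta) tz.
apply/(stabP _ _ _ _ _ uw2); rewrite (stab_conj uw _ eh) -?aE //.
exact: (eVert_edge T uw2 (sP g gx ga)).
Qed.

Lemma next_fixed (t : W) x y : act t x = x -> act t y = y -> act t (next side0 x y) = next side0 x y.
Proof. by move=> tx ty; rewrite -(next_act act1 actM s0T s0E) tx ty. Qed.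

(** On a geodesic fixed by [t], all blocks carry the type of the first one, so an element fixing one
    step fixes the next. *)
Lemma fix_propagate x y (t g : W) : t <> 1 -> x <> y -> act t x = x -> act t y = y ->
  act g x = x -> act g (next side0 x y) = next side0 x y -> act g y = y.
Proof.
move=> t1; move: x y; apply: (geodesic_ind s0T) => x y IH xy tx ty gx ga.
have ta := next_fixed tx ty; have xa := next_adj s0T xy; have [nxa _] := xa.
case: (pselect (next side0 x y = y)) => [<- //|ay].
have ac := next_adj s0T ay; have [nac _] := ac; have tc := next_fixed ta ty.
have gc := near_stab_next (adj_near xa) nxa (adj_near ac) nac t1 tx ta tc gx ga.
exact: (IH xy ay ta ty ga gc).
Qed.

Lemma side0_stab x y (t g : W) : x <> y -> t <> 1 -> act t x = x -> act t y = y ->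
  act g x = x -> side0 x y (act g y) -> act g y = y.
Proof.
move=> xy t1 tx ty gx sgy; apply: (fix_propagate t1 xy) => //.
have xa := next_adj s0T xy; apply: (side0_stabilizer xa gx).
have sa := next_side s0T x y.
apply: (side_trans s0T) (sa) _; apply: (side_trans s0T) sgy _.
by apply: (side_sym s0T); have := s0E g sa; rewrite gx.
Qed.

Lemma side0_block x y z (t : W) : adj side0 x y -> adj side0 x z -> t <> 1 ->
  act t y = y -> act t z = z -> exists g, act g x = x /\ side0 x (act g y) z.
Proof.
move=> xy xz t1 ty tz; case: (pselect (side0 x y z)) => [syz|nyz].
  by exists 1; rewrite !act1.
have tx : act t x = x.
  by rewrite (next_uniq s0T (adj_sym s0T xy) nyz); exact: next_fixed.
have [nxy _] := xy; have [nxz _] := xz.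
have [u [w [w' [k [[uw uw' w'w xE yE] sP]]]]] := near_stab (near_sym (adj_near xy)) (nesym nxy).
have [w2 [h [uw2 eh zE]]] := near_block uw xE (adj_near xz) nxz t1 (sP t ty tx) tz.
have gx : act (h ^ k^-1) x = x by rewrite xE; apply/(stabP _ _ _ _ _ uw); rewrite conjgKV.
exists (h ^ k^-1); split=> //; right; apply: avoids_near => //.
  by rewrite -{1}gx => /(act_inj act1 actM).
exists u, w', w2, (k * h); split=> //.
by rewrite yE act_pt // conjgE invgK -!mulgA mulVg mulg1.
Qed.

Lemma side0_separated x y : x <> y -> exists g, act g x = x /\ act g y <> y.
Proof.
move=> xy; apply: contrapT => nex.
have fixy g : act g x = x -> act g y = y.
  by move=> gx; apply: contrapT => gy; apply: nex; exists g.
have xa := next_adj s0T xy; have [nxa _] := xa.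
have [u [w [w' [k [[uw uw' w'w xE aE] sP]]]]] := near_stab (near_sym (adj_near xa)) (nesym nxa).
have wx : act (gen w ^ k^-1) x = x.
  rewrite xE; apply/(stabP _ _ _ _ _ uw); rewrite conjgKV.
  by apply: vert_edger; [exact: (edge_neq T uw) | exact: vert_gen].
have := sP _ (next_fixed wx (fixy _ wx)) wx; rewrite conjgKV => /vert_eps.
move/(_ w (edge_neq T uw)); rewrite eps_gen eqxx => /(congr1 (@nat_of_ord _)).
by rewrite /= modn_small.
Qed.

(** ** Valences *)

(** Each end of the edge that is not a leaf accounts for one flag present in every structure. *)
Definition valence_of (p : V * V) : nat :=
  (1 < degree e p.1)%N + (1 < degree e p.2)%N.

Lemma valence_rep x : exists p : V * V, e p.1 p.2 /\ exists g, x = pt p.1 p.2 g.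
Proof. by have [u [w [g [uw ->]]]] := ptP T c0r x; exists (u, w); split=> //; exists g. Qed.

Definition valence x : nat := valence_of (projT1 (cid (valence_rep x))).

Lemma valence_pt u w g : e u w -> valence (pt u w g) = valence_of (u, w).
Proof.
move=> uw; rewrite /valence; case: cid => -[u' w'] /= [uw' [g' E]].
have [_ [[-> ->]//|[-> ->]]] := pt_inj uw uw' E.
by rewrite /valence_of addnC.
Qed.

Lemma valence_act g x : valence (act g x) = valence x.
Proof. by have [u [w [k [uw ->]]]] := ptP T c0r x; rewrite act_pt // !valence_pt. Qed.

Section Flags.
Variable s : side vertex.
Hypothesis sG : good act s.
Let sT := good_tree sG.

(** A second edge at [u] gives another point fixed by the conjugate of [vert u], and so is the first
    step towards it, whatever the structure. *)
Lemma interior_direction u w g : e u w -> (1 < degree e u)%N ->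
  exists y, adj s (pt u w g) y /\ forall h, vert u (h ^ g) -> act h y = y.
Proof.
move=> uw; rewrite /degree (cardD1 w) inE uw ltnS => /card_gt0P[w1].
rewrite !inE => /andP[w1w uw1].
have ne : pt u w g <> pt u w1 g.
  move=> /(pt_inj uw uw1)[_ [[_ E]|[E1 E2]]]; first by rewrite E eqxx in w1w.
  by have := edge_neq T uw; rewrite E1 eqxx.
exists (next s (pt u w g) (pt u w1 g)); split; first exact: next_adj.
move=> h vh; rewrite -(next_act act1 actM sT (good_equiv sG)).
by congr next; apply/(stabP _ _ _ _ _ _) => //; exact: (eVert_edge T).
Qed.

(** If the stabilizer of [x] carried one direction to the other, its commutativity would make both
    vertex groups, hence all of it, fix [y], against [side0_separated]. *)
Lemma interior_flags u w g y z : e u w -> adj s (pt u w g) y -> adj s (pt u w g) z ->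
  (forall h, vert u (h ^ g) -> act h y = y) -> (forall h, vert w (h ^ g) -> act h z = z) ->
  flag_of act s (pt u w g) y <> flag_of act s (pt u w g) z.
Proof.
move=> uw xy xz yfix zfix; set x := pt u w g in xy xz *.
have [nxy _] := xy; have [nxz _] := xz.
have unw := edge_neq T uw.
move=> /(flag_of_inv act1 sG (nesym nxy) (nesym nxz))[k [kx syz]].
have stab_comm h : act h x = x -> h * k = k * h.
  move=> hx; apply: (can_inj (conjgK g)); rewrite !conjMg.
  by apply: (edge_comm uw); apply/(stabP m_gt1 T c0r).
have wfix h : vert w (h ^ g) -> act h y = y.
  move=> vh; have hx : act h x = x.
    by apply/(stabP _ _ _ _ _ uw); apply: vert_edger.
  apply: (good_stab sG xy hx).
  have := good_equiv sG h syz; rewrite hx -actM (stab_comm h hx) actM (zfix h vh) => h1.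
  by apply: (side_trans sT) syz _; exact: (side_sym sT).
have [h [hx hy]] := side0_separated nxy; apply: hy.
have /(stabP _ _ _ _ _ uw) := hx; set j := h ^ g => ej.
have -> : h = (gen u ^+ eps u j) ^ g^-1 * (gen w ^+ eps w j) ^ g^-1.
  by rewrite -conjMg -ej conjgK.
by rewrite actM wfix ?yfix // conjgKV; exact: vertX.
Qed.

Lemma valence_flags x : exists l : seq vertex,
  [/\ size l = valence x, forall y, y \in l -> y <> x & uniq (map (flag_of act s x) l)].
Proof.
have [u [w [g [uw ->]]]] := ptP T c0r x; rewrite valence_pt // /valence_of /=.
have wu : e w u by rewrite e_sym.
case: (boolP (1 < degree e u)%N) => du; case: (boolP (1 < degree e w)%N) => dw.
- have [y [xy yfix]] := interior_direction g uw du.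
  have [z [xz zfix]] := interior_direction g wu dw.
  rewrite -pt_swap // in xz; exists [:: y; z]; split=> //.
    by move=> t; rewrite !in_cons orbF => /orP[] /eqP ->; [case: xy | case: xz] => /nesym.
  rewrite /= andbT inE; apply/eqP; exact: interior_flags xy xz yfix zfix.
- have [y [xy yfix]] := interior_direction g uw du; exists [:: y]; split=> //.
  by move=> t; rewrite in_cons orbF => /eqP ->; case: xy => /nesym.
- have [z [xz zfix]] := interior_direction g wu dw; rewrite -pt_swap // in xz.
  exists [:: z]; split=> //.
  by move=> t; rewrite in_cons orbF => /eqP ->; case: xz => /nesym.
by exists [::].
Qed.

End Flags.

Lemma edge_count u v : (e u v : nat) = ((v != r) && (par v == u) + (u != r) && (v == par u))%N.
Proof.
case: (boolP (e u v)) => [uv|nuv].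
  have E : (u != r) && (v == par u) || (v != r) && (par v == u).
    by case: (par_edge T uv) => -[-> ->]; rewrite eqxx ?orbT.
  have : ~~ [&& (u != r), v == par u, v != r & par v == u].
    apply/negP => /and4P[ur /eqP vu vr /eqP pv].
    have := @par_cycle _ _ _ _ T v 1; rewrite /= pv -vu => /(_ erefl) E'.
    by rewrite E' eqxx in vr.
  by move: E; case: (u != r); case: (v == _); case: (v != r); case: (par v == u).
suff : ~~ ((u != r) && (v == par u)) && ~~ ((v != r) && (par v == u)).
  by case/andP => /negbTE -> /negbTE ->.
apply/andP; split; apply: contra nuv => /andP[nr /eqP E].
  by rewrite E; exact: par_adj T _ nr.
by rewrite -E e_sym; exact: par_adj T _ nr.
Qed.

Local Notation deg := (degree e).

Lemma deg_children u : deg u = (#|[set v | (v != r) && (par v == u)]| + (u != r))%N.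
Proof.
rewrite /degree -!sum1dep_card big_mkcond [X in (X + _)%N]big_mkcond /=.
have -> : ((u != r) : nat) = \sum_v ((u != r) && (v == par u) : nat)%N.
  case: (u != r) => /=; last by rewrite big1.
  by rewrite (bigD1 (par u)) //= eqxx big1 // => v /negbTE ->.
rewrite -big_split /=; apply: eq_bigr => v _.
by have := edge_count u v; case: (e u v); case: (_ && (par v == u)); case: (_ && _).
Qed.

Lemma deg_gt0 u : (0 < deg u)%N.
Proof.
case: (eqVneq u r) => [->|ur]; last by rewrite deg_children ur addn1.
by have [w rw] := root_edge T c0r; apply/card_gt0P; exists w; rewrite inE.
Qed.

Lemma sum_children (F : V -> nat) :
  (\sum_(v | v != r) F (par v) = \sum_u #|[set v | (v != r) && (par v == u)]| * F u)%N.
Proof.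
rewrite (partition_big par predT) //=; apply: eq_bigr => u _.
rewrite (eq_bigr (fun=> F u)) => [|v /andP[_ /eqP -> //]].
by rewrite sum_nat_const cardsE.
Qed.

Lemma deg_sum (F : V -> nat) :
  (\sum_(v | v != r) (F v + F (par v)) = \sum_u deg u * F u)%N.
Proof.
rewrite big_split /= sum_children [X in (X + _)%N]big_mkcond -big_split /=.
apply: eq_bigr => u _; rewrite deg_children mulnDl addnC; congr (_ + _)%N.
by case: (u != r); rewrite ?mul1n.
Qed.

Lemma card_nonroot : #|[pred v | v != r]| = #|V|.-1.
Proof. by rewrite -(cardC1 r); apply: eq_card => v. Qed.

Lemma size_edge_points : size (edge_points m_gt1 T c0r) = #|V|.-1.
Proof. by rewrite size_map -cardE -card_nonroot; apply: eq_card => v. Qed.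

Lemma card_leaves : #|leaves e| = (\sum_u (deg u == 1))%N.
Proof.
rewrite -sum1_card big_mkcond /=; apply: eq_bigr => u _.
by rewrite inE /degree; case: (_ == _).
Qed.

Lemma degree_total : (\sum_u deg u = 2 * #|V|.-1)%N.
Proof.
rewrite (eq_bigr (fun u => deg u * 1)%N) => [|u _]; last by rewrite muln1.
rewrite -deg_sum -card_nonroot -sum1_card big_distrr /=.
by apply: eq_bigr => v; rewrite addn1.
Qed.

Lemma valence_sum :
  (\sum_(x <- edge_points m_gt1 T c0r) valence x + #|leaves e| = 2 * #|V|.-1)%N.
Proof.
have -> : (\sum_(x <- edge_points m_gt1 T c0r) valence x = \sum_u deg u * (1 < deg u)%N)%N.
  rewrite -deg_sum big_map /= big_enum /=; apply: eq_bigr => v vr.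
  by rewrite valence_pt //; exact: par_adj T v vr.
rewrite card_leaves -big_split /= -degree_total; apply: eq_bigr => u _.
by have := deg_gt0 u; case: (deg u) => [//|[|k]] _; rewrite ?muln1 ?addn0.
Qed.

End CosetStabilizers.

Lemma finite_index_map (G : groupType) (H : subgroup G) (K : finType) (D : G -> K) :
  (forall p q, D p = D q -> p^-1 * q \in H) -> finite_index H.
Proof.
move=> DH; pose rep d := if pselect (exists p, D p = d) is left h then projT1 (cid h) else 1.
exists [seq rep d | d <- enum K] => p; exists (rep (D p)); first exact/map_f/mem_enum.
by rewrite /rep; case: pselect => [h|[]]; [case: cid => q /= /DH | exists p].
Qed.

Lemma finite_index_power (G : groupType) (H : subgroup G) (g : G) :
  finite_index H -> exists n, g ^+ n.+1 \in H.
Proof.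
case=> l lP.
have [t tP] : exists t : nat -> G, forall n, t n \in l /\ (t n)^-1 * g ^+ n \in H.
  have ex n : exists t : G, t \in l /\ t^-1 * g ^+ n \in H.
    by have [t tl tH] := lP (g ^+ n); exists t.
  by exists (fun n => projT1 (cid (ex n))) => n; case: cid.
have [i [j [ij tij]]] : exists i j, (i < j)%N /\ t i = t j.
  have /(uniqPn 1)[i [j []]] : ~~ uniq (mkseq t (size l).+1).
    apply/negP => ut; have := uniq_leq_size (s2 := l) ut; rewrite size_mkseq ltnn.
    by case/(_ _)/notF => q /mapP[n _ ->]; case: (tP n).
  rewrite size_mkseq => ij jl; rewrite !nth_mkseq // ?(ltn_trans ij) // => tij.
  by exists i, j.
exists (j - i).-1; rewrite prednK ?subn_gt0 //.
have [_ hi] := tP i; have [_ hj] := tP j; rewrite -tij in hj.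
have hiV : ((t i)^-1 * g ^+ i)^-1 \in H by rewrite gpredV.
have := gpredM _ _ hiV hj; rewrite invgM invgK -mulgA mulVKg.
by rewrite -{1}(subnK (ltnW ij)) addnC expgnDr mulKg.
Qed.

Lemma val_expg (G : groupType) (H : subgroup G) (p : subgroup_group H) n :
  val (p ^+ n) = val p ^+ n.
Proof. by elim: n => [//|n IH]; rewrite !expgS -IH. Qed.

(** * A finite index subgroup acting freely *)

Section FreeSubgroup.
Variables (V : finType) (e : rel V) (m : V -> nat) (r : V) (par : V -> V).
Hypotheses (m_gt1 : forall v, (1 < m v)%N) (T : rooted e r par).
Variable c0 : V.
Hypothesis c0r : c0 != r.
Local Notation W := (graph_product e m).
Local Notation gen := (gen e m).
Local Notation vert := (vert m_gt1).
Local Notation edge := (edge m_gt1).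
Local Notation eps := (@eps V e m m_gt1).
Local Notation vertex := (vertex e m_gt1).
Local Notation pt := (pt m_gt1 T c0r).
Local Notation act := (@act V e m r par m_gt1 T c0 c0r).
Local Notation side0 := (@side0 V e m r par m_gt1 T c0 c0r).
Let e_sym : symmetric e := par_sym T.
Let act1 := act1 (m_gt1 := m_gt1) T c0r.
Let actM := actM (m_gt1 := m_gt1) T c0r.
Let s0T := side0_tree_like m_gt1 T c0r.
Let gen_ind := @gp_ind V e m m_gt1.
Implicit Types (u v w : V) (g h k : W) (x y z t : vertex).
Let s0G : good act side0 := @side0_good V e m r par m_gt1 T c0 c0r.
Let fin_stab := @fin_stab V e m r par m_gt1 T c0 c0r.
Let sep := @side0_separated V e m r par m_gt1 T c0 c0r.
Local Notation theta := (theta act1 actM fin_stab s0G sep).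
Local Notation transport := (transport act1 actM fin_stab s0G sep).
Implicit Types (phi psi : aut W).

Definition tame psi := forall u w, e u w ->
  exists g, (forall v, eps v g = 0%R) /\ forall h, edge u w h -> psi h = h ^ g.

Lemma neighbour v : exists w, e v w.
Proof.
case: (eqVneq v r) => [->|vr]; first exact: (root_edge T c0r).
by exists (par v); exact: par_adj T v vr.
Qed.

Lemma tame_eps psi v g : tame psi -> eps v (psi g) = eps v g.
Proof.
move=> tpsi; elim/gen_ind: g => [|g u IH]; first by rewrite aut1E.
rewrite autM !epsM IH; congr (_ + _)%R.
have [w uw] := neighbour u; have [h [_ hE]] := tpsi u w uw.
by rewrite hE ?epsJ //; apply: (eVert_edge T uw); exact: vert_gen.
Qed.

Lemma aut_eps0 psi g : (forall v, eps v g = 0%R) -> forall v, eps v (psi g) = 0%R.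
Proof.
move=> g0 v; have dM : {morph (fun h => eps v (psi h)) : x y / x * y >-> (x + y)%R}.
  by move=> x y; rewrite autM epsM.
by rewrite (additive_eps m_gt1 dM) big1 // => u _; rewrite g0 GRing.mulr0n.
Qed.

Lemma tame1 : tame 1.
Proof. by move=> u w uw; exists 1; split=> [v|x _]; rewrite ?eps1 ?conjg1. Qed.

Lemma tameM phi psi : tame phi -> tame psi -> tame (phi * psi).
Proof.
move=> tphi tpsi u w uw; have [g [g0 gE]] := tphi u w uw; have [h [h0 hE]] := tpsi u w uw.
exists (g * phi h); split=> [v|x ex]; first by rewrite epsM g0 tame_eps // h0 GRing.addr0.
have -> : (phi * psi) x = phi (psi x) by [].
by rewrite hE // aut_conjg gE // conjgM.
Qed.

Lemma tameV psi : tame psi -> tame psi^-1.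
Proof.
move=> tpsi u w uw; have [g [g0 gE]] := tpsi u w uw.
have K (x : W) : psi^-1 (psi x) = x by exact: aut_invK.
exists (psi^-1 g)^-1; split=> [v|x ex].
  by rewrite epsV aut_eps0 // GRing.oppr0.
have := K x; rewrite gE // aut_conjg => E.
by rewrite -{2}E conjgK.
Qed.

Lemma conj_autM (a : W) : {morph (fun x : W => x ^ a) : x y / x * y}.
Proof. by move=> x y; rewrite conjMg. Qed.

Lemma conj_aut_bij (a : W) : bijective (fun x : W => x ^ a).
Proof. by exists (fun x : W => x ^ a^-1); [exact: conjgK | exact: conjgKV]. Qed.

Definition conj_aut (a : W) : aut W := Aut (@conj_autM a) (conj_aut_bij a).

Lemma conj_aut_inn a : conj_aut a \in @inn W.
Proof. by apply/innP; exists a. Qed.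

Lemma tame_conj a : (forall v, eps v a = 0%R) -> tame (conj_aut a).
Proof. by move=> a0 u w uw; exists a. Qed.

Local Open Scope quotient_scope.

Lemma out_piM phi psi : \pi_(out W) (phi * psi) = \pi_(out W) phi * \pi_(out W) psi :> out W.
Proof. exact: quotient_piM. Qed.

Lemma out_piV phi : \pi_(out W) phi^-1 = (\pi_(out W) phi : out W)^-1.
Proof.
by apply: (@mulgI _ (\pi_(out W) phi : out W)); rewrite -out_piM !mulgV.
Qed.

Lemma out_pi_inn phi : phi \in @inn W -> \pi_(out W) phi = 1 :> out W.
Proof.
move=> phiI; apply/esym/(quotient_eq (@inn_normal W)).
by rewrite invg1 mul1g.
Qed.

Definition tame_out : {pred out W} := fun p => `[< exists psi, tame psi /\ \pi_(out W) psi = p >].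

Lemma tame_out_mul : mulg_closed tame_out.
Proof.
move=> p q /asboolP[phi [tphi <-]] /asboolP[psi [tpsi <-]]; apply/asboolP.
by exists (phi * psi); split; [exact: tameM | rewrite out_piM].
Qed.

Lemma tame_out1 : 1 \in tame_out.
Proof. by apply/asboolP; exists 1; split; [exact: tame1 | apply: out_pi_inn; exact: inn1]. Qed.

Lemma tame_out_inv : invg_closed tame_out.
Proof.
move=> p /asboolP[phi [tphi <-]]; apply/asboolP.
by exists phi^-1; split; [exact: tameV | rewrite out_piV].
Qed.

HB.instance Definition _ := isMulClosed.Build (out W) tame_out tame_out_mul.
HB.instance Definition _ := isMul1Closed.Build (out W) tame_out tame_out1.
HB.instance Definition _ := isInvClosed.Build (out W) tame_out tame_out_inv.

Definition tame_subgroup : subgroup (out W) := tame_out.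

Lemma tame_subgroupP p : reflect (exists psi, tame psi /\ \pi_(out W) psi = p) (p \in tame_subgroup).
Proof. exact: asboolP. Qed.

(** ** Finite index *)

(** A common bound puts the exponent sums, which live in different rings, into one finite type. *)
Let bound := (\max_v m v).+1.

Definition fingerprint g : {ffun V -> 'I_bound} := [ffun v => inord (eps v g)].

Lemma fingerprint_inj g h : fingerprint g = fingerprint h -> forall v, eps v g = eps v h.
Proof.
move=> E v; apply: val_inj => /=.
have lt k : (eps v k < bound)%N.
  rewrite /bound ltnS; apply: leq_trans (leq_bigmax v).
  by apply: ltnW; rewrite -{2}(Zp_cast (m_gt1 v)).
have /(congr1 (@nat_of_ord _)) : fingerprint g v = fingerprint h v by rewrite E.
by rewrite !ffunE !inordK.
Qed.

(** The adjacency condition stays inside the existential, so that [theta_at] is a total function on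
    pairs. *)
Lemma theta_rep psi (p : V * V) : exists q : V * V * W, e p.1 p.2 ->
  e q.1.1 q.1.2 /\ theta psi (pt p.1 p.2 1) = pt q.1.1 q.1.2 q.2.
Proof.
have [u [w [g [uw ->]]]] := ptP T c0r (theta psi (pt p.1 p.2 1)).
by exists (u, w, g).
Qed.

Definition theta_at psi p := projT1 (cid (theta_rep psi p)).

(** Finitely many values: the target edges, the exponent sums of the conjugating elements, and those
    of the images of the generators. Automorphisms sharing them differ by a tame one. *)
Definition type_of psi : {ffun V * V -> V * V * {ffun V -> 'I_bound}} *
    {ffun V -> {ffun V -> 'I_bound}} :=
  ([ffun p => ((theta_at psi p).1, fingerprint (theta_at psi p).2)],
   [ffun v => fingerprint (psi (gen v))]).

Lemma type_of_tame phi psi : type_of phi = type_of psi -> tame (psi^-1 * phi).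
Proof.
case=> /ffunP E1 /ffunP E2 u w uw.
have epsE v g : eps v (phi g) = eps v (psi g).
  have dM chi : {morph (fun h => eps v (aut_fun chi h)) : x y / x * y >-> (x + y)%R}.
    by move=> x y; rewrite autM epsM.
  rewrite (additive_eps m_gt1 (dM phi)) (additive_eps m_gt1 (dM psi)).
  apply: eq_bigr => k _; congr (_ *+ _)%R; apply: fingerprint_inj.
  by have := E2 k; rewrite !ffunE.
have := E1 (u, w); rewrite !ffunE /theta_at.
case: cid => -[[u1 w1] h] /= /(_ uw)[uw1 th]; case: cid => -[[u2 w2] k] /= /(_ uw)[uw2 tk].
move=> [E3 E4 /fingerprint_inj hk]; rewrite -{}E3 -{}E4 in uw2 tk.
have fixed chi l (x : W) : theta chi (pt u w 1) = pt u1 w1 l -> edge u w x -> edge u1 w1 (chi x ^ l).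
  move=> tl ex; apply/(stabP m_gt1 T c0r _ _ uw1); rewrite -tl -thetaP.
  by apply/(stabP m_gt1 T c0r _ _ uw); rewrite conjg1.
have main (x : W) : edge u w x -> phi x = psi x ^ (k * h^-1).
  move=> ex; apply: (can_inj (conjgK h)); rewrite -conjgM mulgVK.
  by apply: (edge_inj (fixed phi h x th ex) (fixed psi k x tk ex)); rewrite !epsJ epsE.
exists (psi^-1 (k * h^-1)); split=> [|x ex].
  by apply: aut_eps0 => v; rewrite epsM epsV hk GRing.addrN.
by rewrite -[LHS]/(psi^-1 (phi x)) main // aut_conjg; congr (_ ^ _); exact: aut_invK.
Qed.

Lemma tame_finite_index : finite_index tame_subgroup.
Proof.
apply: (@finite_index_map _ _ _ (fun p : out W => type_of (repr p))) => p q E.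
apply/tame_subgroupP; exists ((repr p)^-1 * repr q); split; first exact: type_of_tame.
by rewrite out_piM out_piV !reprK.
Qed.

(** ** Freeness *)

Lemma vert_fix u w k y (t g : W) : e u w -> t <> 1 -> vert u (t ^ k) -> vert u (g ^ k) ->
  act t y = y -> act g y = y.
Proof.
move=> uw t1 vt vg ty; set x := pt u w k.
have fx h : vert u (h ^ k) -> act h x = x.
  by move=> vh; apply/(stabP m_gt1 T c0r _ _ uw); exact: (eVert_edge T uw).
case: (pselect (x = y)) => [<-|xy]; first exact: fx.
have xa := next_adj s0T xy; have [nxa _] := xa.
have ta := next_fixed (fx t vt) ty.
have [w2 [h [uw2 eh aE]]] := near_block uw (erefl x) (adj_near xa) nxa t1 vt ta.
apply: (fix_propagate t1 xy (fx t vt) ty (fx g vg)).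
rewrite aE; apply/(stabP m_gt1 T c0r _ _ uw2).
by rewrite (stab_conj uw (fx g vg) eh); exact: (eVert_edge T uw2).
Qed.

(** Since the orbits differ, some end of the edge of [x] is not an end of the edge of [y]. There [t]
    and [d], which fix [y], have exponent 0, and so has [g]. Thus [t] and [g] lie in the vertex
    group of the other end, and [vert_fix] applies. *)
Lemma shared_stabilizer x y (t g d : W) : (forall h, y <> act h x) -> t <> 1 ->
  act t x = x -> act t y = y -> act g x = x -> act d y = y ->
  (forall v, eps v g = eps v d) -> act g y = y.
Proof.
move=> orb t1 tx ty gx dy gd; have [u [w [k [uw xE]]]] := ptP T c0r x.
have [u2 [w2 [k2 [uw2 yE]]]] := ptP T c0r y.
have stab_eps u' w' k' v (h : W) : e u' w' -> act h (pt u' w' k') = pt u' w' k' ->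
    v != u' -> v != w' -> eps v h = 0%R.
  move=> uw' /(stabP m_gt1 T c0r _ _ uw') eh vu vw; rewrite -(epsJ m_gt1 v h k').
  exact: edge_eps eh vu vw.
have reduce u' w' : e u' w' -> x = pt u' w' k -> w' != u2 -> w' != w2 -> act g y = y.
  move=> uw' xE' wu ww; have vert_k h : act h x = x -> eps w' h = 0%R -> vert u' (h ^ k).
    rewrite xE' => /(stabP m_gt1 T c0r _ _ uw') eh h0; apply: (edge_vert eh).
    by rewrite epsJ.
  apply: (vert_fix uw' t1 _ _ ty); apply: vert_k => //.
    by rewrite yE in ty; exact: stab_eps uw2 ty wu ww.
  by rewrite gd; rewrite yE in dy; exact: stab_eps uw2 dy wu ww.
case: (boolP ((w != u2) && (w != w2))) => [/andP[]|nw]; first exact: (reduce u w uw xE).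
case: (boolP ((u != u2) && (u != w2))) => [/andP[]|nu].
  by apply: (reduce w u); [rewrite e_sym | rewrite xE pt_swap].
case: (orb (k2 * k^-1)); rewrite xE yE act_pt // mulgVK.
have unw := edge_neq T uw.
move: nw nu; rewrite !negb_and !negbK.
case/orP=> /eqP ew /orP[] /eqP eu; rewrite ew eu ?eqxx // in unw *.
by rewrite pt_swap.
Qed.

(* Along the adjacency relation of an invariant structure, [psi] stays the
   identity on stabilizers: it can only move a neighbour [y] of [x] by some [g]
   fixing [x] whose exponent sums are those of an element fixing [y]. *)
Lemma tame_fixed_trivial psi s u w : good act s -> tame psi -> transport psi s = s ->
  e u w -> (forall h, edge u w h -> psi h = h) -> psi = 1.
Proof.
move=> sG tpsi ps uw psi_uw; have sT := good_tree sG.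
pose P x := theta psi x = x /\ forall g, act g x = x -> psi g = g.
have P0 : P (pt u w 1).
  have id_uw g : act g (pt u w 1) = pt u w 1 -> psi g = g.
    by move/(stabP m_gt1 T c0r _ _ uw); rewrite conjg1; exact: psi_uw.
  by split=> //; apply: theta_uniq => g gx; rewrite id_uw.
have step x y : adj s x y -> P x -> P y.
  move=> xy [thx idx]; have [u1 [w1 [k [uw1 yE]]]] := ptP T c0r y.
  have [g1 [g1_0 g1E]] := tpsi u1 w1 uw1.
  (* On the conjugate subgroup fixing [y], the conjugating element changes by [k] and [psi k], whose
     exponent sums agree. *)
  have [c c0' psiE] : exists2 c, forall v, eps v c = 0%R & forall h, act h y = y -> psi h = h ^ c.
    exists (k * g1 * (psi k)^-1) => [v|h].
      by rewrite !epsM epsV tame_eps // g1_0 GRing.addr0 GRing.addrN.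
    rewrite yE => /(stabP m_gt1 T c0r _ _ uw1) eh.
    rewrite -{1}(conjgK k h) aut_conjg g1E // autV !conjgM.
    by rewrite -conjgM.
  have thy : theta psi y = act c^-1 y.
    by apply: theta_uniq => h hy; rewrite psiE // conjgE !actM (actVK act1 actM) hy.
  have xthy : adj s x (act c^-1 y).
    rewrite -thy -{1}thx; rewrite -ps.
    by apply/(adj_pull (thetaKV _ _ _ _ _ psi) (thetaK _ _ _ _ _ psi)); rewrite !thetaK.
  (* [psi] preserves [s] and fixes [x], so [y] and its image differ by some [g] fixing [x]; then
     [c * g] fixes [y] and has the exponent sums of [g]. *)
  have [g [gx gy]] := adj_orbit act1 actM sG xy xthy.
  have dy : act (c * g) y = y by rewrite actM -gy (actVK act1 actM).
  have [t [t1 tx ty]] := good_fix sG xy.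
  have gy' : act g y = y.
    apply: (shared_stabilizer _ t1 tx ty gx dy) => [h yh|v].
      by apply: (adj_same_orbit act1 actM sG (x := x) (h := h)); rewrite -yh.
    by rewrite epsM c0' GRing.add0r.
  split; first by rewrite thy gy.
  move=> h hy; rewrite psiE //.
  have cy : act c y = y by have := dy; rewrite actM gy'.
  apply: (can_inj (conjgK k)); rewrite conjJg.
  move: hy cy; rewrite yE => /(stabP m_gt1 T c0r _ _ uw1) h1 /(stabP m_gt1 T c0r _ _ uw1) h2.
  exact: conj_edge uw1 h1 h2.
have all y : P y.
  by apply: (geodesic_propagate sT (P := P) _ P0) => x z _ _; exact: step.
apply: aut_ext => g; apply: (gp_hom_ext m_gt1) => [x z|//|v]; first exact: autM.
have [w1 vw] := neighbour v; have [_] := all (pt v w1 1); apply.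
by apply/(stabP m_gt1 T c0r _ _ vw); rewrite conjg1; apply: (eVert_edge T vw); exact: vert_gen.
Qed.

Lemma tame_fixed_inn psi s : good act s -> tame psi -> transport psi s = s -> psi \in @inn W.
Proof.
move=> sG tpsi ps; have c0p := par_adj T c0r.
have [g [g0 gE]] := tpsi _ _ c0p.
pose chi := conj_aut g^-1 * psi.
have chi1 : chi = 1.
  apply: (tame_fixed_trivial sG _ _ c0p) => [||h eh].
  - by apply: tameM => //; apply: tame_conj => v; rewrite epsV g0 GRing.oppr0.
  - rewrite -{2}ps; apply: (transport_inn _ _ _ _ _ sG).
    rewrite /chi invgM -mulgA -conjgE.
    apply: inn_normal; apply: inn_invg_closed; exact: conj_aut_inn.
  - by rewrite /chi -[LHS]/((psi h) ^ g^-1) gE // conjgK.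
have -> : psi = (conj_aut g^-1)^-1 by apply: (@mulgI _ (conj_aut g^-1)); rewrite mulgV.
exact: (inn_invg_closed (conj_aut_inn _)).
Qed.

Local Notation out_act := (out_act act1 actM fin_stab s0G sep).
Local Notation structure := (structure act).

Lemma tame_out_free (p : out W) (a : structure) :
  p \in tame_subgroup -> out_act p a = a -> p = 1.
Proof.
move=> /tame_subgroupP[psi [tpsi <-]] /(congr1 val); rewrite out_act_pi => ps.
apply: out_pi_inn; apply: (tame_fixed_inn _ tpsi ps); exact: structure_good.
Qed.

(** Some positive power lies in the tame subgroup and still fixes [a], hence is trivial. *)
Lemma torsion_free_out_free (H : subgroup (out W)) (a : structure) (p : subgroup_group H) :
  torsion_free (subgroup_group H) -> out_act (val p) a = a -> p = 1.
Proof.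
move=> tfH pa.
have fixed n : out_act (val p ^+ n) a = a.
  elim: n => [|n IH]; first by rewrite out_act1.
  by rewrite expgS out_actM IH.
have [n pn] := finite_index_power (val p) tame_finite_index.
apply: (tfH p n.+1) => //; apply: val_inj.
by rewrite val_expg (tame_out_free pn (fixed _)).
Qed.

Lemma structure_chain_bound (a : structure) (c : seq structure) :
  path (@finer _ _ act) a c -> (size (a :: c) <= (#|leaves e| - 2).+1)%N.
Proof.
move=> ac; have V2 : (1 < #|V|)%N by apply/card_gt1P; exists c0, r.
have spS := edge_points_spanning m_gt1 T c0r.
have := chain_size_bound act1 actM spS (@valence_act V e m r par m_gt1 T c0 c0r)
  (fun s x sG => @valence_flags V e m r par m_gt1 T c0 c0r s sG x) _ ac.
rewrite size_edge_points => /(_ _)h.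
have {}h : (size (a :: c) + \sum_(x <- edge_points m_gt1 T c0r) valence T c0r x <= (2 * #|V|.-1.-1).+1)%N.
  by apply: h; case: #|V| V2 => [|[|]].
have := valence_sum m_gt1 T c0r; move: h; move: (size _) (\sum_(x <- _) _)%N => sz S.
by case: #|V| V2 => [|[|N]] //= _; lia.
Qed.

Theorem free_cd_le (H : subgroup (out W)) :
  (forall (p : subgroup_group H) (a : structure), out_act (val p) a = a -> p = 1) ->
  cd_le (subgroup_group H) (#|leaves e| - 2).
Proof.
move=> freeH.
apply: (@acyclic_cd_le (subgroup_group H) structure (@finer _ _ act) predT
  (fun p a => out_act (val p) a) (#|leaves e| - 2) (base_structure s0G)).
- exact: finer_trans.
- by move=> a; exact: out_act1.
- by move=> p q a; exact: out_actM.
- by move=> p a b; exact: out_act_finer.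
- by [].
- by move=> p a _; exact: freeH.
- by [].
- apply: (structures_acyclic act1 actM fin_stab s0G).
  + by move=> x y t g xy t1 tx ty gx h; exact: (side0_stab xy t1 tx ty gx h).
  + by move=> x y z t xy xz t1 ty tz; exact: (side0_block xy xz t1 ty tz).
case=> [//|a c] /andP[ac _]; exact: structure_chain_bound.
Qed.

Lemma tame_torsion_free : torsion_free (subgroup_group tame_subgroup).
Proof.
apply: cd_le_torsion_free; apply: free_cd_le => p a pa.
by apply: val_inj; exact: tame_out_free (valP p) pa.
Qed.

Theorem out_upper_bound :
  virtually_torsion_free (out W) /\
  forall H : subgroup (out W), torsion_free (subgroup_group H) ->
    cd_le (subgroup_group H) (#|leaves e| - 2).
Proof.
split; first by exists tame_subgroup; split; [exact: tame_finite_index | exact: tame_torsion_free].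
by move=> H tfH; apply: free_cd_le => p a; exact: torsion_free_out_free.
Qed.

End FreeSubgroup.

(** * Free abelian subgroups *)

Section IntegerPowers.
Variable G : groupType.
Implicit Types (x y : G).

Definition expz x (n : int) : G := match n with Posz k => x ^+ k | Negz k => x ^- k.+1 end.

Lemma expzS x n : expz x (n + 1)%R = x * expz x n.
Proof.
case: n => [n|[|n]].
- by rewrite -PoszD addn1 /= expgS.
- by rewrite /= mulgV.
have -> : (Negz n.+1 + 1)%R = Negz n by lia.
by rewrite /= [in RHS]expgSr invgM mulVKg.
Qed.

Lemma expzB x n : expz x (n - 1)%R = x^-1 * expz x n.
Proof. by rewrite -{2}(GRing.subrK 1%R n) expzS mulKg. Qed.

Lemma expzD x n k : expz x (n + k)%R = expz x n * expz x k.
Proof.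
have pos (j : nat) : expz x (j%:Z + k)%R = x ^+ j * expz x k.
  elim: j => [|j IH]; first by rewrite GRing.add0r mul1g.
  by rewrite -addn1 PoszD GRing.addrAC expzS IH addn1 expgS mulgA.
have neg (j : nat) : expz x (k - j%:Z)%R = x ^- j * expz x k.
  elim: j => [|j IH]; first by rewrite GRing.subr0 invg1 mul1g.
  by rewrite -addn1 PoszD GRing.opprD GRing.addrA expzB IH addn1 expgSr invgM mulgA.
case: n => n; first exact: pos.
by rewrite NegzE GRing.addrC neg.
Qed.

Lemma expz_closed (K : G -> Prop) x n : K 1 -> (forall y z, K y -> K z -> K (y * z)) ->
  (forall y, K y -> K y^-1) -> K x -> K (expz x n).
Proof.
move=> K1 KM KV Kx; have Kp k : K (x ^+ k).
  by elim: k => [|k IH]; rewrite ?expg0 // expgS; exact: KM.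
by case: n => n; [exact: Kp | exact/KV/Kp].
Qed.

Lemma expz_comm x y n : x * y = y * x -> expz x n * y = y * expz x n.
Proof.
move=> xy; apply: (expz_closed (K := fun z => z * y = y * z)) => //.
- by rewrite mulg1 mul1g.
- by move=> u v uy vy; rewrite -mulgA vy !mulgA uy.
by move=> u uy; apply: (@mulgI _ u); rewrite mulVKg mulgA uy mulgK.
Qed.

End IntegerPowers.

(** Each [K] is a subgroup containing the other [t j] and no positive power of [t i]; this gives
    injectivity as one infinite cyclic factor is added at a time. *)
Lemma zpow_embed (G : groupType) (I : eqType) (l : seq I) (t : I -> G) : uniq l ->
  {in l &, forall i j, t i * t j = t j * t i} ->
  (forall i, i \in l -> exists K : G -> Prop, [/\ K 1,
     forall x y, K x -> K y -> K (x * y), forall x, K x -> K x^-1,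
     forall j, j \in l -> j != i -> K (t j) &
     forall x n, K x -> x * t i ^+ n.+1 <> 1]) ->
  exists phi : zpow (size l) -> G, {morph phi : x y / x * y} /\ injective phi.
Proof.
move=> ul tC tK.
suff [phi [phiM phiI _]] : exists phi : zpow (size l) -> G,
    [/\ {morph phi : x y / x * y}, injective phi &
     forall K : G -> Prop, K 1 -> (forall x y, K x -> K y -> K (x * y)) ->
       (forall x, K x -> K x^-1) -> (forall j, j \in l -> K (t j)) -> forall x, K (phi x)].
  by exists phi.
elim: l ul tC tK => [_ _ _|i l IH /andP[il ul] tC tK].
  exists (fun=> 1); split=> // [x y|x y _]; first by rewrite mulg1.
  by rewrite (ord1 x) (ord1 y).
have sub j : j \in l -> j \in i :: l by rewrite in_cons orbC => ->.
have [||phi [phiM phiI phiK]] := IH ul.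
- by move=> j k jl kl; apply: tC; exact: sub.
- move=> j jl; have [K [K1 KM KV Kt Kn]] := tK j (sub j jl); exists K; split=> //.
  by move=> k kl; apply: Kt; exact: sub.
have phiC b n : expz (t i) n * phi b = phi b * expz (t i) n.
  apply: expz_comm; apply/esym; apply: (phiK (fun z => z * t i = t i * z)) b => //.
  - by rewrite mulg1 mul1g.
  - by move=> u v uy vy; rewrite -mulgA vy !mulgA uy.
  - by move=> u uy; apply: (@mulgI _ u); rewrite mulVKg mulgA uy mulgK.
  - by move=> j jl; apply: tC; [exact: sub | exact: mem_head].
exists (fun x : zext (zpow (size l)) => phi x.2 * expz (t i) x.1); split.
- move=> [a b] [a' b'] /=; rewrite expzD phiM -!mulgA; congr (_ * _).
  by rewrite !mulgA phiC.
- have [K [K1 KM KV Kt Kn]] := tK i (mem_head i l).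
  have Kphi b : K (phi b).
    apply: (phiK K) => // j jl; apply: Kt; first exact: sub.
    by apply: contraNneq il => <-.
  move=> [a b] [a' b'] /= E.
  have E1 : (phi b')^-1 * phi b * expz (t i) (a - a')%R = 1.
    by rewrite expzD mulgA -(mulgA _ (phi b)) E mulKg -expzD GRing.addrN.
  have Kb : K ((phi b')^-1 * phi b) by apply: KM => //; exact: KV.
  have aa : a = a'.
    apply/eqP; rewrite -GRing.subr_eq0; apply/eqP.
    case: (a - a')%R E1 => [[//|n] E1|n E1]; first by case: (Kn _ n Kb).
    case: (Kn _ n (KV _ Kb)); apply: (@mulgI _ ((phi b')^-1 * phi b)).
    rewrite mulVKg mulg1; apply: (@mulIg _ (t i ^- n.+1)).
    by rewrite mulgV E1.
  by move: E; rewrite aa => /mulIg/phiI ->.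
move=> K K1 KM KV Kt [a b] /=; apply: (KM).
  by apply: (phiK K) => // j jl; apply: Kt; exact: sub.
by apply: (expz_closed (K := K)) => //; apply: Kt; exact: mem_head.
Qed.

(** * Commuting twists *)

Section Twists.
Variables (V : finType) (e : rel V) (m : V -> nat) (r : V) (par : V -> V).
Hypotheses (m_gt1 : forall v, (1 < m v)%N) (T : rooted e r par).
Variable c0 : V.
Hypothesis c0r : c0 != r.
Local Notation W := (graph_product e m).
Local Notation gen := (gen e m).
Local Notation vert := (vert m_gt1).
Local Notation edge := (edge m_gt1).
Local Notation vertex := (vertex e m_gt1).
Local Notation pt := (pt m_gt1 T c0r).
Local Notation act := (@act V e m r par m_gt1 T c0 c0r).
Local Notation near := (@near V e m r par m_gt1 T c0 c0r).
Local Notation side0 := (@side0 V e m r par m_gt1 T c0 c0r).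
Let e_sym : symmetric e := par_sym T.
Let actM := actM (m_gt1 := m_gt1) T c0r.
Let s0T := side0_tree_like m_gt1 T c0r.
Let s0E := @side0_equiv V e m r par m_gt1 T c0 c0r.
Implicit Types (u v w : V) (g h k : W) (x y z t : vertex).
Let sep := @side0_separated V e m r par m_gt1 T c0 c0r.
Implicit Types (phi psi : aut W).

Let genC v w (vw : e v w) : gen v * gen w = gen w * gen v := gen_comm m vw.

(** Such a [g] maps the fixed point of the edge group to a fixed point of the edge group, and by
    [stab_inj] there is only one. *)
Lemma stab_centralizer u p g : e u p -> g * gen u = gen u * g -> g * gen p = gen p * g ->
  edge u p g.
Proof.
move=> up gu gp; suff /(stabP m_gt1 T c0r _ _ up) : act g (pt u p 1) = pt u p 1.
  by rewrite conjg1.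
apply/esym/(stab_inj sep) => h /(stabP m_gt1 T c0r _ _ up); rewrite conjg1 => eh.
have hg : h * g = g * h.
  have gX v n : g * gen v = gen v * g -> g * gen v ^+ n = gen v ^+ n * g.
    by move=> gv; elim: n => [|n IH]; rewrite ?mulg1 ?mul1g // expgS mulgA gv -mulgA IH mulgA.
  by rewrite eh -mulgA -gX // mulgA -gX // mulgA.
rewrite -actM hg actM; congr act.
by apply/(stabP m_gt1 T c0r _ _ up); rewrite conjg1.
Qed.

(* Ping-pong: [gen p] maps the complement of the half-space at [A] away from [B]
   into it, and symmetrically for [gen q]. *)
Lemma power_moves u p q w n : e u p -> e u q -> e u w -> p != q -> w != p -> w != q ->
  act ((gen p * gen q) ^+ n.+1) (pt u w 1) <> pt u w 1.
Proof.
move=> up uq uw pq wp wq.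
set A := pt u p 1; set B := pt u q 1; set z := pt u w 1.
have neq v v' : e u v -> e u v' -> v != v' -> pt u v 1 <> pt u v' 1.
  move=> uv uv' vv' /(pt_inj uv uv')[_ [[_ E]|[E _]]]; first by rewrite E eqxx in vv'.
  by have := edge_neq T uv; rewrite -E eqxx.
have AB : A <> B by exact: neq.
have zA : z <> A by exact: neq.
have zB : z <> B by exact: neq.
have nr v v' : e u v -> e u v' -> near (pt u v 1) (pt u v' 1).
  by move=> uv uv'; exists u, v, v', 1.
have sA : side0 A B z by right; apply: avoids_near; [| exact/nesym | exact: nr].
have sB : side0 B A z by right; apply: avoids_near; [exact/nesym | exact/nesym | exact: nr].
have pong v v' t : e u v -> e u v' -> v != v' ->
    side0 (pt u v 1) (pt u v' 1) t -> ~ side0 (pt u v 1) (pt u v' 1) (act (gen v) t).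
  move=> uv uv' vv' st st'.
  have fv : act (gen v) (pt u v 1) = pt u v 1.
    apply/(stabP m_gt1 T c0r _ _ uv); rewrite conjg1.
    by apply: vert_edger; [exact: (edge_neq T uv) | exact: vert_gen].
  have adjv : adj side0 (pt u v 1) (pt u v' 1) by apply: near_adj; [exact: nr | exact: neq].
  have /(stabP m_gt1 T c0r _ _ uv') : act (gen v) (pt u v' 1) = pt u v' 1.
    apply: (side0_stabilizer adjv fv); apply: (side_trans s0T) st' _.
    by apply: (side_sym s0T); have := s0E (gen v) st; rewrite fv.
  rewrite conjg1 => /edge_gen[]; last by move/eqP: vv'.
  by move=> E; have := edge_neq T uv; rewrite E eqxx.
have nAB t : ~ side0 A B t -> side0 B A t.
  by move=> n1; case: (side_tree s0T t AB).
have step t : side0 B A t -> ~ side0 A B (act (gen p * gen q) t).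
  move=> st; rewrite actM; apply: (pong p q) => //; case: (side_tree s0T (act (gen q) t) AB) => // st'.
  by case: (pong q p t uq up _ st); rewrite // eq_sym.
have main : ~ side0 A B (act ((gen p * gen q) ^+ n.+1) z).
  elim: n => [|n IH]; first by rewrite expg1; exact: step.
  by rewrite expgS actM; apply: step; case: (side_tree s0T (act ((gen p * gen q) ^+ n.+1) z) AB).
by move=> E; apply: main; rewrite E.
Qed.

Lemma commg_expV (x : W) n g : g * x = x * g -> g * x ^+ n = x ^+ n * g.
Proof.
by move=> gx; elim: n => [|n IH]; rewrite ?mulg1 ?mul1g // expgS mulgA gx -mulgA IH mulgA.
Qed.

(** Otherwise [x * g^-1] centralizes [gen u] and [gen w], so it lies in [edge u w]. As [g] lies in
    [vert u], the power [x] would fix [pt u w 1]. *)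
Lemma power_not_central u p q w n g : e u p -> e u q -> e u w -> p != q -> w != p -> w != q ->
  g * gen u = gen u * g -> g * gen p = gen p * g -> g * gen q = gen q * g ->
  gen w ^ ((gen p * gen q) ^+ n.+1) <> gen w ^ g.
Proof.
move=> up uq uw pq wp wq gu gp gq E; apply: (power_moves (n := n) up uq uw pq wp wq).
have eup := stab_centralizer up gu gp; have euq := stab_centralizer uq gu gq.
have vg : vert u g.
  apply: (edge_vert eup); apply: (edge_eps euq) => //.
  by rewrite eq_sym; exact: (edge_neq T up).
set x := (gen p * gen q) ^+ n.+1 in E *.
have xu : x * gen u = gen u * x.
  apply/esym; apply: commg_expV; rewrite mulgA (genC up) -mulgA (genC uq) mulgA.
  by [].
have yw : edge u w (x * g^-1).
  apply: stab_centralizer => //.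
    rewrite -mulgA; have -> : g^-1 * gen u = gen u * g^-1.
      by apply: (@mulgI _ g); rewrite mulVKg mulgA gu mulgK.
    by rewrite mulgA xu mulgA.
  have E2 : gen w ^ (x * g^-1) = gen w by rewrite conjgM E conjgK.
  by rewrite [RHS]conjgC E2.
apply/(stabP m_gt1 T c0r _ _ uw); rewrite conjg1 -(mulgVK g x).
by apply: (edgeM uw yw); exact: (eVert_edge T uw).
Qed.

(** ** Partial conjugations *)

(** Relations across the boundary of [D] survive because the vertices just outside commute with [x].
    The map fixes [x], so conjugating by [x^-1] on [D] inverts it. *)
Lemma partial_conj (D : pred V) p q : ~~ D p -> ~~ D q ->
  (forall v v', e v v' -> D v -> ~~ D v' -> e v' p /\ e v' q) ->
  exists tau : aut W, forall v, tau (gen v) = if D v then gen v ^ (gen p * gen q) else gen v.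
Proof.
move=> nDp nDq Dedge; set x := gen p * gen q.
have hom (y : W) : (forall v, e v p -> e v q -> gen v * y = y * gen v) ->
    exists F : W -> W, {morph F : a b / a * b} /\
      forall v, F (gen v) = if D v then gen v ^ y else gen v.
  move=> yC; apply: gp_hom => // [v|v v' vv'].
    by case: (D v); rewrite -?conjXg gen_order ?conj1g.
  have cross a b : e a b -> D a -> ~~ D b -> gen a ^ y * gen b = gen b * gen a ^ y.
    move=> ab Da nDb; have [bp bq] := Dedge a b ab Da nDb.
    have -> : gen b = gen b ^ y by rewrite conjgE yC // mulKg.
    by rewrite -!conjMg (genC ab).
  case: (boolP (D v)) => Dv; case: (boolP (D v')) => Dv'.
  - by rewrite -!conjMg (genC vv').
  - exact: cross.
  - by rewrite cross // e_sym.
  - exact: genC.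
have xC v : e v p -> e v q -> gen v * x = x * gen v.
  by move=> vp vq; rewrite mulgA (genC vp) -mulgA (genC vq) mulgA.
have [F [FM FE]] := hom x xC.
have [F' [F'M F'E]] : exists F : W -> W, {morph F : a b / a * b} /\
      forall v, F (gen v) = if D v then gen v ^ x^-1 else gen v.
  apply: hom => v vp vq; apply: (@mulgI _ x); rewrite mulVKg mulgA -xC //.
  by rewrite mulgK.
have Fx : F x = x by rewrite FM !FE (negPf nDp) (negPf nDq).
have F'x : F' x = x by rewrite F'M !F'E (negPf nDp) (negPf nDq).
have homV (H : W -> W) a : {morph H : a b / a * b} -> H a^-1 = (H a)^-1.
  by move=> HM; apply: (@mulgI _ (H a)); rewrite -HM !mulgV hom1.
have homJ (H : W -> W) a b : {morph H : a b / a * b} -> H (a ^ b) = H a ^ H b.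
  by move=> HM; rewrite !conjgE !HM homV.
have FK : cancel F F'.
  apply: (gp_hom_ext (F := F' \o F) (F' := id) m_gt1) => // [a b|v] /=; first by rewrite FM F'M.
  rewrite FE; case: ifP => Dv; last by rewrite F'E Dv.
  by rewrite homJ // F'E Dv F'x conjgKV.
have FK' : cancel F' F.
  apply: (gp_hom_ext (F := F \o F') (F' := id) m_gt1) => // [a b|v] /=; first by rewrite F'M FM.
  rewrite F'E; case: ifP => Dv; last by rewrite FE Dv.
  by rewrite homJ // FE Dv homV // Fx conjgK.
by exists (Aut FM (Bijective FK FK')).
Qed.

Lemma retraction (S : pred V) : exists F : W -> W, {morph F : a b / a * b} /\
  forall v, F (gen v) = if S v then gen v else 1.
Proof.
apply: gp_hom => // [v|v v' vv']; first by case: (S v); rewrite ?gen_order ?expg1n.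
by case: (S v); case: (S v'); rewrite ?mulg1 ?mul1g ?(genC vv').
Qed.

(** ** Twists *)

Definition child u v := (v != r) && (par v == u).

(* A chosen child of [u]; [u] itself when there is none. *)
Definition first_child u := odflt u [pick v | child u v].

Definition twister w := [&& w != r, par w != r & w != first_child (par w)].

Definition twx w : W := gen (par (par w)) * gen (first_child (par w)).

Local Notation desc := (desc par).

Lemma first_childP w : w != r -> child (par w) (first_child (par w)).
Proof.
move=> wr; rewrite /first_child; case: pickP => [//|/(_ w)].
by rewrite /child wr eqxx.
Qed.

Section OneTwister.
Variable w : V.
Hypothesis tw : twister w.
Let u := par w.
Let p := par u.
Let q := first_child u.

Lemma twister_facts : [/\ w != r, u != r, w != q, q != r & par q = u].
Proof.
have /and3P[wr ur wq] := tw; have /andP[qr /eqP pq] := first_childP wr.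
by split.
Qed.

Lemma twister_edges : [/\ e u p, e u q & e u w].
Proof.
have [wr ur wq qr pq] := twister_facts; split; first exact: par_adj T u ur.
  by rewrite e_sym -pq; exact: par_adj T q qr.
by rewrite e_sym; exact: par_adj T w wr.
Qed.

Lemma twister_ndesc : [/\ ~~ desc w u, ~~ desc w p & ~~ desc w q].
Proof.
have [wr ur wq qr pq] := twister_facts.
have nu : ~~ desc w u by apply/negP => /(desc_par_neq T wr); rewrite eqxx.
split=> //; apply/negP => h; case/negP: nu; first exact: par_desc.
by rewrite -pq; apply: desc_par => //; rewrite eq_sym.
Qed.

Lemma twister_neq : [/\ p != q, w != p & w != q].
Proof.
have [wr ur wq qr pq] := twister_facts; have [nu np nq] := twister_ndesc.
split=> //; last by apply: contraNneq np => <-; exact: desc_refl.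
apply/eqP => E; have := @par_cycle _ _ _ _ T q 1; rewrite /= pq -/p E => /(_ erefl) E'.
by rewrite E' eqxx in qr.
Qed.

Lemma twist_exists : exists tau : aut W, forall v,
  tau (gen v) = if desc w v then gen v ^ twx w else gen v.
Proof.
have [wr ur wq qr pq] := twister_facts; have [nu np nq] := twister_ndesc.
have [up uq uw] := twister_edges.
apply: partial_conj => // v v' vv' dv ndv'.
by have [_ ->] := desc_boundary T vv' dv ndv'.
Qed.

End OneTwister.

Definition twist w : aut W :=
  if boolP (twister w) is AltTrue tw then projT1 (cid (twist_exists tw)) else 1.

Lemma twistE w v : twister w -> twist w (gen v) = if desc w v then gen v ^ twx w else gen v.
Proof.
by move=> tw; rewrite /twist; case: {-}_ / boolP => [tw'|/negP//]; case: cid.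
Qed.

Lemma twist_self w : twister w -> twist w (twx w) = twx w.
Proof.
move=> tw; have [nu np nq] := twister_ndesc tw.
by rewrite /twx autM !twistE // (negPf np) (negPf nq).
Qed.

(* When [par w' = w], the vertex [par (par w')] lies outside [desc w], but its
   generator commutes with [twx w]. *)
Lemma twist_nested w w' : twister w -> twister w' -> desc w w' -> w' != w ->
  twist w (twx w') = twx w' ^ twx w.
Proof.
move=> tw tw' dw w'w; have [wr ur wq qr pq] := twister_facts tw.
have [wr' ur' wq' qr' pq'] := twister_facts tw'.
have du' := desc_par dw w'w.
have dq' : desc w (first_child (par w')) by apply: par_desc; rewrite pq'.
rewrite /twx autM !twistE // dq' conjMg; congr (_ * _).
case: ifP => // /negP ndp'; have u'w : par w' = w.
  by apply/eqP; apply/negPn/negP => n; apply: ndp'; exact: desc_par.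
have [up uq uw] := twister_edges tw.
have C : gen (par w) * twx w = twx w * gen (par w).
  by rewrite /twx mulgA (genC up) -mulgA (genC uq) mulgA.
by rewrite u'w conjgE -/(twx w) C mulKg.
Qed.

Lemma twist_unrelated w w' : twister w -> twister w' -> ~~ desc w w' ->
  twist w (twx w') = twx w'.
Proof.
move=> tw tw' ndw; have [wr ur wq qr pq] := twister_facts tw.
have [wr' ur' wq' qr' pq'] := twister_facts tw'.
have ndu' : ~~ desc w (par w') by apply: contra ndw; exact: par_desc.
have ndp' : ~~ desc w (par (par w')) by apply: contra ndu'; exact: par_desc.
have ndq' : ~~ desc w (first_child (par w')).
  apply/negP => dq'; case: (eqVneq (first_child (par w')) w) => [E|n].
    have pw : par w = par w' by rewrite -E pq'.
    by rewrite pw E eqxx in wq.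
  by case/negP: ndu'; rewrite -pq'; exact: desc_par.
by rewrite /twx autM !twistE // (negPf ndp') (negPf ndq').
Qed.

Lemma desc_comparable w w' v : desc w v -> desc w' v -> desc w w' || desc w' w.
Proof.
move=> /asboolP[i iE] /asboolP[j jE]; case: (leqP i j) => ij.
  apply/orP; right; apply/asboolP; exists (j - i)%N.
  by rewrite -iE -iterD subnK.
apply/orP; left; apply/asboolP; exists (i - j)%N.
by rewrite -jE -iterD subnK // ltnW.
Qed.

(** Unrelated twists fix each other's twisting elements. If one is nested in the other, the outer
    one conjugates by the same element both the generators moved by the inner one and its twisting
    element. *)
Lemma twistC w w' : twister w -> twister w' -> twist w * twist w' = twist w' * twist w.
Proof.
have nested a b : twister a -> twister b -> desc a b -> b != a ->
    forall v, twist a (twist b (gen v)) = twist b (twist a (gen v)).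
  move=> ta tb dab nab v; have ndba : ~~ desc b a.
    by apply: contra nab => dba; apply/eqP; exact: desc_anti T _ _ dba dab.
  have xa := twist_unrelated tb ta ndba; have xb := twist_nested ta tb dab nab.
  case: (boolP (desc b v)) => dbv.
    have dav := desc_trans dab dbv; rewrite !twistE // dav dbv !aut_conjg xa xb !twistE // dav dbv.
    by rewrite -conjJg.
  have Eb : twist b (gen v) = gen v by rewrite twistE // (negPf dbv).
  by rewrite Eb twistE //; case: ifP => _; rewrite ?aut_conjg Eb ?xa.
move=> tw tw'; apply: aut_ext => g.
apply: (gp_hom_ext m_gt1) => [x y|x y|v]; try exact: autM.
rewrite -[LHS]/(twist w (twist w' (gen v))) -[RHS]/(twist w' (twist w (gen v))).
case: (eqVneq w' w) => [->//|ne].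
case: (boolP (desc w w')) => dw; first exact: nested.
case: (boolP (desc w' w)) => dw'; first by apply/esym/nested; rewrite // eq_sym.
have xw := twist_unrelated tw tw' dw; have xw' := twist_unrelated tw' tw dw'.
rewrite !twistE //; case: (boolP (desc w v)) => dv; case: (boolP (desc w' v)) => dv'.
- by have := desc_comparable dv dv'; rewrite (negPf dw) (negPf dw').
- by rewrite aut_conjg xw' !twistE // dv (negPf dv').
- by rewrite aut_conjg xw !twistE // (negPf dv) dv'.
by rewrite !twistE // (negPf dv) (negPf dv').
Qed.

(** ** Independence *)

(** The star detecting the twist at [w]: with all other generators killed, the twisting element of
    any other twist that moves a generator of the star becomes 1. *)
Definition support w : pred V := [pred v | v \in [:: par w; par (par w); first_child (par w); w]].

Definition project w : W -> W := projT1 (cid (retraction (support w))).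

Lemma projectM w : {morph project w : x y / x * y}.
Proof. by rewrite /project; case: cid => F []. Qed.

Lemma project_gen w v : project w (gen v) = if support w v then gen v else 1.
Proof. by rewrite /project; case: cid => F []. Qed.

Lemma projectJ w g h : project w (g ^ h) = project w g ^ project w h.
Proof.
have rV a : project w a^-1 = (project w a)^-1.
  by apply: (@mulgI _ (project w a)); rewrite -projectM !mulgV (hom1 (@projectM w)).
by rewrite !conjgE !projectM rV.
Qed.

Lemma project_twist w w' g : twister w -> twister w' -> w' != w -> project w (twist w' g) = project w g.
Proof.
move=> tw tw' ne; move: g.
apply: (gp_hom_ext m_gt1) => [x y|x y|v]; rewrite ?autM ?projectM //.
rewrite twistE //; case: ifP => // dv; rewrite projectJ project_gen.
case: ifP => Sv; last by rewrite conj1g.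
have [wr ur wq qr pq] := twister_facts tw; have [wr' ur' wq' qr' pq'] := twister_facts tw'.
have [nu' np' nq'] := twister_ndesc tw'.
have du : desc w' (par w).
  move: Sv; rewrite /support !inE => /or4P[] /eqP E; rewrite E in dv => //.
  - exact: par_desc.
  - rewrite -pq; apply: desc_par => //; apply: contraNneq wq' => E'.
    by rewrite -E' pq.
  - by apply: desc_par => //; rewrite eq_sym.
have dw : desc w' w by exact: par_desc.
have dq : desc w' (first_child (par w)) by apply: par_desc; rewrite pq.
have cyc a : a != r -> par a != a by exact: par_neq T a.
suff [S1 S2] : ~~ support w (par (par w')) /\ ~~ support w (first_child (par w')).
  by rewrite /twx projectM !project_gen (negPf S1) (negPf S2) mulg1 conjg1.
split; rewrite /support !inE; apply/negP => /or4P[] /eqP E; try by rewrite E ?du ?dw ?dq in np' nq'.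
- case: (eqVneq (par w) w') => [E'|n]; last by rewrite E desc_par in np'.
  by have := cyc _ ur'; rewrite E E' eqxx.
- case: (eqVneq (par w) w') => [E'|n]; last by rewrite E desc_par in nq'.
  by have := cyc _ ur'; rewrite -{1}E' -E pq' eqxx.
Qed.

Lemma autX (G : groupType) (f : aut G) (a : G) n : f (a ^+ n) = f a ^+ n.
Proof. by elim: n => [|n IH]; rewrite ?expg0 ?aut1E // !expgS autM IH. Qed.

Lemma twistX w n v : twister w ->
  (twist w ^+ n) (gen v) = if desc w v then gen v ^ (twx w ^+ n) else gen v.
Proof.
move=> tw; elim: n => [|n IH]; first by rewrite !expg0 conjg1; case: ifP.
rewrite expgS -[LHS]/(twist w ((twist w ^+ n) (gen v))) IH; case: ifP => dv; last by rewrite twistE // dv.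
by rewrite aut_conjg autX twist_self // twistE // dv -conjgM expgS.
Qed.

Lemma project_twistX w w' n g : twister w -> twister w' -> w' != w ->
  project w ((twist w' ^+ n) g) = project w g.
Proof.
move=> tw tw' ne; elim: n => [//|n IH].
by rewrite expgS -[X in project w X]/(twist w' ((twist w' ^+ n) g)) project_twist.
Qed.

(** Were it conjugation by [g], the projection of [g] would commute with the generators at the
    parent, grandparent and sibling, yet act on [gen w] as a power of [twx w], which
    [power_not_central] excludes. *)
Lemma twist_independent w psi n : twister w -> (forall g, project w (psi g) = project w g) ->
  psi * twist w ^+ n.+1 \notin @inn W.
Proof.
move=> tw psiE; apply/negP => /innP[g gE].
have [up uq uw] := twister_edges tw; have [pq wp wq] := twister_neq tw.
have [nu np nq] := twister_ndesc tw.
have E v : project w ((twist w ^+ n.+1) (gen v)) = project w (gen v) ^ project w g.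
  by rewrite -psiE -[X in X = _]/(project w ((psi * twist w ^+ n.+1) (gen v))) gE projectJ.
have fixed v : support w v -> ~~ desc w v -> project w g * gen v = gen v * project w g.
  move=> Sv nv; have := E v; rewrite twistX // (negPf nv) project_gen Sv => E'.
  by rewrite [RHS]conjgC -E'.
have [Su Sp Sq Sw] : [/\ support w (par w), support w (par (par w)),
    support w (first_child (par w)) & support w w].
  by rewrite /support !inE !eqxx !orbT.
have rx : project w (twx w ^+ n.+1) = twx w ^+ n.+1.
  elim: n.+1 => [|k IH]; first by rewrite expg0 (hom1 (@projectM w)).
  by rewrite !expgS projectM IH /twx projectM !project_gen Sp Sq.
have := E w; rewrite twistX // desc_refl projectJ rx project_gen Sw.
exact: (power_not_central up uq uw pq wp wq (fixed _ Su nu) (fixed _ Sp np) (fixed _ Sq nq)).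
Qed.

Local Open Scope quotient_scope.

Theorem out_lower_bound (H : subgroup (out W)) (k : nat) : finite_index H ->
  cd_le (subgroup_group H) k -> (#|[set w | twister w]| <= k)%N.
Proof.
move=> fH cdH; pose l := enum [set w | twister w].
have lP w : w \in l <-> twister w by rewrite mem_enum inE.
have exn w : exists n, (\pi_(out W) (twist w) : out W) ^+ n.+1 \in H by exact: finite_index_power.
pose n w := projT1 (cid (exn w)).
have nP w : (\pi_(out W) (twist w) : out W) ^+ (n w).+1 \in H by rewrite /n; case: cid.
pose t w : subgroup_group H := Sub ((\pi_(out W) (twist w) : out W) ^+ (n w).+1) (nP w).
have piX (phi : aut W) j : (\pi_(out W) phi : out W) ^+ j = \pi_(out W) (phi ^+ j).
  by elim: j => [//|j IH]; rewrite !expgS IH out_piM.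
have [||| phi [phiM phiI]] := @zpow_embed (subgroup_group H) V l t.
- exact: enum_uniq.
- move=> w w' /lP tw /lP tw'; apply: val_inj.
  rewrite -[LHS]/(val (t w) * val (t w')) -[RHS]/(val (t w') * val (t w)) /=.
  apply: commuteX2; rewrite /commute -!out_piM.
  by rewrite twistC.
- move=> w /lP tw.
  (* The subgroup [K] for [w]: classes with a representative invisible after projection to the star
     of [w]. *)
  exists (fun a : subgroup_group H => exists psi, \pi_(out W) psi = val a /\ forall g, project w (psi g) = project w g); split.
  + by exists 1.
  + move=> a b [phi [ex phiE]] [psi [ey psiE]]; exists (phi * psi); split.
      by rewrite out_piM ex ey.
    by move=> g; rewrite -[X in project w X]/(phi (psi g)) phiE psiE.
  + move=> a [phi [ex phiE]]; exists phi^-1; split; first by rewrite out_piV ex.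
    by move=> g; rewrite -phiE; congr (project w _); exact: aut_invVK.
  + move=> w' /lP tw' ne; exists (twist w' ^+ (n w').+1); split; first by rewrite /= piX.
    by move=> g; exact: project_twistX.
  + move=> a j [psi [ex psiE]] /(congr1 val).
    rewrite -[X in X = _]/(val a * val (t w ^+ j.+1)).
    rewrite val_expg /= piX piX -expgnA -ex -out_piM => E1.
    have : psi * twist w ^+ ((n w).+1 * j.+1) \in @inn W.
      have /(quotient_eq (@inn_normal W)) := esym E1 : \pi_(out W) 1 = _.
      by rewrite invg1 mul1g.
    by apply/negP; rewrite mulSn addSn; exact: twist_independent.
have pdH := cd_le_pd cdH.
have := zpow_pd (restrict_pd_Z phiM phiI pdH).
by rewrite -cardE.
Qed.

End Twists.

(** * Counting leaves and twists *)

Section Count.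
Variables (V : finType) (e : rel V) (r : V) (par : V -> V).
Hypothesis T : rooted e r par.
Variable c0 : V.
Hypothesis c0r : c0 != r.
Local Notation deg := (degree e).

Lemma leaf_exists : exists v, deg v = 1%N.
Proof.
apply: contrapT => nex; have : (2 * #|V| <= \sum_u deg u)%N.
  rewrite mulnC -sum_nat_const; apply: leq_sum => u _.
  have d1 : deg u <> 1%N by move=> E; apply: nex; exists u.
  by have := deg_gt0 T c0r u; move: d1; rewrite -/(deg u); case: (deg u) => [|[|k]].
rewrite (degree_total T) leq_pmul2l //.
have : (0 < #|V|)%N by apply/card_gt0P; exists r.
by case: #|V| => //= n _; rewrite ltnn.
Qed.

(** A vertex [u] other than the root has [deg u - 1] children, and all but the distinguished one are
    counted; at a leaf the truncated subtraction gives 0. *)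
Lemma card_twisters :
  #|[set w | twister r par w]| = (\sum_(u | u != r) (deg u - 2))%N.
Proof.
rewrite -sum1dep_card.
rewrite (partition_big par (fun u => u != r)) /=; last by move=> w /and3P[].
apply: eq_bigr => u ur; rewrite sum1dep_card (deg_children T) ur addn1 subSS subn1.
case: (pickP (child r par u)) => [c cu|nc]; last first.
  rewrite (_ : [set _ | _] = set0) ?cards0; last first.
    by apply/setP => w; rewrite !inE /twister; apply/negP => /andP[/and3P[wr _ _] pw]; have := nc w; rewrite /child wr pw.
  by rewrite (_ : [set _ | _] = set0) ?cards0 //; apply/setP => w; rewrite !inE; exact: nc.
have /andP[cr /eqP pc] := cu; have fP := first_childP par cr; rewrite pc in fP.
rewrite (cardsD1 (first_child r par u) [set v | (v != r) && (par v == u)]) inE.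
have -> : (first_child r par u != r) && (par (first_child r par u) == u) by exact: fP.
rewrite add1n /=; apply: eq_card => w; rewrite !inE /twister.
case: (eqVneq (par w) u) => [->|_]; rewrite ?andbF // ur !andbT /=.
by rewrite andbC.
Qed.

(* Summing [(deg u - 2) + 2 = deg u + [deg u = 1]] over the vertices other than
   the root, which is a leaf. *)
Lemma leaves_twisters : deg r = 1%N -> (#|leaves e| = #|[set w | twister r par w]| + 2)%N.
Proof.
move=> dr; have E : (\sum_(u | u != r) (deg u - 2) + \sum_(u | u != r) 2 =
    \sum_(u | u != r) deg u + \sum_(u | u != r) (deg u == 1))%N.
  rewrite -!big_split /=; apply: eq_bigr => u _.
  by have := deg_gt0 T c0r u; case: (deg u) => [|[|k]] //= _; lia.
have := degree_total T; rewrite (bigD1 r) //= dr => dT.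
rewrite (card_leaves e) card_twisters (bigD1 r) //= dr eqxx.
move: E; rewrite sum_nat_const (card_nonroot r) => E.
have : (0 < #|V|)%N by apply/card_gt0P; exists r.
have : (1 < #|V|)%N by apply/card_gt1P; exists c0, r.
move: E dT; set a := (\sum_(_ | _) _)%N; set b := (\sum_(_ | _) deg _)%N; set c := (\sum_(_ | _) (_ == _))%N.
by case: #|V| => [|n] /=; lia.
Qed.

End Count.

(** * The one-vertex case *)

Lemma trivial_group_cd_le (G : groupType) n : (forall x : G, x = 1) -> cd_le G n.
Proof.
move=> G1; apply: (@acyclic_cd_le G unit (fun _ _ => false) predT (fun _ t => t) n tt) => //.
- have ltxx : irreflexive (fun _ _ : unit => false) by [].
  have lt_trans : transitive (fun _ _ : unit => false) by [].
  by apply: (acyclic_cone ltxx lt_trans (isT : predT tt)) => -[].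
by move=> [|t [|u s]] // /andP[].
Qed.

Section TrivialSubgroup.
Variable G : groupType.

Definition trivial_pred : {pred G} := fun x => x == 1.

Lemma trivial_pred_mul : mulg_closed trivial_pred.
Proof. by move=> x y /eqP -> /eqP ->; rewrite mulg1; exact: eqxx. Qed.

Lemma trivial_pred1 : 1 \in trivial_pred.
Proof. exact: eqxx. Qed.

Lemma trivial_pred_inv : invg_closed trivial_pred.
Proof. by move=> x /eqP ->; rewrite invg1; exact: eqxx. Qed.

HB.instance Definition _ := isMulClosed.Build G trivial_pred trivial_pred_mul.
HB.instance Definition _ := isMul1Closed.Build G trivial_pred trivial_pred1.
HB.instance Definition _ := isInvClosed.Build G trivial_pred trivial_pred_inv.

Definition trivial_subgroup : subgroup G := trivial_pred.

Lemma trivial_subgroup_torsion_free : torsion_free (subgroup_group trivial_subgroup).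
Proof. by move=> x n _ _; apply: val_inj; exact/eqP/(valP x). Qed.

Lemma finite_group_torsion_free (H : subgroup G) : finite_index trivial_subgroup ->
  torsion_free (subgroup_group H) -> forall x : subgroup_group H, x = 1.
Proof.
move=> fG tfH x; have [n /eqP xn] := finite_index_power (val x) fG.
by apply: (tfH x n.+1) => //; apply: val_inj; rewrite val_expg.
Qed.

End TrivialSubgroup.

Local Open Scope quotient_scope.

Lemma one_vertex_finite (V : finType) (e : rel V) (m : V -> nat) (v : V) :
  (forall u, (1 < m u)%N) -> (forall u, u = v) ->
  finite_index (trivial_subgroup (out (graph_product e m))).
Proof.
move=> m_gt1 Vv.
pose D (p : out (graph_product e m)) := eps m_gt1 v (repr p (gen e m v)).
apply: (@finite_index_map _ _ _ D) => p q E.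
have vertW (g : graph_product e m) : vert m_gt1 v g.
  elim/(@gp_ind V e m m_gt1): g => [|g u vg]; first exact: vert1.
  apply: vertM => //; rewrite (Vv u); have := vertX e m_gt1 v 1; by rewrite expg1.
have -> : p = q; last by rewrite mulVg; exact: eqxx.
rewrite -[p]reprK -[q]reprK; congr (\pi_(out _) _); apply: aut_ext.
apply: (gp_hom_ext m_gt1) => [x y|x y|u]; [exact: autM | exact: autM |].
by rewrite (Vv u) (vertW (repr p _)) (vertW (repr q _)) -/(D p) E.
Qed.

End TreeStructures.

Import Homology TreeStructures.

(* The subtraction is truncated. A tree with at least two vertices has at least
   two leaves, so it agrees with the integer one; for the one-vertex tree, which
   has no leaf, the outer automorphism group is finite and the value is 0. *)
Theorem corollary8p12 (V : finType) (e : rel V) (m : V -> nat)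
    (Vn0 : (0 < #|V|)%N) (eS : simple_graph e)
    (mP : forall v : V, prime_power (m v)) (eT : is_tree e) :
  virtually_torsion_free (out (graph_product e m)) /\
  vcd_eq (out (graph_product e m)) (#|leaves e| - 2)%N.
Proof.
have m_gt1 v : (1 < m v)%N.
  by have [p [a [pp a0 ->]]] := mP v; rewrite -(expn0 p) ltn_exp2l ?prime_gt1.
have [esym eirr] := eS; have /card_gt0P[r0 _] := Vn0.
case: (leqP #|V| 1) => [V1|V2]; last first.
  have other (r : V) : exists c, c != r.
    have /card_gt1P[x [y [_ _ xy]]] := V2; case: (eqVneq x r) => [xr|]; last by exists x.
    by exists y; rewrite -xr eq_sym.
  (* The arbitrary first root only serves to find a leaf, which the count of twists requires as
     root. *)
  have [par0 T0] := tree_rooted eirr esym r0 eT; have [c00 c00r] := other r0.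
  have [r dr] := leaf_exists T0 c00r.
  have [par T] := tree_rooted eirr esym r eT; have [c0 c0r] := other r.
  have [vtf upper] := out_upper_bound m_gt1 T c0r.
  split=> //; split=> // H fH tfH; split; first exact: upper.
  move=> k; rewrite (leaves_twisters T c0r dr) addnK.
  exact: (out_lower_bound m_gt1 T c0r).
have Vr u : u = r0 by move/card_le1_eqP: V1; apply.
have fin := one_vertex_finite e m_gt1 Vr.
have vtf : virtually_torsion_free (out (graph_product e m)).
  by exists (trivial_subgroup _); split=> //; exact: trivial_subgroup_torsion_free.
split=> //; split=> // H _ tfH; split.
  by apply: trivial_group_cd_le; exact: finite_group_torsion_free.
suff -> : leaves e = set0 by rewrite cards0.
apply/setP => v; rewrite !inE; apply/negbTE.
rewrite (_ : [set w | e v w] = set0) ?cards0 //; apply/setP => w.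
by rewrite !inE (Vr w) (Vr v) eirr.
Qed.
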